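(* Let $C_1$ and $C_2$ be two distinct parallel circles of positive radius in $\mathbb{R}^3$ centered about a common axis $\Gamma$, and let $\mathcal{S}$ be the set of connected rectifiable surfaces of revolution with boundary $C_1, C_2$ defined in the context. Assume there is a catenoid $\Sigma_{\mathrm{cat}}$ which is the unique area minimizing surface with boundary given by $C_1$ and $C_2$. Let $(\Sigma_j)_{j\ge1}$ be a sequence of surfaces in $\mathcal{S}$ such that $$\liminf_{j\to\infty}\frac{\lambda_j(\Sigma_j)}{j}\ge\frac{4\pi}{\mathrm{Area}(\Sigma_{\mathrm{cat}})}.$$ Then $$\lim_{j\to\infty}\mathrm{Area}(\Sigma_j)=\mathrm{Area}(\Sigma_{\mathrm{cat}}).$$ Moreover $\Sigma_j$ converges to $\Sigma_{\mathrm{cat}}$ in the Hausdorff metric.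
   Context: Surfaces. $\Gamma$ is a line in $\mathbb{R}^3$; $C_1, C_2$ are distinct circles of positive radii lying in planes perpendicular to $\Gamma$ and centered on $\Gamma$; $D_1,D_2$ are the planar discs bounded by $C_1,C_2$. $\mathcal{S}$ is the set of connected surfaces of revolution $\Sigma$ about $\Gamma$ such that (i) $\Sigma$ has two boundary components, given by $C_1$ and $C_2$; (ii) $\Sigma$ is disjoint from $\Gamma$; (iii) a meridian of $\Sigma$ (the intersection of $\Sigma$ with a half-plane bounded by $\Gamma$) is an oriented rectifiable curve from $C_1$ to $C_2$, i.e. a curve admitting a Lipschitz parametrization. Curves. Fix an open half-plane in $\mathbb{R}^3$ bounded by $\Gamma$ and identify it with $\mathbb{R}^2_+ = \{(x,y)\in\mathbb{R}^2 : x>0\}$, where $x$ is the distance to $\Gamma$. Let $p, q$ be the points where $\mathbb{R}^2_+$ meets $C_1, C_2$, respectively. Let $\mathcal{R}$ be the set of Lipschitz functions $\alpha:[0,1]\to\mathbb{R}^2_+$ with $\alpha(0)=p$, $\alpha(1)=q$, and such that there is a constant $L$ with $|\alpha'(t)|=L$ for almost every $t$. Curves $\alpha\in\mathcal{R}$ correspond bijectively to surfaces $\Sigma\in\mathcal{S}$ ($\alpha$ is the constant speed parametrization of the meridian). If $\Sigma$ corresponds to $\alpha=(F,G)$, then $\mathrm{Area}(\Sigma)=2\pi\int_0^1F|\alpha'|\,dt$. Eigenvalues. Let $\mathrm{Lip}_0(0,1)$ be the space of Lipschitz functions $w:[0,1]\to\mathbb{R}$ with $w(0)=w(1)=0$.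 For $\alpha=(F,G)\in\mathcal{R}$, integers $k\ge 0$, $n\ge 1$, define $$\lambda_{k,n}(\alpha)=\min_W\max_{w\in W\setminus\{0\}}\frac{\int_0^1 \frac{|w'|^2F}{|\alpha'|}+\frac{k^2|w|^2|\alpha'|}{F}\,dt}{\int_0^1|w|^2F|\alpha'|\,dt},$$ the minimum being over all $n$-dimensional subspaces $W$ of $\mathrm{Lip}_0(0,1)$. Only finitely many $\lambda_{k,n}(\alpha)$ lie in any bounded set. The numbers $\lambda_1(\alpha)\le\lambda_2(\alpha)\le\dots$ are the non-decreasing enumeration of all $\lambda_{k,n}(\alpha)$ ($k\ge0$, $n\ge1$), where each $\lambda_{k,n}(\alpha)$ with $k\ne0$ is counted twice and each $\lambda_{0,n}(\alpha)$ once. For the surface $\Sigma\in\mathcal{S}$ corresponding to $\alpha$, $\lambda_j(\Sigma)=\lambda_j(\alpha)$; for smooth $\Sigma$ these are the Dirichlet eigenvalues of $-\Delta_\Sigma$, where $\Delta_\Sigma$ is the Laplace-Beltrami operator. Area minimizers. ''Area minimizing surface with boundary given by $C_1$ and $C_2$'' refers to the Plateau problem in $\mathbb{R}^3$; the competitors include every surface in $\mathcal{S}$ as well as the disconnected surface $D_1\cup D_2$. A catenoid with this boundary means a piece of a catenoid (a catenary rotated about $\Gamma$) bounded by $C_1$ and $C_2$; it belongs to $\mathcal{S}$. *)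

(* Defs.v *)
From HB Require Import structures.
From mathcomp Require Export all_boot all_order all_algebra.
From mathcomp Require Export all_classical all_reals all_analysis.
Set Implicit Arguments.
Unset Strict Implicit.
Unset Printing Implicit Defensive.
Import Order.TTheory GRing.Theory Num.Theory.
Import numFieldNormedType.Exports.
Local Open Scope classical_set_scope.
Local Open Scope ring_scope.

Section euclidean_space.
Context {R : realType}.
Local Notation R3 := 'rV[R]_3.

Definition dotv (x y : R3) : R := \sum_(i < 3) x 0 i * y 0 i.

(* The norm `|x| of the library on row vectors is the sup norm. *)
Definition enorm (x : R3) : R := Num.sqrt (dotv x x).

Definition hausdorff_dist (A B : set R3) : \bar R :=
  let excess (X Y : set R3) : \bar R :=
    ereal_sup [set ereal_inf [set (enorm (x - y))%:E | y in Y] | x in X] in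
  Order.max (excess A B) (excess B A).

(* The axis Gamma is the line through o with unit direction vector u;
   o + h *: u is its point at height h. *)
Definition circle (o u : R3) (r h : R) : set R3 :=
  [set x | dotv (x - (o + h *: u)) u = 0 /\ enorm (x - (o + h *: u)) = r].

Definition disc (o u : R3) (r h : R) : set R3 :=
  [set x | dotv (x - (o + h *: u)) u = 0 /\ enorm (x - (o + h *: u)) <= r].

(* Rotation about Gamma of a subset of the half-plane; a point (x, y) of the
   half-plane has distance x to Gamma and height y along Gamma. *)
Definition revolve (o u : R3) (A : set (R * R)) : set R3 :=
  [set v | exists a e, [/\ A a, enorm e = 1, dotv e u = 0 &
                           v = o + a.2 *: u + a.1 *: e]].

End euclidean_space.

(* A curve alpha = (F, G) on [0, 1] is represented by a function on R, whose
   values outside [0, 1] are irrelevant. *)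
Section curves.
Context {R : realType}.
Local Notation mu := (@lebesgue_measure R).
Implicit Types (alpha : R -> R * R) (w : R -> R).

(* |alpha'(t)|, meaningful wherever F and G are differentiable at t, hence
   for almost every t in [0, 1] when alpha is Lipschitz on [0, 1] *)
Definition speed alpha (t : R) : R :=
  Num.sqrt ((derive1 (fun s => (alpha s).1) t) ^+ 2 +
            (derive1 (fun s => (alpha s).2) t) ^+ 2).

Definition meridian (p q : R * R) : set (R -> R * R) :=
  [set alpha : R -> R * R |
    [/\ [lipschitz alpha t | t in (`[0, 1] : set R)],
        forall t : R, t \in `[0, 1] -> 0 < (alpha t).1,
        alpha 0 = p, alpha 1 = q &
        exists L : R, {ae mu, forall t, t \in `[0, 1] -> speed alpha t = L}]].

Definition surface (o u : 'rV[R]_3) alpha : set 'rV[R]_3 :=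
  revolve o u (alpha @` `[0, 1]).

Definition area alpha : R :=
  2 * pi * Rintegral mu `[0, 1] (fun t => (alpha t).1 * speed alpha t).

(* The constant speed parametrization of an arc of a catenary
   x = c cosh ((y - b) / c). *)
Definition catenary_arc alpha : Prop :=
  (exists c b : R, 0 < c /\ forall t, t \in `[0, 1] ->
     let s := ((alpha t).2 - b) / c in
     (alpha t).1 = c * ((expR s + expR (- s)) / 2)) /\
  {in `[0, 1] &, injective alpha}.

(* Lip_0(0, 1), each function being extended by 0 outside [0, 1]; the extension
   is Lipschitz on R, and equality on [0, 1] becomes equality of functions. *)
Definition Lip0 : set (R -> R) :=
  [set w : R -> R | [lipschitz w t | t in (setT : set R)] /\ forall t : R, t \notin `]0, 1[ -> w t = 0].

Definition Lip0_subspace (n : nat) (W : set (R -> R)) : Prop :=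
  exists b : 'I_n -> R -> R,
    [/\ forall i, Lip0 (b i),
        forall c : 'I_n -> R,
          (forall t, \sum_(i < n) c i * b i t = 0) -> forall i, c i = 0 &
        W = [set w | exists c : 'I_n -> R,
                       w = fun t => \sum_(i < n) c i * b i t]].

Definition rayleigh alpha (k : nat) w : R :=
  Rintegral mu `[0, 1] (fun t =>
    (derive1 w t) ^+ 2 * (alpha t).1 / speed alpha t +
    k%:R ^+ 2 * (w t) ^+ 2 * speed alpha t / (alpha t).1) /
  Rintegral mu `[0, 1] (fun t => (w t) ^+ 2 * (alpha t).1 * speed alpha t).

(* For n >= 1 and alpha in [meridian p q] with p <> q, both the minimum and the
   maximum are attained and finite. *)
Definition lambda_kn alpha (k n : nat) : \bar R :=
  ereal_inf [set ereal_sup [set (rayleigh alpha k w)%:E | w in W `\ (fun=> 0)]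
            | W in Lip0_subspace n].

(* The pair (z, n) : int * nat stands for lambda_{|z|, n+1}, so that each
   k <> 0 occurs twice and k = 0 once. *)
Definition is_enumeration alpha (l : nat -> \bar R) : Prop :=
  {homo l : i j / (i <= j)%N >-> (i <= j)%E} /\
  exists e : nat -> int * nat, bijective e /\
    forall i, l i = lambda_kn alpha `|(e i).1|%N (e i).2.+1.

(* lambda_j for j >= 1. The default value is never used for alpha in
   [meridian p q] with p <> q, whose enumeration exists and is unique. *)
Definition lambda alpha (j : nat) : \bar R :=
  xget (fun=> 0%E) [set l | is_enumeration alpha l] j.-1.

End curves.

Section plateau.
Context {R : realType}.
Variables (o u : 'rV[R]_3) (r1 h1 r2 h2 : R).

(* A class of competitors in the Plateau problem: a competitor is a subset of
   R^3 paired with its area (which, for a surface whose meridian overlaps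
   itself, counts multiplicity). *)
Definition plateau_class (K : set (set 'rV[R]_3 * \bar R)) : Prop :=
  (forall alpha, meridian (r1, h1) (r2, h2) alpha ->
     K (surface o u alpha, (area alpha)%:E)) /\
  K (disc o u r1 h1 `|` disc o u r2 h2,
     (pi * r1 ^+ 2 + pi * r2 ^+ 2)%:E).

Definition unique_area_minimizer (K : set (set 'rV[R]_3 * \bar R)) X : Prop :=
  K X /\ forall Y, K Y -> Y <> X -> (X.2 < Y.2)%E.

End plateau.

(* Main.v *)
(* A surface whose meridian stays at distance at least delta from the axis
   satisfies a Weyl upper bound on its eigenvalues that is uniform in the
   surface: cut the meridian into short arcs of equal length, compare each arc
   with a flat cylinder and use products of sines with rotations as test
   functions. If the meridian comes near the axis, then its two end pieces
   already have almost the area of D_1 and D_2 together, which exceeds that of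
   the catenoid, and the arcs near the axis can be discarded. Hence the
   hypothesis on the eigenvalues forces limsup Area(Sigma_j) <= Area(Sigma_cat),
   so that (Sigma_j) is a minimizing sequence and stays away from the axis.
   Along any ultrafilter its meridians converge uniformly. Replacing an arc of
   the j-th meridian by its chord gives a competitor, whose area in the limit
   cannot beat the minimum; this forces the limit curve to have constant speed.
   It is thus a minimizer, so it spans the catenoid by uniqueness. *)

From HB Require Import structures.
Require Import Defs.
From mathcomp Require Import ring lra measurable_realfun.
Import Order.TTheory GRing.Theory Num.Theory.
Import numFieldNormedType.Exports.
Local Open Scope classical_set_scope.
Local Open Scope ring_scope.
Set Implicit Arguments.
Unset Strict Implicit.
Unset Printing Implicit Defensive.

(** * Lipschitz functions of one variable *)

(** The hypothesis only concerns the j-th eigenvalue of the j-th surface, so Weyl's law for each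
    fixed surface is of no use: the upper bound has to hold from one index on for all meridians at
    once, however long. Hence the counting error is charged to each arc in proportion to its area,
    with factors that depend only on the mesh and on the distance to the axis. On an arc of length l
    at distance about f from the axis, the pairs (k, m) with k an integer and m >= 1 whose
    eigenvalue is at most Lambda fill a half ellipse of area f l Lambda / 2 = (2 pi f l) Lambda / (4
    pi), whence the constant 4 pi. Uniform convergence of the meridians bounds the increments of the
    limit curve by the limit of the speeds, but length may be lost: the limit curve could be slower
    than that on a set of positive measure, and its area smaller than the limit of the areas. The
    comparison with chords excludes exactly this, pointwise at almost every parameter. It rests on
    the almost everywhere differentiability of Lipschitz functions, derived here from the
    Radon-Nikodym theorem and Lebesgue differentiation. *)

Lemma near_shift_is_derive (R : realType) (f F : R -> R) (c x d : R) :
  (\forall y \near x, f y = c + F y) -> is_derive x 1 F d -> is_derive x 1 f d.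
Proof.
move=> fF dF; apply: (@near_eq_is_derive _ _ _ (fun y => c + F y)).
  by apply: filterS fF => y ->.
by rewrite -[d]add0r; apply: is_deriveD.
Qed.

Section complementary_cumulatives.
Context {R : realType}.
Local Notation mu := (@lebesgue_measure R).
Variables g h : cumulative R R.
(* The Stieltjes measures of g and h then add up to Lebesgue measure, so both
   are absolutely continuous. *)
Hypothesis ghE : forall x, g x + h x = x.

Local Notation nu := (lebesgue_stieltjes_measure g).

Lemma stieltjes_itvoc (f : cumulative R R) (a b : R) : a <= b ->
  lebesgue_stieltjes_measure f `]a, b]%classic = (f b - f a)%:E.
Proof.
move=> ab.
rewrite /lebesgue_stieltjes_measure/= /measure_extension/= measurable_mu_extE/=;
  last exact: is_ocitv.
by rewrite wlength_itv_bnd.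
Qed.

(** Both sides agree on half-open intervals by [ghE], and these determine Lebesgue measure. *)
Lemma stieltjes_split A : measurable A ->
  mu A = (nu A + lebesgue_stieltjes_measure h A)%E.
Proof.
move=> mA; rewrite -(measure_addE nu (lebesgue_stieltjes_measure h)).
apply: lebesgue_measure_unique => // X.
move=> /ocitvP[->|[[a b]/= ab ->]]; first by rewrite !measure0.
apply: (@eq_trans _ _ (nu `]a, b]%classic +
    lebesgue_stieltjes_measure h `]a, b]%classic)%E); last first.
  exact/esym/(measure_addE nu (lebesgue_stieltjes_measure h)).
rewrite !stieltjes_itvoc ?ltW//.
apply: (@eq_trans _ _ (b - a)%:E); first exact/(stieltjes_itvoc idfun)/ltW.
rewrite -EFinD; congr _%:E.
by rewrite -{1}(ghE a) -{1}(ghE b); ring.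
Qed.

Lemma stieltjes_dominated (a b : R) :
  mrestr nu (measurable_itv `]a, b]) `<< mu.
Proof.
apply/null_content_dominatesP => A mA A0.
apply/eqP; rewrite eq_le measure_ge0 andbT -A0.
apply: (le_trans _ (_ : nu A + lebesgue_stieltjes_measure h A <= _)%E); last first.
  by rewrite -stieltjes_split.
rewrite (le_trans _ (leeDl _ _))//.
by apply: le_measure; rewrite ?inE//; apply: measurableI => //; exact: measurable_itv.
Qed.

Lemma stieltjes_density (a b : R) : a < b -> exists phi : R -> R,
  [/\ mu.-integrable setT (EFin \o phi) &
   forall x y, a <= x -> x <= y -> y <= b ->
     g y - g x = Rintegral mu `]x, y] phi].
Proof.
move=> ab.
have fin : (nu `]a, b]%classic < +oo)%E by rewrite stieltjes_itvoc ?ltW// ltry.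
(* Restricting [nu] to []a, b]] makes it a finite measure. *)
have := @radon_nikodym_sigma_finite _ (measurableTypeR R) R mu
  (@mfrestr _ (measurableTypeR R) R _ nu (measurable_itv `]a, b]) fin)
  (@stieltjes_dominated a b).
move=> [phi [phi0 phifin iphi phiE]].
exists (fine \o phi); split.
  apply: eq_integrable iphi => // x _ /=; by rewrite fineK.
move=> x y ax xy yb.
have sub : `]x, y]%classic `&` `]a, b]%classic = `]x, y]%classic.
  apply/setIidPl => z /=; rewrite !in_itv/= => /andP[xz zy].
  by rewrite (le_lt_trans ax xz) (le_trans zy yb).
have /= := phiE _ (measurable_itv `]x, y]).
rewrite /mfrestr /mrestr.
have -> : nu (`]x, y]%classic `&` `]a, b]%classic) = (g y - g x)%:E.
  by rewrite sub stieltjes_itvoc.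
rewrite /Rintegral => E.
rewrite (@eq_integral _ _ _ mu _ phi); first by rewrite -E.
by move=> z _ /=; rewrite fineK.
Qed.

(** Lebesgue differentiation applies to the indefinite integral of the density, which differs from
    [g] by the constant [g a]. *)
Lemma cumulative_ae_derivable (a b : R) : a < b -> exists phi : R -> R,
  [/\ mu.-integrable setT (EFin \o phi),
   (forall x y, a <= x -> x <= y -> y <= b ->
     g y - g x = Rintegral mu `]x, y] phi) &
   {ae mu, forall x, x \in `]a, b[ -> is_derive x 1 g (phi x)}].
Proof.
move=> ab; have [phi [iphi phiE]] := stieltjes_density ab.
exists phi; split => //.
have loc : locally_integrable setT phi by exact: (@open_integrable_locally R [set: R]
  phi openT iphi).
have iphiS (D : set R) : measurable D -> mu.-integrable D (EFin \o phi).
  by move=> mD; apply: (integrableS measurableT).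
have := @FTC1 R phi (BRight a) (fun y => iphiS _ (measurable_itv _)) loc.
apply: filterS; first exact: (ae_filter_ringOfSetsType mu).
move=> x H; rewrite in_itv/= => /andP[ax xb].
have {H}[|dF FE] := H; first by rewrite /= lte_fin.
set F := (fun x : R => _) in dF FE.
apply: (@near_shift_is_derive _ _ F (g a)); last first.
  by rewrite -FE derive1E; exact/derivableP.
near=> y; rewrite /F -phiE ?lexx//; first by rewrite addrC subrK.
  by apply: ltW; near: y; exact: lt_nbhsr.
by apply: ltW; near: y; exact: lt_nbhsl.
Unshelve. all: by end_near. Qed.
End complementary_cumulatives.

Section lipschitz_functions.
Context {R : realType}.
Local Notation mu := (@lebesgue_measure R).

Lemma lip_continuous (f : R -> R) (C : R) :
  (forall x y, `|f x - f y| <= C * `|x - y|) -> continuous f.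
Proof.
move=> fC x; have C0 : 0 <= C.
  by have := fC 1 0; rewrite subr0 normr1 mulr1; exact: le_trans.
apply/cvgrPdist_lt => e e0.
have e1 : 0 < (C + 1)^-1 * e by rewrite mulr_gt0// invr_gt0 ltr_wpDl.
apply: filterS (nbhsx_ballx x _ e1) => y xy; rewrite (le_lt_trans (fC _ _))//.
rewrite (@le_lt_trans _ _ ((C + 1) * `|x - y|))//.
  by rewrite ler_wpM2r// lerDl.
by rewrite -ltr_pdivlMl// ltr_wpDl.
Qed.

(** Since [f / C] is 1-Lipschitz, adding it to the identity gives a nondecreasing function. Applied
    to [f] and to [- f], this yields two functions that add up to the identity. *)
Lemma lip_is_cumulative (f : R -> R) (C : R) : 0 < C ->
  (forall x y, `|f x - f y| <= C * `|x - y|) ->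
  exists g : cumulative R R, forall x, g x = (x + f x / C) / 2.
Proof.
move=> C0 fC; pose g x := (x + f x / C) / 2.
have gnd : nondecreasing g.
  move=> x y xy; rewrite /g ler_pM2r; last by rewrite invr_gt0.
  rewrite -subr_ge0 (_ : _ - _ = (y - x) - (f x - f y) / C); last by ring.
  rewrite subr_ge0 ler_pdivrMr// mulrC.
  rewrite (le_trans (ler_norm _))// (le_trans (fC _ _))//.
  by rewrite ler0_norm ?subr_le0// opprB.
have grc : right_continuous g.
  move=> x; apply: cvg_within_filter.
  apply: cvgM; last exact: cvg_cst.
  apply: cvgD; first exact: cvg_id.
  by apply: cvgM; [exact: lip_continuous fC _|exact: cvg_cst].
pose H := isCumulative.Build R _ R g gnd grc.
by exists (HB.pack_for (cumulative R R) g H).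
Qed.

(** Rademacher's theorem on the line with the fundamental theorem of calculus. [phi] is f' + (C +
    1), because [f] arises from a nondecreasing function by subtracting [(C + 1) * x]; the constant
    [C + 1] is positive even if [C] is 0. *)
Lemma lip_ftc (f : R -> R) (C a b : R) : a < b ->
  (forall x y, `|f x - f y| <= C * `|x - y|) ->
  exists phi : R -> R, [/\ mu.-integrable setT (EFin \o phi),
   f b - f a = Rintegral mu `]a, b] phi - (C + 1) * (b - a) &
   {ae mu, forall x, x \in `]a, b[ -> is_derive x 1 f (phi x - (C + 1))}].
Proof.
move=> ab fC0; have C0 : 0 < C + 1.
  by have := fC0 1 0; rewrite subr0 normr1 mulr1 => /(le_trans _) =>
    /(_ 0 (normr_ge0 _)); lra.
have fC x y : `|f x - f y| <= (C + 1) * `|x - y|.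
  by rewrite (le_trans (fC0 _ _))// ler_wpM2r// lerDl.
have nfC x y : `|(- f x) - (- f y)| <= (C + 1) * `|x - y|.
  by rewrite -opprD normrN.
have [g gE] := lip_is_cumulative C0 fC.
have [h hE] := lip_is_cumulative C0 nfC.
have ghE x : g x + h x = x by rewrite gE hE; field; lra.
have [phi [iphi phiE dphi]] := cumulative_ae_derivable ghE ab.
have fE : f = (fun x => 2 * (C + 1) * g x - (C + 1) * x).
  by apply/funext => x; rewrite gE; field; lra.
exists (fun x => 2 * (C + 1) * phi x); split.
- exact: (integrableZl measurableT (2 * (C + 1)) iphi).
- rewrite fE RintegralZl ?measurable_itv//.
    by rewrite -phiE ?lexx ?ltW//; ring.
  by apply: (integrableS measurableT) => //; exact: measurable_itv.
- apply: filterS dphi; first exact: (ae_filter_ringOfSetsType mu).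
  move=> x H xab; have {}H := H xab; rewrite fE.
  apply: is_deriveB.
  have := is_deriveZ (C + 1) (is_derive_id x 1).
  by rewrite /= /GRing.scale/= mulr1.
Qed.

End lipschitz_functions.

(* The speed of a curve and the derivatives in the Rayleigh quotient are only
   known almost everywhere, hence these integrands are not assumed to be
   measurable. *)
Section nonmeasurable_integrands.
Context d (T : measurableType d) (R : realType).
Variable mu : {measure set T -> \bar R}.
Local Open Scope ereal_scope.
Import HBNNSimple.

Let nnintegral f := ereal_sup [set sintegral mu h |
  h in [set h : {nnsfun T >-> R} | forall x, (h x)%:E <= f x]].

(** A simple function below [f] gets below [g] once it is set to 0 on [N], and its integral does not
    change. Only simple functions are integrated here, so [f] and [g] may fail to be measurable. *)
Let le_nnintegral (f g : T -> \bar R) (N : set T) : measurable N -> mu N = 0 ->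
  (forall x, 0 <= g x) -> (forall x, ~ N x -> f x <= g x) ->
  nnintegral f <= nnintegral g.
Proof.
move=> mN N0 g0 fg; apply: ge_ereal_sup => _ [h hf <-].
have mNC : measurable (~` N) by exact: measurableC.
pose k := proj_nnsfun h mNC.
have kE x : k x = if x \in N then 0%R else h x.
  rewrite /= /measurable_realfun.mindic indicE in_setC; case: (x \in N) => /=;
    by rewrite ?mulr0 ?mulr1.
have -> : sintegral mu h = sintegral mu k.
  rewrite -!integralT_nnsfun; apply: ge0_ae_eq_integral => //.
  - exact/measurable_EFinP.
  - exact/measurable_EFinP.
  - by move=> x _; rewrite lee_fin.
  - by move=> x _; rewrite lee_fin.
  - exists N; split => // x /= /not_implyP[_ hk]; apply: contrapT => Nx.
    apply: hk; congr _%:E; rewrite -[RHS]/(k x) kE memNset//.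
apply: ereal_sup_ubound; exists k => //= x; change ((k x)%:E <= g x).
rewrite -/(k x) kE; case: ifPn => [_|]; first exact: g0.
by rewrite notin_setE => Nx; apply: le_trans (fg _ Nx).
Qed.

Lemma ge0_ae_le_nonmeasurable_integral (D : set T) (f g : T -> \bar R) :
  (forall x, D x -> 0 <= f x) -> (forall x, D x -> 0 <= g x) ->
  {ae mu, forall x, D x -> f x <= g x} ->
  \int[mu]_(x in D) f x <= \int[mu]_(x in D) g x.
Proof.
move=> f0 g0 [N [mN N0 fgN]]; rewrite !ge0_integralE//.
apply: (@le_nnintegral _ _ N) => //; first by move=> x; exact: erestrict_ge0.
move=> x Nx; rewrite !patchE; case: ifPn => // /set_mem Dx.
by apply: contrapT => fgx; apply: Nx; apply: fgN => /= /(_ Dx).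
Qed.

Lemma ge0_ae_eq_nonmeasurable_integral (D : set T) (f g : T -> \bar R) :
  (forall x, D x -> 0 <= f x) -> (forall x, D x -> 0 <= g x) ->
  {ae mu, forall x, D x -> f x = g x} ->
  \int[mu]_(x in D) f x = \int[mu]_(x in D) g x.
Proof.
move=> f0 g0 fg; apply/eqP; rewrite eq_le; apply/andP.
by split; apply: ge0_ae_le_nonmeasurable_integral => //;
  apply: filterS fg => x /[apply] ->.
Qed.

Lemma ge0_ae_eq_nonmeasurable_Rintegral (D : set T) (f g : T -> R) :
  (forall x, D x -> 0 <= f x)%R -> (forall x, D x -> 0 <= g x)%R ->
  {ae mu, forall x, D x -> f x = g x} ->
  Rintegral mu D f = Rintegral mu D g.
Proof.
move=> f0 g0 fg; congr fine; apply: ge0_ae_eq_nonmeasurable_integral => //.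
apply: filterS fg.
by move=> x H /H ->.
Qed.

Lemma ae_le0_Rintegral (D : set T) (f : T -> R) : measurable D ->
  mu.-integrable D (EFin \o f) ->
  {ae mu, forall x, D x -> (f x <= 0)%R} -> (Rintegral mu D f <= 0)%R.
Proof.
move=> mD fi fle.
have mf := measurable_int mu fi.
rewrite /Rintegral integralE (_ : \int[mu]_(x in D) _ = 0); last first.
  rewrite -[RHS](integral0 mu D); apply: ae_eq_integral => //.
  - exact: measurable_funepos.
  - apply: filterS fle.
    by move=> x /[apply] fx; rewrite funeposE/=; apply/max_idPr; rewrite lee_fin.
rewrite sub0e fineN oppr_le0 fine_ge0//.
by apply: integral_ge0 => x _; exact: funeneg_ge0.
Qed.

End nonmeasurable_integrands.

Section lipschitz_growth.
Context {R : realType}.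
Local Notation mu := (@lebesgue_measure R).

Lemma continuous_itv_integrable (f : R -> R) (a b : R) : continuous f ->
  mu.-integrable `[a, b] (EFin \o f).
Proof.
move=> fc; apply: continuous_compact_integrable; first exact: segment_compact.
exact/continuous_subspaceT.
Qed.

Lemma integrable_cst_itv (a b c : R) : mu.-integrable `[a, b] (EFin \o cst c).
Proof. by apply: continuous_itv_integrable => x; exact: cvg_cst. Qed.

(** A bound on the derivative almost everywhere controls the growth because [f] is the integral of
    its derivative; the Cantor function shows that continuity alone would not do. *)
Lemma lip_growth (f : R -> R) (C a b L : R) : a <= b ->
  (forall x y, `|f x - f y| <= C * `|x - y|) ->
  {ae mu, forall x, x \in `]a, b[ -> derivable f x 1 -> derive1 f x <= L} ->
  f b - f a <= L * (b - a).
Proof.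
rewrite le_eqVlt => /predU1P[->|ab]; first by rewrite !subrr mulr0.
move=> fC fL; have [phi [iphi -> dphi]] := lip_ftc ab fC.
set c := L + (C + 1).
suff : Rintegral mu `]a, b] (fun x => phi x - c) <= 0.
  rewrite RintegralB ?measurable_itv//.
  - have -> : Rintegral mu `]a, b] (fun=> c) = c * (b - a).
      rewrite Rintegral_cst ?measurable_itv//; congr (_ * _).
      apply: (congr1 fine (y := (b - a)%:E)).
      by apply: eq_trans (lebesgue_measure_itv _) _; rewrite /= lte_fin ab.
    by rewrite /c; lra.
  - by apply: (integrableS measurableT) => //; exact: measurable_itv.
  - apply: (integrableS _ _ _ (integrable_cst_itv a b c)); try exact: measurable_itv.
    exact: subset_itv_oc_cc.
have i1 : mu.-integrable `]a, b[ (EFin \o phi).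
  by apply: (integrableS measurableT) => //; exact: measurable_itv.
have i2 : mu.-integrable `]a, b[ (EFin \o cst c).
  apply: (integrableS _ _ _ (integrable_cst_itv a b c)); try exact: measurable_itv.
  exact: subset_itv_oo_cc.
have i3 : mu.-integrable `]a, b[ (EFin \o (fun x => phi x - c)).
  apply: eq_integrable (integrableB _ i1 i2); try exact: measurable_itv.
  by move=> x _ /=.
rewrite -Rintegral_itv_bndo_bndc//.
apply: (ae_le0_Rintegral _ i3); try exact: measurable_itv.
apply: filterS2 dphi fL; first exact: (ae_filter_ringOfSetsType mu).
move=> x H1 H2 xab; have [dx fx] := H1 xab.
by have := H2 xab dx; rewrite derive1E fx /c; lra.
Qed.

Lemma lip_ae_derivable (f : R -> R) (C a b : R) : a < b ->
  (forall x y, `|f x - f y| <= C * `|x - y|) ->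
  {ae mu, forall x, x \in `]a, b[ -> derivable f x 1}.
Proof.
move=> ab fC; have [phi [_ _ dphi]] := lip_ftc ab fC.
apply: filterS dphi; first exact: (ae_filter_ringOfSetsType mu).
by move=> x H /H [].
Qed.

End lipschitz_growth.

(** * Meridians *)

Section integrals_of_continuous_functions.
Context {R : realType}.
Local Notation mu := (@lebesgue_measure R).
Implicit Types (f g : R -> R) (a b c : R).

Lemma Rintegral_itv_cst a b c : a <= b ->
  Rintegral mu `[a, b] (fun=> c) = c * (b - a).
Proof.
move=> ab; rewrite Rintegral_cst ?measurable_itv//; congr (_ * _).
apply: (congr1 fine (y := (b - a)%:E)).
apply: eq_trans (lebesgue_measure_itv _) _; rewrite /= lte_fin.
by case: ltgtP ab => // -> _; rewrite subrr.
Qed.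

Lemma Rintegral_itvD f g a b : continuous f -> continuous g ->
  Rintegral mu `[a, b] (fun t => f t + g t) =
  Rintegral mu `[a, b] f + Rintegral mu `[a, b] g.
Proof.
by move=> fc gc; apply: RintegralD; rewrite ?measurable_itv//;
  exact: continuous_itv_integrable.
Qed.

Lemma Rintegral_itvZ f a b c : continuous f ->
  Rintegral mu `[a, b] (fun t => c * f t) = c * Rintegral mu `[a, b] f.
Proof.
by move=> fc; apply: RintegralZl; rewrite ?measurable_itv//;
  exact: continuous_itv_integrable.
Qed.

Lemma le_Rintegral_itv f g a b : continuous f -> continuous g ->
  (forall x, a <= x -> x <= b -> f x <= g x) ->
  Rintegral mu `[a, b] f <= Rintegral mu `[a, b] g.
Proof.
move=> fc gc fg; apply: le_Rintegral; rewrite ?measurable_itv//;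
  try exact: continuous_itv_integrable.
by move=> x /=; rewrite in_itv/= => /andP[]; exact: fg.
Qed.

(** The base point [a] lies strictly to the left of the segments, so that [F] has a two-sided
    derivative at their left ends too. *)
Lemma continuous_primitive f a : continuous f -> exists2 F : R -> R,
  (forall x, a < x -> is_derive x 1 F (f x)) &
  (forall x y, a < x -> x <= y -> Rintegral mu `[x, y] f = F y - F x).
Proof.
move=> fc; exists (fun x => Rintegral mu `[a, x] f).
  move=> x ax.
  have xx1 : x < x + 1 by rewrite ltrDl.
  have [d dE] := continuous_FTC1_closed xx1 (continuous_itv_integrable a (x + 1) fc)
    ax (fc x).
  by rewrite -dE derive1E; exact/derivableP.
move=> x y ax xy.
rewrite (Rintegral_itvB (continuous_itv_integrable a y fc)) ?bnd_simp ?(ltW ax)//.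
rewrite Rintegral_itv_obnd_cbnd//.
apply: (integrableS _ _ _ (continuous_itv_integrable x y fc)); try exact: measurable_itv.
exact: subset_itv_oc_cc.
Qed.

Lemma Rintegral_itv_chasles f a b c : continuous f -> a <= b -> b <= c ->
  Rintegral mu `[a, c] f = Rintegral mu `[a, b] f + Rintegral mu `[b, c] f.
Proof.
move=> fc ab bc; have a1 : a - 1 < a by rewrite ltrBlDr ltrDl.
have [F _ FE] := continuous_primitive (a - 1) fc.
by rewrite !FE ?(le_trans ab)// ?(lt_le_trans a1)//; ring.
Qed.

Lemma is_derive_continuous (F : R -> R) (x y : R) : is_derive x 1 F y ->
  {for x, continuous F}.
Proof. by case=> /derivable1_diffP dF _; exact: differentiable_continuous. Qed.

Lemma Rintegral_itv_ftc (f F : R -> R) a b : a <= b ->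
  continuous f -> (forall x, a <= x <= b -> is_derive x 1 F (f x)) ->
  Rintegral mu `[a, b] f = F b - F a.
Proof.
rewrite le_eqVlt => /predU1P[->|ab] fc dF.
  by rewrite set_itv1 Rintegral_set1 subrr.
have [G dG ->] := continuous_primitive (a - 1) fc; last 2 first.
- by rewrite ltrBlDr ltrDl.
- exact: ltW.
have dH x : a <= x <= b -> is_derive x 1 (G - F) (f x - f x).
  move=> /andP[ax xb]; apply: is_deriveB; last by apply: dF; rewrite ax.
  by apply: dG; rewrite ltrBlDr ltr_pwDr.
have [|x|c _] := @MVT _ (G - F) (fun x => f x - f x) _ _ ab.
- by move=> x; rewrite in_itv/= => /andP[/ltW ax /ltW xb]; apply: dH; rewrite ax.
- apply: continuous_in_subspaceT => z /[1!inE]/= /dH.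
  exact: is_derive_continuous.
rewrite subrr mul0r => H.
have : (G b - F b) - (G a - F a) = 0 by exact: H.
by lra.
Qed.

Lemma Rintegral_itv_affine f a b c e : 0 < c -> continuous f -> a <= b ->
  c * Rintegral mu `[a, b] (fun t => f (c * t + e)) =
  Rintegral mu `[c * a + e, c * b + e] f.
Proof.
move=> c0 fc ab.
have cab : c * a + e <= c * b + e by rewrite lerD2r ler_pM2l.
have [F dF FE] := continuous_primitive (c * a + e - 1) fc.
have l1 x : c * a + e <= x -> c * a + e - 1 < x.
  by move=> ax; rewrite ltrBlDr ltr_pwDr.
have d1 (x : R) : is_derive x 1 (fun t : R => c * t + e) c.
  have := is_deriveD (is_deriveZ c (is_derive_id x 1)) (is_derive_cst e x 1).
  by rewrite /GRing.scale/= mulr1 addr0.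
have fcc : continuous (fun t : R => f (c * t + e)).
  move=> x; apply: continuous_comp; last exact: fc.
  exact: is_derive_continuous (d1 x).
rewrite FE//; last exact: l1.
rewrite -Rintegral_itvZ//.
have cfcc : continuous (fun t : R => c * f (c * t + e)).
  by move=> x; apply: cvgM; [exact: cvg_cst|exact: fcc].
apply: (@Rintegral_itv_ftc _ (F \o (fun t => c * t + e))) => // x /andP[ax xb].
rewrite mulrC; apply: is_derive1_comp => //.
by apply: dF; apply: l1; rewrite lerD2r ler_pM2l.
Qed.

Lemma Rintegral_cells (N : nat) f m : (0 < N)%N -> continuous f ->
  Rintegral mu `[0, m%:R / N%:R] f =
  \sum_(0 <= i < m) Rintegral mu `[i%:R / N%:R, i.+1%:R / N%:R] f.
Proof.
move=> N0 fc; have n0 : 0 < N%:R :> R by rewrite ltr0n.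
elim: m => [|m IH]; first by rewrite mul0r set_itv1 Rintegral_set1 big_geq.
have cell_le : m%:R / N%:R <= m.+1%:R / N%:R :> R.
  by rewrite ler_pM2r ?invr_gt0// ler_nat.
by rewrite (Rintegral_itv_chasles fc _ cell_le) ?divr_ge0// IH big_nat_recr.
Qed.

(** Preimages of null sets are null: [c] times the image of Lebesgue measure under the affine map
    agrees with Lebesgue measure on half-open intervals. *)
Lemma ae_affine (P : R -> Prop) c e : 0 < c ->
  {ae mu, forall x, P x} -> {ae mu, forall x, P (c * x + e)}.
Proof.
move=> c0 [N [mN N0 PN]].
pose g (x : measurableTypeR R) : measurableTypeR R := c * x + e.
have mg : measurable_fun setT g.
  apply: continuous_measurable_fun => x.
  by apply: cvgD; [apply: cvgM; [exact: cvg_cst|exact: cvg_id]|exact: cvg_cst].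
exists (g @^-1` N); split.
- by rewrite -[X in measurable X]setTI; exact: mg.
- pose nu := mscale (NngNum (ltW c0)) (pushforward mu g).
  have : mu N = nu mg N.
    apply: (@lebesgue_measure_unique R (mscale (NngNum (ltW c0)) (pushforward mu g)))
      => // X.
    move=> /ocitvP[->|[[a b]/= ab ->]]; first by rewrite !measure0.
    apply: eq_trans (lebesgue_measure_itv _) _; rewrite /= lte_fin ab.
    rewrite /nu /mscale /pushforward/=.
    have E : g @^-1` `]a, b]%classic = `](a - e) / c, (b - e) / c]%classic.
      apply/seteqP; split => x /=; rewrite !in_itv/= /g => /andP[ax xb];
        apply/andP; split.
      - by rewrite ltr_pdivrMr// mulrC ltrBlDr.
      - by rewrite ler_pdivlMr// mulrC lerBrDr.
      - by rewrite -ltrBlDr mulrC -ltr_pdivrMr.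
      - by rewrite -lerBrDr mulrC -ler_pdivlMr.
    apply: (@eq_trans _ _ (c%:E * mu (g @^-1` `]a, b]%classic))%E); last by [].
    rewrite E; have -> : mu `](a - e) / c, (b - e) / c]%classic = ((b - a) / c)%:E.
      apply: eq_trans (lebesgue_measure_itv _) _; rewrite /= lte_fin.
      rewrite ltr_pM2r ?invr_gt0// ltrD2r ab -EFinD; congr _%:E.
      by rewrite -mulrBl; congr (_ / _); ring.
    by rewrite -EFinM; congr _%:E; field; rewrite gt_eqF.
  rewrite N0 /nu /mscale /pushforward/= => /esym/eqP.
  by rewrite mule_eq0 eqe gt_eqF//= => /eqP.
- by move=> x /= Px; apply: PN.
Qed.
End integrals_of_continuous_functions.

Section clamping.
Context {R : realType}.
Implicit Types a b x y t : R.

Definition clamp a b x := Num.max a (Num.min b x).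

Lemma clamp_id a b x : a <= x <= b -> clamp a b x = x.
Proof. by move=> /andP[ax xb]; rewrite /clamp min_r// max_r. Qed.

Lemma clamp_itv a b x : a <= b -> a <= clamp a b x <= b.
Proof. by move=> ab; rewrite /clamp le_max lexx/= ge_max ab ge_min lexx. Qed.

Lemma clamp_homo a b : {homo clamp a b : x y / x <= y}.
Proof.
move=> x y xy; rewrite /clamp /Order.max /Order.min.
by do ! case: ifPn; rewrite -?leNgt => *; lra.
Qed.

Lemma clamp_lip a b x y : `|clamp a b x - clamp a b y| <= `|x - y|.
Proof.
wlog xy : x y / x <= y => [H|].
  have [|/ltW] := leP x y; first exact: H.
  by move=> /H; rewrite distrC [leRHS]distrC.
rewrite distrC [leRHS]distrC [leRHS]ger0_norm ?subr_ge0//.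
rewrite ger0_norm ?subr_ge0 ?clamp_homo//.
move: xy; rewrite /clamp /Order.max /Order.min.
by do ! case: ifPn; rewrite -?leNgt => *; lra.
Qed.

End clamping.

(** * Curves of constant speed *)

Section meridians.
Context {R : realType}.
Local Notation mu := (@lebesgue_measure R).
Implicit Types (F G : R -> R) (alpha : R -> R * R).

Lemma ae_neq (a : R) : {ae mu, forall t, t != a}.
Proof.
exists [set a]; split; [exact: measurable_set1|exact: lebesgue_measure_set1|].
by move=> t /= /negP; rewrite negbK => /eqP.
Qed.

Lemma lipschitz_onP (V : normedModType R) (f : R -> V) (A : set R) :
  [lipschitz f t | t in A] <->
  exists C : R, forall s t, A s -> A t -> `|f s - f t| <= C * `|s - t|.
Proof.
split.
  move=> [M [_ H]]; exists (M + 1) => s t As At.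
  by have /(_ (s, t)) := H (M + 1) (ltr_pwDr ltr01 (lexx M)); apply.
move=> [C H]; exists C; split; first exact: num_real.
move=> D CD [s t] /= [As At]; rewrite (le_trans (H _ _ As At))//.
by rewrite ler_wpM2r// ltW.
Qed.

(** Differentiability is part of the statement, since [derive1] has a value even where there is no
    derivative. *)
Definition ae_speed (L : R) F G :=
  {ae mu, forall t : R, t \in `]0, 1[ -> exists df dg : R, [/\ is_derive t 1 F df,
    is_derive t 1 G dg & df ^+ 2 + dg ^+ 2 = L ^+ 2]}.

(** The Euclidean Lipschitz bound. Unlike [ae_speed] it is a closed condition and passes to
    pointwise limits. *)
Definition equilip (L : R) F G :=
  forall s t : R, (F s - F t) ^+ 2 + (G s - G t) ^+ 2 <= (L * (s - t)) ^+ 2.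

Lemma equilip_lip L F G : 0 <= L -> equilip L F G ->
  (forall s t, `|F s - F t| <= L * `|s - t|) /\
  (forall s t, `|G s - G t| <= L * `|s - t|).
Proof.
move=> L0 FG.
have H s t (x : R) : x ^+ 2 <= (L * (s - t)) ^+ 2 -> `|x| <= L * `|s - t|.
  by rewrite -[x ^+ 2]real_normK ?num_real// -[leRHS]real_normK ?num_real//
    ler_pXn2r ?nnegrE// normrM (ger0_norm L0).
split=> s t; apply: H; apply: le_trans (FG s t); first by rewrite lerDl sqr_ge0.
by rewrite lerDr sqr_ge0.
Qed.

(** Project the curve on the direction of its chord: by Cauchy-Schwarz the derivative of [h] is at
    most [D * L], while [h] grows by [D ^+ 2]. *)
Lemma ae_speed_equilip (C L : R) F G : 0 <= L ->
  (forall s t, `|F s - F t| <= C * `|s - t|) ->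
  (forall s t, `|G s - G t| <= C * `|s - t|) ->
  ae_speed L F G ->
  forall s t, 0 <= s -> s <= t -> t <= 1 ->
    (F s - F t) ^+ 2 + (G s - G t) ^+ 2 <= (L * (s - t)) ^+ 2.
Proof.
move=> L0 FC GC FGL s t s0 st t1.
set x := F t - F s; set y := G t - G s.
pose D := Num.sqrt (x ^+ 2 + y ^+ 2).
have D0 : 0 <= D by exact: sqrtr_ge0.
have DE : D ^+ 2 = x ^+ 2 + y ^+ 2 by rewrite sqr_sqrtr// addr_ge0// sqr_ge0.
pose h u := x * F u + y * G u.
have hC u v : `|h u - h v| <= ((`|x| + `|y|) * C) * `|u - v|.
  rewrite /h (_ : _ - _ = x * (F u - F v) + y * (G u - G v)); last by ring.
  rewrite (le_trans (ler_normD _ _))// !normrM -mulrA mulrDl.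
  by rewrite lerD// ler_wpM2l.
have : h t - h s <= (D * L) * (t - s).
  apply: (lip_growth st hC).
  apply: filterS FGL; first exact: (ae_filter_ringOfSetsType mu).
  move=> u H; rewrite in_itv/= => /andP[su ut] _.
  have [|df [dg [dF dG dL]]] := H.
    by rewrite in_itv/= (le_lt_trans s0 su) (lt_le_trans ut t1).
  have dh : is_derive u 1 h (x * df + y * dg).
    by apply: is_deriveD; apply: is_deriveZ.
  rewrite derive1E derive_val; apply: le_trans (ler_norm _) _.
  rewrite -(@ler_pXn2r _ 2)// ?nnegrE// ?mulr_ge0//.
  rewrite real_normK ?num_real// exprMn DE -dL -subr_ge0.
  rewrite (_ : _ - _ = (x * dg - y * df) ^+ 2); last by ring.
  exact: sqr_ge0.
have -> : h t - h s = D ^+ 2 by rewrite DE /h /x /y; ring.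
rewrite (_ : (F s - F t) ^+ 2 + (G s - G t) ^+ 2 = D ^+ 2); last by rewrite DE /x /y;
  ring.
rewrite (_ : (L * (s - t)) ^+ 2 = (L * (t - s)) ^+ 2); last by ring.
rewrite expr2 -mulrA; have [->|D1] := eqVneq D 0; first by rewrite mul0r sqr_ge0.
have Dp : 0 < D by rewrite lt_neqAle eq_sym D1.
rewrite ler_pM2l// => H; rewrite -expr2 ler_pXn2r// ?nnegrE//.
by rewrite mulr_ge0// subr_ge0.
Qed.

Lemma speed_clamp alpha (t : R) : t \in `]0, 1[ ->
  derivable (fun s => (alpha (clamp 0 1 s)).1) t 1 ->
  derivable (fun s => (alpha (clamp 0 1 s)).2) t 1 ->
  speed alpha t ^+ 2 =
  ('D_1 (fun s => (alpha (clamp 0 1 s)).1) t) ^+ 2 +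
  ('D_1 (fun s => (alpha (clamp 0 1 s)).2) t) ^+ 2.
Proof.
rewrite in_itv/= => /andP[t0 t1] d1 d2.
rewrite /speed sqr_sqrtr ?addr_ge0 ?sqr_ge0// !derive1E.
by congr (_ ^+ 2 + _ ^+ 2); apply: near_eq_derive; near=> u;
  rewrite clamp_id//; apply/andP; split; apply: ltW; near: u;
  [exact: lt_nbhsr|exact: lt_nbhsl|exact: lt_nbhsr|exact: lt_nbhsl].
Unshelve. all: by end_near. Qed.

Lemma area_ae alpha (L : R) : (forall t : R, t \in `[0, 1] -> 0 < (alpha t).1) ->
  {ae mu, forall t : R, t \in `[0, 1] -> speed alpha t = L} -> 0 <= L ->
  area alpha = 2 * pi * Rintegral mu `[0, 1] (fun t => (alpha t).1 * L).
Proof.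
move=> a0 aL L0; rewrite /area; congr (_ * _).
apply: ge0_ae_eq_nonmeasurable_Rintegral.
- by move=> t /a0 /ltW ?; rewrite mulr_ge0// /speed sqrtr_ge0.
- by move=> t /a0 /ltW ?; rewrite mulr_ge0.
apply: filterS aL; first exact: (ae_filter_ringOfSetsType mu).
by move=> t H /H ->.
Qed.

Lemma meridian_arc p q alpha : p != q -> meridian p q alpha ->
  exists L F G, [/\ 0 < L, equilip L F G, ae_speed L F G, (forall t, 0 < F t) &
   [/\ forall t : R, t \in `[0, 1] -> alpha t = (F t, G t),
   {ae mu, forall t : R, t \in `[0, 1] -> speed alpha t = L} &
   area alpha = 2 * pi * (L * Rintegral mu `[0, 1] F)]].
Proof.
move=> pq [/lipschitz_onP[C aC] a0 ap aq [L0 aL0]].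
(* Extended by constants outside [[0, 1]], both coordinates are Lipschitz on the whole line, as
   [lip_ftc] demands. *)
pose F t := (alpha (clamp 0 1 t)).1; pose G t := (alpha (clamp 0 1 t)).2.
have cl t : clamp 0 1 t \in `[0, 1] :> bool by rewrite in_itv/= clamp_itv.
have C0 : 0 <= C.
  have := aC 1 0; rewrite subr0 normr1 mulr1 => /(_ _ _)/(le_trans _) -> //=.
  - by rewrite in_itv/= lexx ler01.
  - by rewrite in_itv/= lexx ler01.
have aC' s t : `|alpha (clamp 0 1 s) - alpha (clamp 0 1 t)| <= C * `|s - t|.
  by rewrite (le_trans (aC _ _ _ _))//= ?cl// ler_wpM2l// clamp_lip.
have FC s t : `|F s - F t| <= C * `|s - t|.
  by apply: le_trans (aC' s t); rewrite prod_normE/= le_max lexx.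
have GC s t : `|G s - G t| <= C * `|s - t|.
  by apply: le_trans (aC' s t); rewrite prod_normE/= le_max lexx orbT.
(* Speeds are nonnegative, so a speed equal to [L0] also equals its absolute value; this avoids an
   argument for the sign of [L0]. *)
pose L := `|L0|.
have aL : {ae mu, forall t : R, t \in `[0, 1] -> speed alpha t = L}.
  apply: filterS aL0; first exact: (ae_filter_ringOfSetsType mu).
  by move=> t H /H; rewrite /L => <-; rewrite ger0_norm// sqrtr_ge0.
have FGL : ae_speed L F G.
  have dF := lip_ae_derivable (@ltr01 R) FC.
  have dG := lip_ae_derivable (@ltr01 R) GC.
  apply: filterS3 aL dF dG; first exact: (ae_filter_ringOfSetsType mu).
  move=> t H1 H2 H3 t01; exists ('D_1 F t), ('D_1 G t).
  have {}H2 := H2 t01; have {}H3 := H3 t01; split; [exact/derivableP|exact/derivableP|].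
  by rewrite -speed_clamp// H1//; apply: subset_itv_oo_cc t01.
have L_ge0 : 0 <= L by rewrite normr_ge0.
have FG01 := ae_speed_equilip L_ge0 FC GC FGL.
have FGe : equilip L F G.
  move=> s t; wlog st : s t / s <= t => [H|].
    have [|/ltW] := leP s t; first exact: H.
    by move=> /H; rewrite -sqrrN opprB -[X in _ +
      X]sqrrN opprB -[leRHS]sqrrN -mulrN opprB.
  have E u : F u = F (clamp 0 1 u) by rewrite /F [clamp 0 1 (clamp _ _ _)]clamp_id//
    clamp_itv.
  have E2 u : G u = G (clamp 0 1 u) by rewrite /G [clamp 0 1 (clamp _ _ _)]clamp_id//
    clamp_itv.
  have /andP[s0 s1] := clamp_itv s (@ler01 R).
  have /andP[t0 t1] := clamp_itv t (@ler01 R).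
  have cst : clamp 0 1 s <= clamp 0 1 t.
    exact: clamp_homo.
  rewrite (E s) (E t) (E2 s) (E2 t) (le_trans (FG01 _ _ s0 cst t1))//.
  rewrite !exprMn ler_wpM2l ?sqr_ge0//.
  rewrite -[leLHS]real_normK ?num_real// -[leRHS]real_normK ?num_real//.
  by rewrite ler_pXn2r ?nnegrE// clamp_lip.
have L_gt0 : 0 < L.
  rewrite lt_neqAle L_ge0 andbT; apply: contraNN pq => /eqP L00.
  have := FGe 0 1; rewrite -L00 mul0r expr0n/= /F /G !clamp_id ?lexx ?ler01// ap aq.
  move=> H; have {}H : (p.1 - q.1) ^+ 2 + (p.2 - q.2) ^+ 2 == 0.
    by rewrite eq_le H addr_ge0 ?sqr_ge0.
  move: H; rewrite paddr_eq0 ?sqr_ge0// !sqrf_eq0 !subr_eq0 => /andP[/eqP p1 /eqP p2].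
  by rewrite [p]surjective_pairing p1 p2 -surjective_pairing.
have aFG t : t \in `[0, 1] -> alpha t = (F t, G t).
  rewrite in_itv/= => t01; rewrite /F /G clamp_id//; exact: surjective_pairing.
exists L, F, G; split => //; first by move=> t; rewrite /F a0// cl.
split => //; rewrite (area_ae a0 aL)//; congr (_ * _).
rewrite -Rintegral_itvZ; last exact: lip_continuous FC.
by apply: eq_Rintegral => t /set_mem/= /aFG ->; rewrite mulrC.
Qed.

Lemma arc_meridian (C L : R) F G : 0 <= L ->
  (forall s t, `|F s - F t| <= C * `|s - t|) ->
  (forall s t, `|G s - G t| <= C * `|s - t|) ->
  (forall t : R, t \in `[0, 1] -> 0 < F t) -> ae_speed L F G ->
  meridian (F 0, G 0) (F 1, G 1) (fun t => (F t, G t)) /\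
  area (fun t => (F t, G t)) = 2 * pi * (L * Rintegral mu `[0, 1] F).
Proof.
move=> L0 FC GC F0 FGL.
have aL : {ae mu, forall t : R, t \in `[0, 1] -> speed (fun t => (F t, G t)) t = L}.
  (* [meridian] speaks of the closed interval and [ae_speed] of the open one; the two end points are
     discarded as a null set. *)
  apply: filterS3 FGL (ae_neq 0) (ae_neq 1); first exact: (ae_filter_ringOfSetsType mu).
  move=> t H t0 t1; rewrite in_itv/= => /andP[t0' t1'].
  have [|df [dg [dF dG dE]]] := H.
    by rewrite in_itv/= lt_neqAle eq_sym t0 t0' lt_neqAle t1 t1'.
  by rewrite /speed/= !derive1E !derive_val dE sqrtr_sqr ger0_norm.
split; last first.
  rewrite (@area_ae (fun t => (F t, G t)) L F0 aL L0)/=; congr (_ * _).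
  rewrite -Rintegral_itvZ; last exact: lip_continuous FC.
  by apply: eq_Rintegral => t _; rewrite mulrC.
split => //; last by exists L.
apply/lipschitz_onP; exists C => s t _ _.
by rewrite prod_normE/= ge_max FC GC.
Qed.

End meridians.

(** * Replacing an arc of a meridian by its chord *)

Lemma is_derive_affine (R : realType) (c e x : R) :
  is_derive x 1 (fun t : R => c * t + e) c.
Proof.
have := is_deriveD (is_deriveZ c (is_derive_id x 1)) (is_derive_cst e x 1).
by rewrite /GRing.scale/= mulr1 addr0.
Qed.

Lemma is_derive_comp_affine (R : realType) (F : R -> R) (c e x df : R) :
  is_derive (c * x + e) 1 F df -> is_derive x 1 (fun t : R => F (c * t + e)) (df * c).
Proof.
move=> dF; apply: (@is_derive1_comp _ F (fun t => c * t + e) x _ _ dF).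
exact: is_derive_affine.
Qed.

Lemma near_is_derive (R : realType) (f g : R -> R) (a b x d : R) : a < x -> x < b ->
  (forall y, a <= y -> y <= b -> f y = g y) -> is_derive x 1 f d -> is_derive x 1 g d.
Proof.
move=> ax xb fg; apply: near_eq_is_derive; near=> y; apply: fg; apply: ltW; near: y.
- exact: lt_nbhsr.
- exact: lt_nbhsl.
Unshelve. all: by end_near. Qed.

Lemma mem_itvcc (R : realType) (a b x : R) : x \in `[a, b]%classic -> a <= x <= b.
Proof. by move/set_mem; rewrite /= in_itv. Qed.

Lemma min_lip (R : realType) (x y c : R) : `|Num.min x c - Num.min y c| <= `|x - y|.
Proof.
wlog xy : x y / x <= y => [H|].
  have [|/ltW] := leP x y; first exact: H.
  by move=> /H; rewrite distrC [leRHS]distrC.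
rewrite distrC [leRHS]distrC [leRHS]ger0_norm ?subr_ge0// ler_norml.
rewrite /Order.min; do ! case: ifPn; rewrite -?leNgt => *; apply/andP; split; lra.
Qed.

Lemma max_lip (R : realType) (x y c : R) : `|Num.max c x - Num.max c y| <= `|x - y|.
Proof.
wlog xy : x y / x <= y => [H|].
  have [|/ltW] := leP x y; first exact: H.
  by move=> /H; rewrite distrC [leRHS]distrC.
rewrite distrC [leRHS]distrC [leRHS]ger0_norm ?subr_ge0// ler_norml.
rewrite /Order.max; do ! case: ifPn; rewrite -?leNgt => *; apply/andP; split; lra.
Qed.

Section shortcut.
Context {R : realType}.
Local Notation mu := (@lebesgue_measure R).
Variables (L s t d : R).
Hypotheses (L_gt0 : 0 < L) (s_ge0 : 0 <= s) (t_le1 : t <= 1) (d_ge0 : 0 <= d).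
Let l := L * s + d + L * (1 - t).
Hypothesis l_gt0 : 0 < l.

(* Follow H at speed L up to parameter s, then go straight from H s to H t in
   time d, then follow H again; everything rescaled to total time 1. *)
Definition shortcut (H : R -> R) (tau : R) :=
  H (Num.min (l / L * tau) s) +
  (H (Num.max t (l / L * tau + (t - (L * s + d) / L))) - H t) +
  clamp 0 1 (l / d * tau + (- (L * s / d))) * (H t - H s).

(** The rescaled times at which the chord is entered ([a]) and left ([b]); [l] is the total length
    of the new curve. *)
Let a := L * s / l.
Let b := (L * s + d) / l.

Let Ls_ge0 : 0 <= L * s. Proof. by rewrite mulr_ge0// ltW. Qed.

Let aE tau : (tau <= a) = (l / L * tau <= s).
Proof. by rewrite /a ler_pdivlMr// -mulrA [L^-1 * _]mulrC mulrA ler_pdivrMr//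
  [tau * l]mulrC [s * L]mulrC. Qed.

Let bE tau : (b <= tau) = (0 <= l / L * tau - (L * s + d) / L).
Proof.
rewrite /b ler_pdivrMr// (_ : _ - _ = (tau * l - (L * s + d)) / L); last first.
  by field; rewrite gt_eqF.
by rewrite pmulr_lge0 ?invr_gt0// subr_ge0.
Qed.

Let ab : a <= b. Proof. by rewrite ler_pM2r ?invr_gt0// lerDl. Qed.
Let a0 : 0 <= a. Proof. by rewrite divr_ge0// ltW. Qed.
Let b1 : b <= 1.
Proof. by rewrite /b ler_pdivrMr// mul1r /l lerDl mulr_ge0 ?subr_ge0// ltW. Qed.

Let bE' tau : (tau <= b) = (l / L * tau - (L * s + d) / L <= 0).
Proof.
rewrite /b ler_pdivlMr// (_ : _ - _ = (tau * l - (L * s + d)) / L); last first.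
  by field; rewrite gt_eqF.
by rewrite pmulr_lle0 ?invr_gt0// subr_le0.
Qed.

Let dE tau : 0 < d -> l / d * tau + (- (L * s / d)) = (l * tau - L * s) / d.
Proof. by move=> d0; field; rewrite gt_eqF. Qed.

Lemma shortcut_left H tau : (d = 0 -> H s = H t) -> tau <= a ->
  shortcut H tau = H (l / L * tau).
Proof.
move=> d0H ta; rewrite /shortcut min_l -?aE// max_l; last first.
  by rewrite addrCA gerDl -bE' (le_trans ta).
rewrite subrr addr0.
(* For a chord of length 0 the factor [H t - H s] removes the middle summand, whatever the quotients
   by [d] are. *)
have [d0|d_neq0] := eqVneq d 0; first by rewrite d0H// subrr mulr0 addr0.
have d_gt0 : 0 < d by rewrite lt_neqAle eq_sym d_neq0.
rewrite dE// /clamp max_l ?mul0r ?addr0// ge_min; apply/orP; right.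
rewrite pmulr_lle0 ?invr_gt0// subr_le0.
by move: ta; rewrite /a ler_pdivlMr// mulrC.
Qed.

Lemma shortcut_mid H tau : 0 < d -> a <= tau -> tau <= b ->
  shortcut H tau = H s + (l / d * tau + (- (L * s / d))) * (H t - H s).
Proof.
move=> d_gt0 at_ tb; rewrite /shortcut max_l; last first.
  by rewrite addrCA gerDl -bE'.
rewrite subrr addr0 (_ : Num.min _ _ = s); last first.
  have [ta|/ltW ta] := leP tau a; last first.
    by rewrite min_r//; move: at_;
      rewrite /a ler_pdivrMr// -[_ * tau]mulrAC ler_pdivlMr// mulrC [l * _]mulrC.
  have -> : tau = a by apply/le_anti; rewrite ta at_.
  by rewrite /a (_ : _ * _ = s) ?minxx//; field; rewrite !gt_eqF.
rewrite clamp_id// dE//; apply/andP; split.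
  by apply: divr_ge0 => //; rewrite subr_ge0; move: at_;
    rewrite /a ler_pdivrMr// [tau * _]mulrC.
rewrite ler_pdivrMr// mul1r lerBlDl; move: tb.
by rewrite /b ler_pdivlMr// mulrC.
Qed.

Lemma shortcut_right H tau : (d = 0 -> H s = H t) -> b <= tau ->
  shortcut H tau = H (l / L * tau + (t - (L * s + d) / L)).
Proof.
move=> d0H bt; rewrite /shortcut (@max_r _ _ t); last first.
  by rewrite addrCA lerDl -bE.
rewrite (_ : Num.min _ _ = s); last first.
  by rewrite min_r// -mulrAC ler_pdivlMr// mulrC [l * _]mulrC -ler_pdivrMr//
    (le_trans ab).
have [d0|d_neq0] := eqVneq d 0; first by rewrite d0H// subrr mulr0 addr0 addrC subrK.
have d_gt0 : 0 < d by rewrite lt_neqAle eq_sym d_neq0.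
rewrite dE// (_ : clamp _ _ _ = 1); first by ring.
rewrite /clamp min_l ?max_r//.
by rewrite ler_pdivlMr// mul1r lerBrDl [l * _]mulrC -ler_pdivrMr.
Qed.

(** Written as a sum of clamped pieces rather than by cases, the curve is Lipschitz summand by
    summand, without gluing at [a] and [b]. *)
Lemma shortcut_lip H (C : R) : 0 <= C -> (forall x y, `|H x - H y| <= C * `|x - y|) ->
  forall x y, `|shortcut H x - shortcut H y| <=
    (C * (l / L) + C * (l / L) + `|H t - H s| * `|l / d|) * `|x - y|.
Proof.
move=> C0 HC x y; rewrite /shortcut.
set A := (X in H X); set A' := (X in _ - (H X + _ + _)).
set B := (X in H A + (H X - _)); set B' := (X in _ - (H A' + (H X - _) + _)).
set D := clamp _ _ _; set D' := clamp _ _ _.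
rewrite (_ : _ - _ = (H A - H A') + (H B - H B') + (H t - H s) * (D - D')); last by ring.
rewrite (le_trans (ler_normD _ _))// [leRHS]mulrDl; apply: lerD; last first.
  rewrite normrM -mulrA ler_wpM2l// (le_trans (clamp_lip _ _ _ _))//.
  by rewrite (_ : _ - _ = l / d * (x - y)) ?normrM//; ring.
have n1 u v : `|l / L * u - l / L * v| = l / L * `|u - v|.
  by rewrite -mulrBr normrM gtr0_norm// divr_gt0.
rewrite (le_trans (ler_normD _ _))// [leRHS]mulrDl -!mulrA.
apply: lerD; apply: le_trans (HC _ _) _; rewrite ler_wpM2l// mulrA -n1.
  exact: min_lip.
rewrite /B /B' (le_trans (max_lip _ _ _))//.
by rewrite (_ : _ - _ = l / L * x - l / L * y)//; ring.
Qed.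

Lemma shortcut_0 H : (d = 0 -> H s = H t) -> shortcut H 0 = H 0.
Proof. by move=> ?; rewrite shortcut_left// mulr0. Qed.

Lemma shortcut_1 H : (d = 0 -> H s = H t) -> shortcut H 1 = H 1.
Proof.
by move=> ?; rewrite shortcut_right//; congr H; rewrite /l; field; rewrite gt_eqF.
Qed.

Lemma shortcut_split tau : [\/ tau <= a, 0 < d /\ a <= tau <= b | b <= tau].
Proof.
have [ta|at_] := leP tau a; first by constructor 1.
have [tb|bt] := leP tau b; last by constructor 3; exact: ltW.
constructor 2; split; last by rewrite (ltW at_).
rewrite lt_neqAle d_ge0 andbT; apply/eqP => d0.
by move: (lt_le_trans at_ tb); rewrite /a /b -d0 addr0 ltxx.
Qed.

Lemma shortcut_pos H : (d = 0 -> H s = H t) -> (forall x, 0 < H x) ->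
  forall tau, 0 < shortcut H tau.
Proof.
move=> d0 H0 tau; have [ta|[d_gt0 /andP[at_ tb]]|bt] := shortcut_split tau.
- by rewrite shortcut_left.
- rewrite shortcut_mid//; set x := _ + - _.
  have x0 : 0 <= x.
    rewrite /x dE//; apply: divr_ge0 => //.
    by rewrite subr_ge0; move: at_; rewrite /a ler_pdivrMr// [tau * _]mulrC.
  have x1 : x <= 1.
    rewrite /x dE// ler_pdivrMr// mul1r lerBlDl; move: tb.
    by rewrite /b ler_pdivlMr// mulrC.
  by have := H0 s; have := H0 t; nra.
- by rewrite shortcut_right.
Qed.

(** Up to the factor 2 pi these are areas; the middle term belongs to the frustum swept out by the
    chord. *)
Lemma shortcut_Rintegral H (C : R) : 0 <= C ->
  (forall x y, `|H x - H y| <= C * `|x - y|) -> (d = 0 -> H s = H t) ->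
  l * Rintegral mu `[0, 1] (shortcut H) =
  L * Rintegral mu `[0, s] H + d * ((H s + H t) / 2) + L * Rintegral mu `[t, 1] H.
Proof.
move=> C0 HC d0H; have Hc := lip_continuous HC.
have Sc := lip_continuous (shortcut_lip C0 HC).
have lL : 0 < l / L by rewrite divr_gt0.
rewrite (Rintegral_itv_chasles Sc a0 (le_trans ab b1)).
rewrite (Rintegral_itv_chasles Sc ab b1).
have -> : Rintegral mu `[0, a] (shortcut H) =
    Rintegral mu `[0, a] (fun x => H (l / L * x + 0)).
  apply: eq_Rintegral => x /mem_itvcc /andP[_ xa].
  by rewrite -/(shortcut H x) shortcut_left// addr0.
have -> : Rintegral mu `[b, 1] (shortcut H) =
    Rintegral mu `[b, 1] (fun x => H (l / L * x + (t - (L * s + d) / L))).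
  apply: eq_Rintegral => x /mem_itvcc /andP[bx _].
  by rewrite -/(shortcut H x) shortcut_right.
have E x : l * x = L * (l / L * x) by field; rewrite gt_eqF.
rewrite !mulrDr [l * Rintegral mu `[0, a] _]E Rintegral_itv_affine//.
rewrite [l * Rintegral mu `[b, 1] _]E Rintegral_itv_affine//.
rewrite (_ : l / L * 0 + 0 = 0); last by rewrite mulr0 addr0.
rewrite (_ : l / L * a + 0 = s); last by rewrite /a; field; rewrite !gt_eqF.
rewrite (_ : l / L * b + _ = t); last by rewrite /b; field; rewrite !gt_eqF.
rewrite (_ : l / L * 1 + _ = 1); last by rewrite /l; field; rewrite !gt_eqF.
rewrite -addrA; congr (_ + (_ + _)).
have [d0|d_neq0] := eqVneq d 0.
  by rewrite /a /b d0 addr0 set_itv1 Rintegral_set1 mulr0 mul0r.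
have d_gt0 : 0 < d by rewrite lt_neqAle eq_sym d_neq0.
pose g x := H s + x * (H t - H s).
have gc : continuous g.
  move=> x; apply: cvgD; first exact: cvg_cst.
  by apply: cvgM; [exact: cvg_id|exact: cvg_cst].
have -> : Rintegral mu `[a, b] (shortcut H) =
    Rintegral mu `[a, b] (fun x => g (l / d * x + (- (L * s / d)))).
  apply: eq_Rintegral => x /mem_itvcc /andP[ax bx].
  by rewrite -/(shortcut H x) shortcut_mid.
have E2 x : l * x = d * (l / d * x) by field; rewrite gt_eqF.
rewrite E2 Rintegral_itv_affine ?divr_gt0//; congr (_ * _).
rewrite (_ : _ + _ = 0); last by rewrite /a; field; rewrite !gt_eqF.
rewrite (_ : _ + _ = 1); last by rewrite /b; field; rewrite !gt_eqF.
have dg (x : R) : is_derive x 1 (fun x => H s * x + ((H t - H s) / 2) * x ^+ 2) (g x).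
  apply: is_derive_eq; rewrite /GRing.scale /g/=; by field.
by rewrite (Rintegral_itv_ftc ler01 gc (fun x _ => dg x)); field.
Qed.

(** The old arcs are sped up by [l / L] and the chord of length [d] is run through in time [d / l],
    so the speed is [l] on all three pieces. The corners [a] and [b] are a null set. *)
Lemma shortcut_ae_speed F G : (d = 0 -> F s = F t) -> (d = 0 -> G s = G t) ->
  s <= 1 -> 0 <= t -> d ^+ 2 = (F t - F s) ^+ 2 + (G t - G s) ^+ 2 ->
  ae_speed L F G -> ae_speed l (shortcut F) (shortcut G).
Proof.
move=> d0F d0G s1 t0 dFG FG.
have lL : 0 < l / L by rewrite divr_gt0.
have FGl := ae_affine 0 lL FG.
have FGr := ae_affine (t - (L * s + d) / L) lL FG.
have neab : {ae mu, forall x : R, x != a /\ x != b}.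
  apply: filterS2 (ae_neq a) (ae_neq b) => //.
  exact: (ae_filter_ringOfSetsType mu).
apply: filterS3 FGl FGr neab; first exact: (ae_filter_ringOfSetsType mu).
move=> x Hl Hr [xa xb]; rewrite in_itv/= => /andP[x0 x1].
have [xa'|[d_gt0 /andP[ax bx]]|bx] := shortcut_split x.
- have [|df [dg [dF dG dE2]]] := Hl.
    rewrite in_itv/= addr0 mulr_gt0//= (lt_le_trans _ s1)//.
    rewrite lt_neqAle -aE xa' andbT; apply: contraNN xa => /eqP lxs.
    by rewrite /a -lxs; apply/eqP; field; rewrite !gt_eqF.
  have {}xa : x < a by rewrite lt_neqAle xa.
  exists (df * (l / L)), (dg * (l / L)); split.
  + apply: (near_is_derive x0 xa _ (is_derive_comp_affine dF)) => y _ ya.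
    by rewrite shortcut_left//= addr0.
  + apply: (near_is_derive x0 xa _ (is_derive_comp_affine dG)) => y _ ya.
    by rewrite shortcut_left//= addr0.
  + by rewrite exprMn [X in _ + X]exprMn -mulrDl dE2; field; rewrite gt_eqF.
- have {}ax : a < x by rewrite lt_neqAle eq_sym xa.
  have {}bx : x < b by rewrite lt_neqAle xb.
  have dmid H : is_derive x 1 (shortcut H) ((l / d) * (H t - H s)).
    apply: (near_is_derive ax bx (f := fun y => (l / d * (H t - H s)) * y +
        (H s - L * s / d * (H t - H s)))) => [y ay yb|].
      by rewrite shortcut_mid//; ring.
    exact: is_derive_affine.
  exists ((l / d) * (F t - F s)), ((l / d) * (G t - G s)); split => //.
  by rewrite exprMn [X in _ + X]exprMn -mulrDr -dFG; field; rewrite gt_eqF.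
- have {}bx : b < x by rewrite lt_neqAle eq_sym xb.
  have [|df [dg [dF dG dE2]]] := Hr.
    rewrite in_itv/= (le_lt_trans t0)//=; last first.
      by rewrite addrCA ltrDl ltNge -bE' -ltNge.
    rewrite (_ : _ + _ = 1 - l / L * (1 - x)); last first.
      by rewrite /l; field; rewrite gt_eqF.
    by rewrite ltrBlDr ltrDl mulr_gt0// subr_gt0.
  exists (df * (l / L)), (dg * (l / L)); split.
  + apply: (near_is_derive bx x1 _ (is_derive_comp_affine dF)) => y by_ _.
    by rewrite shortcut_right.
  + apply: (near_is_derive bx x1 _ (is_derive_comp_affine dG)) => y by_ _.
    by rewrite shortcut_right.
  + by rewrite exprMn [X in _ + X]exprMn -mulrDl dE2; field; rewrite gt_eqF.
Qed.

End shortcut.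

Lemma shortcut_meridian (R : realType) (L s t : R) (F G : R -> R) :
  0 < L -> equilip L F G -> ae_speed L F G -> (forall x, 0 < F x) ->
  (F 0, G 0) != (F 1, G 1) ->
  0 <= s -> s <= t -> t <= 1 ->
  let d := Num.sqrt ((F t - F s) ^+ 2 + (G t - G s) ^+ 2) in
  exists2 beta, meridian (F 0, G 0) (F 1, G 1) beta &
    area beta = 2 * pi * (L * Rintegral lebesgue_measure `[0, s] F +
      d * ((F s + F t) / 2) + L * Rintegral lebesgue_measure `[t, 1] F).
Proof.
move=> L0 FG sFG F0 pq s0 st t1 d.
have d0 : 0 <= d by exact: sqrtr_ge0.
have dE : d ^+ 2 = (F t - F s) ^+ 2 + (G t - G s) ^+ 2.
  by rewrite sqr_sqrtr// addr_ge0// sqr_ge0.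
have d0FG : d = 0 -> F s = F t /\ G s = G t.
  move=> dz; move: dE; rewrite dz expr0n/= => /esym/eqP.
  rewrite paddr_eq0 ?sqr_ge0// !sqrf_eq0 !subr_eq0 => /andP[/eqP -> /eqP ->].
  by [].
have d0F (dz : d = 0) : F s = F t by case: (d0FG dz).
have d0G (dz : d = 0) : G s = G t by case: (d0FG dz).
(* The total length vanishes only if both remaining arcs and the chord are trivial, and then the two
   end points coincide. *)
have l0 : 0 < L * s + d + L * (1 - t).
  rewrite lt_neqAle eq_sym; apply/andP; split; last first.
    by rewrite !addr_ge0// mulr_ge0 ?subr_ge0// ltW.
  apply: contraNN pq; rewrite !paddr_eq0 ?mulr_ge0 ?subr_ge0 ?(ltW L0)//; last first.
    by rewrite addr_ge0// mulr_ge0// ltW.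
  rewrite !mulf_eq0 (gt_eqF L0)/= subr_eq0 => /andP[/andP[/eqP s_0 /eqP dz] /eqP t_1].
  by have := d0F dz; have := d0G dz; rewrite s_0 -t_1 => -> ->.
have [FC GC] := equilip_lip (ltW L0) FG.
have [CF FC'] : exists C, forall x y,
    `|shortcut L s t d F x - shortcut L s t d F y| <= C * `|x - y|.
  eexists; exact: (shortcut_lip L0 l0 (ltW L0) FC).
have [CG GC'] : exists C, forall x y,
    `|shortcut L s t d G x - shortcut L s t d G y| <= C * `|x - y|.
  eexists; exact: (shortcut_lip L0 l0 (ltW L0) GC).
have FCm x y : `|shortcut L s t d F x - shortcut L s t d F y| <= Num.max CF CG * `|x - y|.
  by apply: le_trans (FC' _ _) _; rewrite ler_wpM2r// le_max lexx.
have GCm x y : `|shortcut L s t d G x - shortcut L s t d G y| <= Num.max CF CG * `|x - y|.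
  by apply: le_trans (GC' _ _) _; rewrite ler_wpM2r// le_max lexx orbT.
have := arc_meridian (ltW l0) FCm GCm _
  (shortcut_ae_speed L0 d0 l0 d0F d0G (le_trans st t1) (le_trans s0 st) dE sFG).
rewrite !shortcut_0// !shortcut_1//.
rewrite (shortcut_Rintegral L0 s0 t1 d0 l0 (ltW L0) FC d0F).
move=> [|bm ba].
  by move=> x _; exact: (shortcut_pos L0 d0 l0).
by exists (fun x => (shortcut L s t d F x, shortcut L s t d G x)).
Qed.

(** * Surfaces of revolution and the Hausdorff distance *)

Section euclidean_geometry.
Context {R : realType}.
Implicit Types (o u v w e x y : 'rV[R]_3) (a b c : R).

Lemma dotvE x y : dotv x y = x 0 ord0 * y 0 ord0 +
  x 0 (lift ord0 ord0) * y 0 (lift ord0 ord0) +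
  x 0 (lift ord0 (lift ord0 ord0)) * y 0 (lift ord0 (lift ord0 ord0)).
Proof. by rewrite /dotv !big_ord_recl big_ord0 addr0 addrA. Qed.

Lemma dotvC x y : dotv x y = dotv y x.
Proof. by rewrite !dotvE; ring. Qed.

Lemma dotv_linear a b u v w : dotv (a *: u + b *: v) w = a * dotv u w + b * dotv v w.
Proof. by rewrite !dotvE !mxE; ring. Qed.

Lemma enorm_ge0 x : 0 <= enorm x. Proof. exact: sqrtr_ge0. Qed.

Lemma enorm1 e : enorm e = 1 <-> dotv e e = 1.
Proof.
have e0 : 0 <= dotv e e by rewrite dotvE !addr_ge0// -expr2 sqr_ge0.
split=> [H|]; last by rewrite /enorm => ->; rewrite sqrtr1.
by rewrite -[LHS]sqr_sqrtr// -/(enorm e) H expr1n.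
Qed.

Lemma enorm_frame u e a b : enorm u = 1 -> enorm e = 1 -> dotv e u = 0 ->
  enorm (a *: u + b *: e) = Num.sqrt (a ^+ 2 + b ^+ 2).
Proof.
move=> /enorm1 uu /enorm1 ee eu; rewrite /enorm; congr Num.sqrt.
rewrite dotv_linear dotvC [dotv e _]dotvC !dotv_linear uu ee [dotv u e]dotvC eu.
by ring.
Qed.

Lemma exists_orthonormal u : enorm u = 1 -> exists e, enorm e = 1 /\ dotv e u = 0.
Proof.
move=> /enorm1 uu.
pose x := u 0 ord0; pose y := u 0 (lift ord0 ord0).
pose z := u 0 (lift ord0 (lift ord0 ord0)).
have E : x * x + y * y + z * z = 1 by rewrite -uu dotvE.
pose vec a b c : 'rV[R]_3 := \row_(i < 3) nth 0 [:: a; b; c] i.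
have vecE a b c : (vec a b c 0 ord0 = a) * (vec a b c 0 (lift ord0 ord0) = b) *
   (vec a b c 0 (lift ord0 (lift ord0 ord0)) = c) by rewrite !mxE.
have [xy0|xy0] := eqVneq (x ^+ 2 + y ^+ 2) 0.
  move/eqP: xy0; rewrite paddr_eq0 ?sqr_ge0// !sqrf_eq0 => /andP[/eqP x0 /eqP y0].
  exists (vec 1 0 0); split; first by apply/enorm1; rewrite dotvE !vecE; ring.
  by rewrite dotvE !vecE -/x x0; ring.
have xyp : 0 < x ^+ 2 + y ^+ 2 by rewrite lt_neqAle eq_sym xy0 addr_ge0 ?sqr_ge0.
pose s := Num.sqrt (x ^+ 2 + y ^+ 2).
have sE : s ^+ 2 = x ^+ 2 + y ^+ 2 by rewrite sqr_sqrtr// ltW.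
have s0 : s != 0 by rewrite gt_eqF// sqrtr_gt0.
exists (vec (y / s) (- x / s) 0); split.
  apply/enorm1; rewrite dotvE !vecE (_ : _ + _ = (x ^+ 2 + y ^+ 2) / s ^+ 2).
    by rewrite sE divff.
  by field.
by rewrite dotvE !vecE -/x -/y; ring.
Qed.

Variables (o u : 'rV[R]_3).
Hypothesis u_unit : enorm u = 1.

Let excess (X Y : set 'rV[R]_3) : \bar R :=
  ereal_sup [set ereal_inf [set (enorm (x - y))%:E | y in Y] | x in X].

(** A point is compared with the one of equal parameter and equal angle, at distance at most sqrt 2
    times [c]; the factor 2 is a round bound. *)
Let excess_le (alpha beta : R -> R * R) c : 0 <= c ->
  (forall t : R, t \in `[0, 1] -> `|(alpha t).1 - (beta t).1| <= c /\
                              `|(alpha t).2 - (beta t).2| <= c) ->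
  (excess (surface o u alpha) (surface o u beta) <= (2 * c)%:E)%E.
Proof.
move=> c0 ab; apply: ge_ereal_sup => _ [_ [a [e [[t t01 <-] e1 eu ->]]] <-].
have [a1 a2] := ab t t01.
apply: (@le_trans _ _ (enorm (o + (alpha t).2 *: u + (alpha t).1 *: e -
   (o + (beta t).2 *: u + (beta t).1 *: e)))%:E).
  apply: ereal_inf_lbound; eexists; last by [].
  by exists (beta t), e; split => //; exists t.
rewrite (_ : _ - _ = ((alpha t).2 - (beta t).2) *: u +
  ((alpha t).1 - (beta t).1) *: e); last first.
  by apply/rowP => i; rewrite !mxE; ring.
rewrite enorm_frame// lee_fin -(@ler_pXn2r _ 2)// ?nnegrE ?sqrtr_ge0 ?mulr_ge0//.
rewrite sqr_sqrtr ?addr_ge0 ?sqr_ge0//.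
have sq (x : R) : `|x| <= c -> x ^+ 2 <= c ^+ 2.
  by move=> xc; rewrite -[x ^+ 2]real_normK ?num_real// ler_pXn2r ?nnegrE.
have := sq _ a1; have := sq _ a2; have := sqr_ge0 c.
by rewrite exprMn; lra.
Qed.

Lemma hausdorff_surface_le (alpha beta : R -> R * R) c : 0 <= c ->
  (forall t : R, t \in `[0, 1] -> `|(alpha t).1 - (beta t).1| <= c /\
                              `|(alpha t).2 - (beta t).2| <= c) ->
  (hausdorff_dist (surface o u alpha) (surface o u beta) <= (2 * c)%:E)%E.
Proof.
move=> c0 ab; rewrite /hausdorff_dist ge_max; apply/andP; split;
  apply: excess_le => // t /ab.
by rewrite distrC [X in _ /\ X <= _]distrC.
Qed.

(** The supremum over an empty set would be -oo, so a point of the surface must be exhibited; this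
    takes a unit vector orthogonal to the axis. *)
Lemma hausdorff_surface_ge0 (alpha beta : R -> R * R) :
  (0 <= hausdorff_dist (surface o u alpha) (surface o u beta))%E.
Proof.
have [e [e1 eu]] := exists_orthonormal u_unit.
rewrite /hausdorff_dist le_max; apply/orP; left.
apply: (@le_trans _ _ (ereal_inf [set (enorm (o + (alpha 0).2 *: u +
  (alpha 0).1 *: e - y))%:E
   | y in surface o u beta])).
  by apply: le_ereal_inf_tmp => _ [y _ <-]; rewrite lee_fin enorm_ge0.
apply: ereal_sup_ubound; eexists; last by [].
exists (alpha 0), e; split => //; exists 0 => //.
by rewrite /= in_itv/= lexx ler01.
Qed.

(** The centre of the disc lies on the axis, which the surface avoids. *)
Lemma surface_neq_disc (alpha : R -> R * R) (r h : R) (B : set 'rV[R]_3) : 0 <= r ->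
  (forall t : R, t \in `[0, 1] -> 0 < (alpha t).1) ->
  surface o u alpha <> disc o u r h `|` B.
Proof.
move=> r0 a0 E; have : surface o u alpha (o + h *: u).
  rewrite E; left; rewrite /disc/= subrr; split.
    by rewrite dotvE !mxE; ring.
  by rewrite /enorm dotvE !mxE !mul0r !addr0 sqrtr0.
move=> [_ [e [[t t01 <-] /enorm1 e1 eu]]] H.
have : dotv ((h - (alpha t).2) *: u + (- (alpha t).1) *: e) e = 0.
  rewrite (_ : _ + _ = o + h *: u - (o + (alpha t).2 *: u + (alpha t).1 *: e)).
    by rewrite -H subrr dotvE !mxE; ring.
  by apply/rowP => i; rewrite !mxE; ring.
rewrite dotv_linear e1 [dotv u e]dotvC eu mulr0 add0r mulr1 => /eqP.
by rewrite oppr_eq0 gt_eqF// a0.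
Qed.

End euclidean_geometry.

(** * Limits of minimizing sequences *)

Lemma ultra_cvg_bounded (T : Type) (R : realType) (U : set_system T)
  (UU : UltraFilter U) (u : T -> R) (M : R) :
  U [set j | `|u j| <= M] -> exists l : R, u j @[j --> U] --> l.
Proof.
move=> uM.
have FU : UltraFilter [set A | U (u @^-1` A)].
  split => [|G PG uG].
    exact: (fmap_proper_filter u).
  apply/seteqP; split => [A GA|]; last exact: uG.
  have [//|nA] := in_ultra_setVsetC (u @^-1` A) UU.
  have nGA : G (~` A) by apply: uG.
  by have [x []] := filter_ex (filterI GA nGA).
have := @segment_compact R (- M) M; rewrite compact_ultra => /(_ _ FU).
case.
  by rewrite /=; apply: filterS uM => j; rewrite /= in_itv/= ler_norml.
by move=> l [_ ul]; exists l.
Qed.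

Lemma cvg_sqr (T : Type) (R : realType) (F : set_system T) (FF : Filter F)
  (f : T -> R) (a : R) : f j @[j --> F] --> a -> (f j) ^+ 2 @[j --> F] --> a ^+ 2.
Proof. by move=> fa; apply: (cvgM fa fa). Qed.

Section limits_of_minimizing_sequences.
Context {R : realType}.
Local Notation mu := (@lebesgue_measure R).
Variables (p q : R * R) (Sigma : nat -> R -> R * R) (Amin delta : R).
Variables (U : set_system nat).
Hypotheses (UU : UltraFilter U) (pq : p != q) (delta_gt0 : 0 < delta).
Hypothesis Amin_le : forall beta, meridian p q beta -> Amin <= area beta.
Hypothesis Sigma_meridian : \forall j \near U, meridian p q (Sigma j).
Hypothesis Sigma_ge : \forall j \near U,
  forall t : R, t \in `[0, 1] -> delta <= (Sigma j t).1.
Hypothesis Sigma_area : area (Sigma j) @[j --> U] --> Amin.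

Let arc_of j (x : R * (R -> R) * (R -> R)) : Prop :=
  let: (L, F, G) := x in
  [/\ 0 < L, equilip L F G, ae_speed L F G, (forall t, 0 < F t) &
   [/\ forall t : R, t \in `[0, 1] -> Sigma j t = (F t, G t),
   {ae mu, forall t : R, t \in `[0, 1] -> speed (Sigma j) t = L} &
   area (Sigma j) = 2 * pi * (L * Rintegral mu `[0, 1] F)]].

Let in0 : (0 : R) \in `[0, 1]. Proof. by rewrite in_itv/= lexx ler01. Qed.
Let in1 : (1 : R) \in `[0, 1]. Proof. by rewrite in_itv/= lexx ler01. Qed.

Let pi2_gt0 : 0 < 2 * pi :> R. Proof. by rewrite mulr_gt0// pi_gt0. Qed.

Lemma limit_arc : exists (L : nat -> R) (F G : nat -> R -> R) (M : R),
  0 <= M /\ \forall j \near U, [/\ 0 < L j <= M, equilip (L j) (F j) (G j),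
    ae_speed (L j) (F j) (G j),
   (forall t, 0 < F j t) &
   [/\ forall t : R, t \in `[0, 1] -> Sigma j t = (F j t, G j t) /\ delta <= F j t,
    (F j 0, G j 0) = p, (F j 1, G j 1) = q &
   area (Sigma j) = 2 * pi * (L j * Rintegral mu `[0, 1] (F j))]].
Proof.
have /choice[x xP] : forall j, exists x, meridian p q (Sigma j) -> arc_of j x.
  move=> j; have [mj|nmj] := pselect (meridian p q (Sigma j)); last first.
    by exists (0, id, id).
  by have [L [F [G H]]] := meridian_arc pq mj; exists (L, F, G).
(* Eventually the area is at most [|Amin| + 1], and it is at least [2 * pi * delta] times the
   length. *)
pose M := (`|Amin| + 1) / (2 * pi * delta).
exists (fun j => (x j).1.1), (fun j => (x j).1.2), (fun j => (x j).2), M.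
split; first by rewrite divr_ge0// ?addr_ge0// !mulr_ge0// ?pi_ge0// ltW.
have aA : \forall j \near U, area (Sigma j) <= `|Amin| + 1.
  have : Amin < `|Amin| + 1 by rewrite (le_lt_trans (ler_norm _))// ltrDl.
  by move=> /(cvgr_le _ Sigma_area).
near=> j.
have mj : meridian p q (Sigma j) by near: j.
have := xP j mj; case: (x j) => [[L F] G] /= [L0 FG sFG F0 [SE _ aE]].
have Fd t : t \in `[0, 1] -> delta <= F t.
  move=> t01; have H : forall t : R, t \in `[0, 1] -> delta <= (Sigma j t).1 by near: j.
  by have := H t t01; rewrite SE.
split => //; last first.
  case: mj => _ _ S0 S1 _; split => //.
  - by move=> t t01; split; [exact: SE|exact: Fd].
  - by rewrite -SE.
  - by rewrite -SE.
rewrite L0/= /M ler_pdivlMr ?mulr_gt0 ?pi_gt0//.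
have : area (Sigma j) <= `|Amin| + 1 by near: j.
apply: le_trans; rewrite (_ : L * (2 * pi * delta) = 2 * pi * (L * delta)); last by ring.
rewrite aE.
rewrite !ler_pM2l//.
have [FC GC] := equilip_lip (ltW L0) FG.
rewrite -[leLHS]mulr1 -[X in _ * X](subr0 1) -Rintegral_itv_cst//.
apply: le_Rintegral_itv; [by move=> y; exact: cvg_cst|exact: lip_continuous FC|].
by move=> y y0 y1; apply: Fd; rewrite in_itv/= y0.
Unshelve. all: by end_near. Qed.

Lemma limit_meridian : exists beta, [/\ meridian p q beta, area beta = Amin &
  forall e : R, 0 < e -> \forall j \near U, forall t : R, t \in `[0, 1] ->
    `|(Sigma j t).1 - (beta t).1| <= e /\ `|(Sigma j t).2 - (beta t).2| <= e].
Proof.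
have [L [F [G [M [M0 H]]]]] := limit_arc.
have HL : \forall j \near U, 0 < L j <= M by apply: filterS H => j [].
have Hlip : \forall j \near U, (forall s t, `|F j s - F j t| <= M * `|s - t|) /\
    (forall s t, `|G j s - G j t| <= M * `|s - t|).
  apply: filterS H => j [/andP[L0 LM] FG _ _ _].
  have [FC GC] := equilip_lip (ltW L0) FG.
  by split=> s t; [apply: le_trans (FC s t) _|apply: le_trans (GC s t) _];
    rewrite ler_wpM2r.
have [Li LiP] : exists l : R, L j @[j --> U] --> l.
  apply: (@ultra_cvg_bounded _ _ _ _ _ M).
  by apply: filterS HL => j /= /andP[/ltW L0 LM]; rewrite ger0_norm.
have /choice[Fi FiP] : forall t, exists l : R, F j t @[j --> U] --> l.
  move=> t; apply: (@ultra_cvg_bounded _ _ _ _ _ (`|p.1| + M * `|t|)).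
  apply: filterS2 H Hlip => j [_ _ _ _ [_ pE _ _]] [FC _] /=.
  rewrite -(subrK (F j 0) (F j t)) addrC (le_trans (ler_normD _ _))//.
  by rewrite -pE lerD//= (le_trans (FC _ _))// subr0.
have /choice[Gi GiP] : forall t, exists l : R, G j t @[j --> U] --> l.
  move=> t; apply: (@ultra_cvg_bounded _ _ _ _ _ (`|p.2| + M * `|t|)).
  apply: filterS2 H Hlip => j [_ _ _ _ [_ pE _ _]] [_ GC] /=.
  rewrite -(subrK (G j 0) (G j t)) addrC (le_trans (ler_normD _ _))//.
  by rewrite -pE lerD//= (le_trans (GC _ _))// subr0.
have Li0 : 0 <= Li.
  by apply: (cvgr_to_ge LiP); apply: filterS HL => j /andP[/ltW].
have cst_lim (f : nat -> R) (a b : R) : f j @[j --> U] --> a ->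
    (\forall j \near U, f j = b) -> a = b.
  move=> fa fb; apply/le_anti/andP; split.
    by apply: (cvgr_to_le fa); apply: filterS fb => j ->.
  by apply: (cvgr_to_ge fa); apply: filterS fb => j ->.
have F0p : (Fi 0, Gi 0) = p.
  rewrite [p]surjective_pairing; congr pair.
    apply: (cst_lim (F^~ 0) (Fi 0) p.1 (FiP 0)).
    by apply: filterS H => j [_ _ _ _ [_ <- _ _]].
  apply: (cst_lim (G^~ 0) (Gi 0) p.2 (GiP 0)).
  by apply: filterS H => j [_ _ _ _ [_ <- _ _]].
have F1q : (Fi 1, Gi 1) = q.
  rewrite [q]surjective_pairing; congr pair.
    apply: (cst_lim (F^~ 1) (Fi 1) q.1 (FiP 1)).
    by apply: filterS H => j [_ _ _ _ [_ _ <- _]].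
  apply: (cst_lim (G^~ 1) (Gi 1) q.2 (GiP 1)).
  by apply: filterS H => j [_ _ _ _ [_ _ <- _]].
have sqd s t : (F j s - F j t) ^+ 2 + (G j s - G j t) ^+ 2 @[j --> U] -->
    (Fi s - Fi t) ^+ 2 + (Gi s - Gi t) ^+ 2.
  by apply: cvgD; apply: cvg_sqr; apply: cvgB.
have FGi : equilip Li Fi Gi.
  move=> s t; apply: (ler_cvg_to (sqd s t) (g := fun j => (L j * (s - t)) ^+ 2)).
    by apply: cvg_sqr; apply: cvgM => //; exact: cvg_cst.
  by apply: filterS H => j [_ + _ _ _]; apply.
have [FiC GiC] := equilip_lip Li0 FGi.
have LiM : Li <= M by apply: (cvgr_to_le LiP); apply: filterS HL => j /andP[].
have Fid (t : R) : t \in `[0, 1] -> delta <= Fi t.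
  move=> t01; apply: (cvgr_to_ge (FiP t)).
  by apply: filterS H => j [_ _ _ _ [SE _ _ _]]; have [] := SE t t01.
(* As in the Arzela-Ascoli theorem: the common Lipschitz constant reduces uniform convergence to the
   points of a finite grid, of mesh fine enough for an oscillation of at most [e / 3]. *)
have unif (f : nat -> R -> R) (fi : R -> R) :
    (forall t, f j t @[j --> U] --> fi t) ->
    (\forall j \near U, forall s t, `|f j s - f j t| <= M * `|s - t|) ->
    (forall s t, `|fi s - fi t| <= Li * `|s - t|) ->
    forall e : R, 0 < e -> \forall j \near U, forall t, 0 <= t -> t <= 1 ->
      `|f j t - fi t| <= e.
  move=> ffi fC fiC e e0.
  pose n := (Num.truncn (3 * (M + 1) / e)).+1.
  have n0 : 0 < n%:R :> R by rewrite ltr0n.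
  have Mn : M / n%:R <= e / 3.
    have : 3 * (M + 1) / e < n%:R by exact: truncnS_gt.
    rewrite ltr_pdivrMr// => h; rewrite ler_pdivrMr// mulrAC ler_pdivlMr//; lra.
  have grid : \forall j \near U, forall i : 'I_n.+1,
    `|f j (i%:R / n%:R) - fi (i%:R / n%:R)| <= e / 3.
    apply: filter_forall => i.
    have e3 : 0 < e / 3 by rewrite divr_gt0.
    by have /cvgrPdist_le/(_ _ e3) := ffi (i%:R / n%:R); apply: filterS => j;
      rewrite distrC.
  apply: filterS2 grid fC => j g fC t t0 t1.
  pose i := Num.truncn (t * n%:R).
  have /andP[it ti] : i%:R <= t * n%:R < i.+1%:R by apply: truncn_itv;
    rewrite mulr_ge0// ltW.
  have i_n : (i < n.+1)%N.
    by rewrite ltnS -(ler_nat R) (le_trans it)// -[leRHS]mul1r ler_wpM2r// ltW.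
  have := g (Ordinal i_n) => /=; set x := _ / _ => gx.
  have tx : `|t - x| <= n%:R^-1.
    rewrite /x ler_norml; apply/andP; split.
      by rewrite (@le_trans _ _ 0)// ?oppr_le0 ?invr_ge0 ?(ltW n0)// subr_ge0 ler_pdivrMr.
    by rewrite lerBlDr -[X in X + _]mul1r -mulrDl ler_pdivlMr// nat1r ltW.
  have h1 : `|f j t - f j x| <= e / 3.
    by rewrite (le_trans (fC _ _))// (le_trans _ Mn)// ler_wpM2l.
  have h2 : `|fi x - fi t| <= e / 3.
    rewrite (le_trans (fiC _ _))// (le_trans _ Mn)// distrC.
    by rewrite ler_pM.
  rewrite (_ : _ - _ = (f j t - f j x) + (f j x - fi x) + (fi x - fi t)); last by ring.
  rewrite (le_trans (ler_normD _ _))// (_ : e = e / 3 + e / 3 + e / 3); last by field.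
  by rewrite lerD// (le_trans (ler_normD _ _))// lerD.
have HF : \forall j \near U, forall s t, `|F j s - F j t| <= M * `|s - t|.
  by apply: filterS Hlip => j [].
have HG : \forall j \near U, forall s t, `|G j s - G j t| <= M * `|s - t|.
  by apply: filterS Hlip => j [].
have uF := unif F Fi FiP HF FiC; have uG := unif G Gi GiP HG GiC.
have Fic := lip_continuous FiC.
have intF (s t : R) : 0 <= s -> s <= t -> t <= 1 ->
    Rintegral mu `[s, t] (F j) @[j --> U] --> Rintegral mu `[s, t] Fi.
  move=> s0 st t1; apply/cvgrPdist_le => e e0.
  apply: filterS2 (uF e e0) HF => j ue FC.
  have Fjc := lip_continuous FC.
  have -> : Rintegral mu `[s, t] (F j) = Rintegral mu `[s, t] Fi +
      Rintegral mu `[s, t] (fun x => F j x + (-1) * Fi x).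
    rewrite Rintegral_itvD ?Rintegral_itvZ//; first by ring.
    by move=> x; apply: cvgM; [exact: cvg_cst|exact: Fic].
  have dc : continuous (fun x => F j x + (-1) * Fi x).
    by move=> x; apply: cvgD; [exact: Fjc|apply: cvgM; [exact: cvg_cst|exact: Fic]].
  have cc (c : R) : continuous (fun _ : R => c) by move=> x; exact: cvg_cst.
  have e1 : e * (t - s) <= e by rewrite -[leRHS]mulr1 ler_pM2l//; lra.
  rewrite opprD addNKr normrN ler_norml; apply/andP; split.
    apply: (@le_trans _ _ ((- e) * (t - s))); first by lra.
    rewrite -Rintegral_itv_cst//; apply: le_Rintegral_itv => // x sx xt.
    by have := ue x (le_trans s0 sx) (le_trans xt t1); rewrite ler_norml => /andP[]; lra.
  apply: le_trans e1; rewrite -Rintegral_itv_cst//; apply: le_Rintegral_itv => // x sx xt.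
  by have := ue x (le_trans s0 sx) (le_trans xt t1); rewrite ler_norml => /andP[]; lra.
have aE : 2 * pi * (Li * Rintegral mu `[0, 1] Fi) = Amin.
  apply: (cvg_unique (@Rhausdorff R) _ Sigma_area).
  have : 2 * pi * (L j * Rintegral mu `[0, 1] (F j)) @[j --> U] -->
      2 * pi * (Li * Rintegral mu `[0, 1] Fi).
    by apply: cvgM; [exact: cvg_cst|apply: cvgM => //; exact: intF].
  apply: cvg_trans; apply: near_eq_cvg.
  by apply: filterS H => j [_ _ _ _ [_ _ _ <-]].
(* The shortcut of the j-th meridian between [s] and [t] has area at least [Amin]. In the limit the
   outer arcs cancel against [aE], leaving the arc, weighted with the limit speed [Li], against the
   frustum over its chord. *)
have key (s t : R) : 0 <= s -> s <= t -> t <= 1 ->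
    Li * Rintegral mu `[s, t] Fi <=
    Num.sqrt ((Fi t - Fi s) ^+ 2 + (Gi t - Gi s) ^+ 2) * ((Fi s + Fi t) / 2).
  move=> s0 st t1.
  have lim : 2 * pi * (L j * Rintegral mu `[0, s] (F j) +
      Num.sqrt ((F j t - F j s) ^+ 2 + (G j t - G j s) ^+ 2) * ((F j s + F j t) / 2) +
      L j * Rintegral mu `[t, 1] (F j)) @[j --> U] -->
      2 * pi * (Li * Rintegral mu `[0, s] Fi +
      Num.sqrt ((Fi t - Fi s) ^+ 2 + (Gi t - Gi s) ^+ 2) * ((Fi s + Fi t) / 2) +
      Li * Rintegral mu `[t, 1] Fi).
    apply: cvgM; first exact: cvg_cst.
    apply: cvgD; first apply: cvgD.
    - by apply: cvgM => //; apply: intF => //; exact: le_trans st t1.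
    - apply: cvgM; first by apply: (cvg_comp _ _ (sqd t s)); exact: sqrt_continuous.
      by apply: cvgM; [exact: cvgD|exact: cvg_cst].
    - by apply: cvgM => //; apply: intF => //; exact: le_trans s0 st.
  have : Amin <= 2 * pi * (Li * Rintegral mu `[0, s] Fi +
      Num.sqrt ((Fi t - Fi s) ^+ 2 + (Gi t - Gi s) ^+ 2) * ((Fi s + Fi t) / 2) +
      Li * Rintegral mu `[t, 1] Fi).
    apply: (cvgr_to_ge lim); apply: filterS H => j [/andP[L0 _] FG sFG F0 [_ pE qE _]].
    have pq' : (F j 0, G j 0) != (F j 1, G j 1) by rewrite pE qE.
    have [beta] := shortcut_meridian L0 FG sFG F0 pq' s0 st t1.
    by rewrite pE qE => /Amin_le + <-.
  rewrite -aE ler_pM2l// (Rintegral_itv_chasles Fic s0 (le_trans st t1)).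
  by rewrite (Rintegral_itv_chasles Fic st t1); lra.
have sFGi : ae_speed Li Fi Gi.
  have dF := lip_ae_derivable (@ltr01 R) FiC.
  have dG := lip_ae_derivable (@ltr01 R) GiC.
  apply: filterS2 dF dG; first exact: (ae_filter_ringOfSetsType mu).
  move=> x dF dG x01; have {}dF := dF x01; have {}dG := dG x01.
  exists ('D_1 Fi x), ('D_1 Gi x); split; [exact/derivableP|exact/derivableP|].
  have /andP[x0 x1] : 0 < x < 1 by move: x01; rewrite in_itv.
  have dq (f : R -> R) : derivable f x 1 ->
      (h^-1 * (f (x + h) - f x)) @[h --> 0^'+] --> 'D_1 f x.
    move=> df; apply: cvg_dnbhs_at_right; apply: cvg_trans df.
    apply: near_eq_cvg; near=> h; rewrite /= /GRing.scale/=.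
    by rewrite mulr1 [h + x]addrC.
  pose S h := (h^-1 * (Fi (x + h) - Fi x)) ^+ 2 + (h^-1 * (Gi (x + h) - Gi x)) ^+ 2.
  have Slim : S h @[h --> 0^'+] --> ('D_1 Fi x) ^+ 2 + ('D_1 Gi x) ^+ 2.
    by apply: cvgD; apply: cvg_sqr; apply: dq.
  have SE h : 0 < h -> (Fi (x + h) - Fi x) ^+ 2 + (Gi (x + h) - Gi x) ^+ 2 = h ^+ 2 * S h.
    by move=> h0; rewrite /S; field; rewrite gt_eqF.
  (* One inequality is [equilip] divided by [h ^+ 2]. For the other, [key] on [[x, x + h]] divided
     by [h] tends to [Li * Fi x <= Num.sqrt D * Fi x], and [Fi x] is positive. *)
  apply/le_anti/andP; split.
    apply: (cvgr_to_le Slim); near=> h.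
    have h0 : 0 < h by near: h; exact: nbhs_right_gt.
    rewrite -(@ler_pM2l _ (h ^+ 2)) ?exprn_gt0// -SE//.
    by rewrite (le_trans (FGi _ _))// addrC addKr exprMn mulrC.
  set D := _ + _ in Slim *.
  have D0 : 0 <= D by rewrite addr_ge0// sqr_ge0.
  suff LD : Li <= Num.sqrt D.
    by rewrite -[leRHS]sqr_sqrtr// ler_pXn2r// nnegrE// sqrtr_ge0.
  have Fx0 : 0 < Fi x.
    apply: lt_le_trans delta_gt0 _; apply: Fid; rewrite in_itv/=.
    by rewrite !ltW.
  rewrite -(ler_pM2r Fx0).
  have hid : h @[h --> (0 : R)^'+] --> (0 : R).
    by apply: cvg_at_right_filter; exact: cvg_id.
  (* [Fi] varies by at most [Li * h] on [[x, x + h]]; [l1] and [l2] are the limits of the two sides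
     of [key] after this estimate and division by [h]. *)
  have l1 : Li * (Fi x - Li * h) @[h --> 0^'+] --> Li * (Fi x - Li * 0).
    apply: cvgM; first exact: cvg_cst.
    apply: cvgB; first exact: cvg_cst.
    by apply: cvgM => //; exact: cvg_cst.
  have l2 : Num.sqrt (S h) * (Fi x + Li * h) @[h --> 0^'+] --> Num.sqrt D * (Fi x +
    Li * 0).
    apply: cvgM; first by apply: (cvg_comp _ _ Slim); exact: sqrt_continuous.
    apply: cvgD; first exact: cvg_cst.
    by apply: cvgM => //; exact: cvg_cst.
  rewrite mulr0 subr0 in l1; rewrite mulr0 addr0 in l2.
  apply: (ler_cvg_to l1 l2); near=> h.
  have h0 : 0 < h by near: h; exact: nbhs_right_gt.
  have h1 : x + h <= 1.
    rewrite addrC -lerBrDr; apply: ltW; near: h; apply: nbhs_right_lt.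
    by rewrite subr_gt0.
  have := key x (x + h) (ltW x0) _ h1; rewrite lerDl (ltW h0) => /(_ isT).
  rewrite SE// sqrtrM ?sqr_ge0// sqrtr_sqr (gtr0_norm h0) => kh.
  rewrite -(ler_pM2l h0).
  have Fb y : x <= y -> y <= x + h -> `|Fi y - Fi x| <= Li * h.
    move=> xy yh; rewrite (le_trans (FiC _ _))// ler_wpM2l//.
    by rewrite ger0_norm ?subr_ge0// lerBlDl.
  have i1 : (Fi x - Li * h) * h <= Rintegral mu `[x, x + h] Fi.
    rewrite (_ : (_ - _) * _ = (Fi x - Li * h) * (x + h - x)); last by ring.
    rewrite -Rintegral_itv_cst ?lerDl ?(ltW h0)//.
    apply: le_Rintegral_itv => //; first by move=> y; exact: cvg_cst.
    by move=> y xy yh; have := Fb y xy yh; rewrite ler_norml => /andP[]; lra.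
  have i2 : (Fi x + Fi (x + h)) / 2 <= Fi x + Li * h.
    have := Fb (x + h); rewrite lerDl (ltW h0) lexx => /(_ isT isT).
    have : 0 <= Li * h by rewrite mulr_ge0// ltW.
    by rewrite ler_norml => ? /andP[]; lra.
  apply: (@le_trans _ _ (Li * Rintegral mu `[x, x + h] Fi)).
    by rewrite mulrCA ler_wpM2l// mulrC.
  apply: le_trans kh _; rewrite -mulrA ler_pM2l//.
  by rewrite ler_wpM2l// sqrtr_ge0.
exists (fun t => (Fi t, Gi t)).
have Fi0 (t : R) : t \in `[0, 1] -> 0 < Fi t by move=> /Fid; exact: lt_le_trans.
have [mb ab] := arc_meridian Li0 FiC GiC Fi0 sFGi.
rewrite F0p F1q in mb; split => //; first by rewrite ab aE.
move=> e e0; apply: filterS3 (uF e e0) (uG e e0) H =>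
  j uFe uGe [_ _ _ _ [SE _ _ _]] t t01.
have [-> _] := SE t t01; move: t01; rewrite in_itv/= => /andP[t0 t1].
by split; [exact: uFe|exact: uGe].
Unshelve. all: by end_near. Qed.

End limits_of_minimizing_sequences.

(** * Lattice points in a quarter ellipse *)

Section quarter_disc.
Context {R : realType}.
Implicit Types (x y a b t : R).

(** At [asin x] this primitive is the area under the unit quarter circle over [[0, x]]. *)
Lemma is_derive_half_angle t :
  is_derive t 1 (fun t : R => (sin t * cos t + t) / 2) (cos t ^+ 2).
Proof.
apply: is_derive_eq; rewrite /GRing.scale/= !mulr0 add0r.
have : sin t * sin t = 1 - cos t ^+ 2 by have := cos2Dsin2 t; rewrite -!expr2; lra.
by rewrite mulrN => ->; field.
Qed.

(** The left side is the integral of cos ^ 2 over [[x, y]], the right side that of cos times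
    [cos x]; cos decreases there. *)
Lemma half_angle_le x y : 0 <= x -> x <= y -> y <= pi / 2 ->
  (sin y * cos y + y) / 2 - (sin x * cos x + x) / 2 <= (sin y - sin x) * cos x.
Proof.
move=> x0 xy y2.
pose g t := sin t * cos x - (sin t * cos t + t) / 2.
have dg t : is_derive t 1 g (cos t * cos x - cos t ^+ 2).
  apply: is_deriveB; last exact: is_derive_half_angle.
  by apply: is_derive_eq; rewrite /GRing.scale/= mulr0 add0r mulrC.
have gc : continuous g.
  by move=> t; apply/differentiable_continuous/derivable1_diffP; case: (dg t).
have [c /[1!in_itv]/= /andP[xc cy] gE] := MVT_segment xy
  (fun t _ => dg t) (continuous_subspaceT gc).
have : 0 <= g y - g x.
  rewrite gE; apply: mulr_ge0; last by rewrite subr_ge0.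
  rewrite (_ : _ - _ = cos c * (cos x - cos c)); last by ring.
  apply: mulr_ge0.
    apply: cos_ge0_pihalf; rewrite (le_trans cy y2) andbT.
    by rewrite (le_trans _ (le_trans x0 xc))// oppr_le0 divr_ge0// pi_ge0.
  have pi2 : pi / 2 <= pi :> R by have := pi_ge0 R; lra.
  rewrite subr_ge0 leNgt ltr_cos -?leNgt// in_itv/=; apply/andP; split=> //;
    by lra.
by rewrite /g; lra.
Qed.

Lemma asin_homo x y : 0 <= x -> x <= y -> y <= 1 -> 0 <= asin x <= asin y.
Proof.
move=> x0 xy y1.
have pi0 := pi_ge0 R.
have itv z : 0 <= z -> z <= 1 -> asin z \in `[- (pi / 2), pi / 2].
  move=> z0 z1; have z11 : -1 <= z <= 1 by lra.
  by rewrite in_itv/= asin_geNpi2// asin_lepi2.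
have sK z : 0 <= z -> z <= 1 -> sin (asin z) = z.
  by move=> z0 z1; apply: asinK; rewrite in_itv/=; lra.
have x1 := le_trans xy y1; have y0 := le_trans x0 xy.
apply/andP; split; rewrite leNgt -ltr_sin ?itv// -?leNgt ?sin0 ?sK//.
by rewrite in_itv/=; lra.
Qed.

Lemma quarter_disc_step x y : 0 <= x -> x <= y -> y <= 1 ->
  (sin (asin y) * cos (asin y) + asin y) / 2 - (sin (asin x) * cos (asin x) + asin x) / 2
   <= (y - x) * Num.sqrt (1 - x ^+ 2).
Proof.
move=> x0 xy y1; have /andP[ax axy] := asin_homo x0 xy y1.
have y11 : -1 <= y <= 1 by lra.
have x11 : -1 <= x <= 1 by lra.
apply: le_trans (half_angle_le ax axy (asin_lepi2 y11)) _.
by rewrite !asinK ?in_itv//= cos_asin.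
Qed.

(** A left Riemann sum of step [a^-1] for a decreasing function exceeds the integral, the quarter
    disc area pi / 4. The last strip is cut off at 1 and narrower than the step. *)
Lemma quarter_disc_sum a : 0 < a ->
  a * (pi / 4) <= \sum_(0 <= k < (Num.truncn a).+1) Num.sqrt (1 - (k%:R / a) ^+ 2).
Proof.
move=> a0; pose A x := (sin (asin x) * cos (asin x) + asin x) / 2.
have /andP[Ka aK] := truncn_itv (ltW a0).
set K := Num.truncn a in Ka aK *.
have x1 k : (k <= K)%N -> k%:R / a <= 1.
  by move=> kK; rewrite ler_pdivrMr// mul1r (le_trans _ Ka)// ler_nat.
have x0 k : 0 <= k%:R / a by rewrite divr_ge0// ltW.
have S0 x : 0 <= Num.sqrt x by exact: sqrtr_ge0.
have partial m : (m <= K)%N ->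
    A (m%:R / a) - A 0 <= a^-1 * \sum_(0 <= k < m) Num.sqrt (1 - (k%:R / a) ^+ 2).
  elim: m => [|m IH] mK; first by rewrite mul0r subrr big_geq// mulr0.
  have := IH (ltnW mK); rewrite big_nat_recr//= mulrDr.
  have := @quarter_disc_step (m%:R / a) (m.+1%:R / a) (x0 m) _ (x1 _ mK).
  rewrite ler_pM2r ?invr_gt0// ler_nat leqnSn => /(_ isT).
  rewrite (_ : m.+1%:R / a - m%:R / a = a^-1); last first.
    by rewrite -natr1; field; rewrite gt_eqF.
  by rewrite /A; lra.
have last := @quarter_disc_step (K%:R / a) 1 (x0 K) (x1 _ (leqnn K)) (lexx _).
rewrite mulrC -ler_pdivlMr// [leRHS]mulrC big_nat_recr//= mulrDr.
have A1 : A 1 = pi / 4.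
  rewrite /A; have -> : asin 1 = pi / 2 :> R.
    rewrite -[in LHS]sin_pihalf sinK// in_itv/= lexx andbT.
    by have := pi_ge0 R; lra.
  by rewrite sin_pihalf cos_pihalf; field.
have A0 : A 0 = 0.
  rewrite /A; have -> : asin 0 = 0 :> R.
    by rewrite -[in LHS]sin0 sinK// in_itv/=; have := pi_ge0 R; lra.
  by rewrite sin0 mul0r addr0 mul0r.
have := partial K (leqnn K); rewrite A0 subr0.
have : (1 - K%:R / a) * Num.sqrt (1 - (K%:R / a) ^+ 2) <=
  a^-1 * Num.sqrt (1 - (K%:R / a) ^+ 2).
  rewrite ler_wpM2r// -(@ler_pM2r _ a)// mulrBl mul1r mulfVK ?gt_eqF// mulVf ?gt_eqF//.
  by move: aK; rewrite -natr1; lra.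
by move: last; rewrite -/(A 1) -/(A (K%:R / a)) A1; lra.
Qed.

(* Rows with k > a are empty because Num.sqrt is 0 on negative numbers. *)
Definition lattice_row a b k := Num.truncn (b * Num.sqrt (1 - (k%:R / a) ^+ 2)).

(** The right side counts the points (k, m) of a half ellipse with k an integer and m >= 1, the rows
    k and -k being equal. Rounding loses at most 1 in each of at most [a + 1] rows, twice, and row 0
    has at most [b] points. *)
Lemma lattice_count a b K : 0 < a -> 0 < b -> (Num.truncn a < K)%N ->
  pi / 2 * (a * b) - 2 * (a + 1) - b <=
  2 * (\sum_(0 <= k < K) (lattice_row a b k)%:R) - (lattice_row a b 0)%:R.
Proof.
move=> a0 b0 aK.
have /andP[Ka _] := truncn_itv (ltW a0).
have bs k : 0 <= b * Num.sqrt (1 - (k%:R / a) ^+ 2) by rewrite mulr_ge0 ?sqrtr_ge0// ltW.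
have row0 : (lattice_row a b 0)%:R <= b.
  have /andP[+ _] := truncn_itv (bs 0%N).
  by rewrite mul0r expr0n subr0 sqrtr1 mulr1 /lattice_row mul0r expr0n subr0 sqrtr1 mulr1.
have : b * (a * (pi / 4)) - (a + 1) <= \sum_(0 <= k < K) (lattice_row a b k)%:R.
  rewrite (big_cat_nat (leq0n _) aK)/= -[leLHS]addr0 lerD ?sumr_ge0//.
  apply: (@le_trans _ _ (\sum_(0 <= k < (Num.truncn a).+1)
      (b * Num.sqrt (1 - (k%:R / a) ^+ 2) - 1))); last first.
    apply: ler_sum => k _; have /andP[_] := truncn_itv (bs k).
    by rewrite -/(lattice_row a b k) -natr1; lra.
  rewrite big_split/= -mulr_sumr sumrN sumr_const_nat subn0.
  apply: lerB; last by rewrite -natr1 lerD2r.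
  by apply: ler_wpM2l; [exact: ltW|exact: quarter_disc_sum].
by lra.
Qed.

End quarter_disc.

(** * Area of the arcs away from the axis *)

Section telescoping.
Context {R : realDomainType}.
Variables (x g : nat -> R) (delta : R).
Hypotheses (x_ge0 : forall i, 0 <= x i) (delta_ge0 : 0 <= delta).
Hypothesis g_ge : forall i, delta <= x i -> `|x i ^+ 2 - x i.+1 ^+ 2| <= g i.
Hypothesis x_step : forall i, x i < delta -> x i.+1 <= 2 * delta.

Let g_ge0 i : delta <= x i -> 0 <= g i.
Proof. by move=> /g_ge; apply: le_trans. Qed.

(* On the way from x 0 down to delta, and from delta up to x n, the sum of the
   g i telescopes. *)
Let descend m : x 0%N ^+ 2 <= \sum_(0 <= i < m | delta <= x i) g i + delta ^+ 2 \/
  x 0%N ^+ 2 <= \sum_(0 <= i < m | delta <= x i) g i + x m ^+ 2.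
Proof.
elim: m => [|m IH]; first by right; rewrite big_geq// add0r.
have [xm|xm] := leP delta (x m).
  have := g_ge xm; have := g_ge0 xm;
    rewrite big_mkcond big_nat_recr//= -big_mkcond xm ler_norml => g0 /andP[_ gm].
  by case: IH => IH; [left|right]; lra.
rewrite big_mkcond big_nat_recr//= -big_mkcond (lt_geF xm) addr0.
case: IH => IH; left => //; apply: le_trans IH _.
by rewrite lerD2l ler_pXn2r ?nnegrE// ltW.
Qed.

Let ascend m n : (m <= n)%N -> x m < delta ->
  x n ^+ 2 <= \sum_(m <= i < n | delta <= x i) g i + 4 * delta ^+ 2.
Proof.
move=> + xm; have d2 := sqr_ge0 delta; elim: n => [|n IH].
  rewrite leqn0 => /eqP m0; move: xm; rewrite m0 => xm; rewrite big_geq// add0r.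
  by apply: (@le_trans _ _ (delta ^+ 2)); [rewrite ler_pXn2r ?nnegrE// ltW|lra].
rewrite leq_eqVlt => /predU1P[<-|].
  rewrite big_geq// add0r.
  by apply: (@le_trans _ _ (delta ^+ 2)); [rewrite ler_pXn2r ?nnegrE// ltW|lra].
rewrite ltnS => mn; have {}IH := IH mn.
have [xn|xn] := leP delta (x n).
  have := g_ge xn; rewrite big_mkcond big_nat_recr//= -big_mkcond xn ler_norml =>
    /andP[gn _].
  by lra.
rewrite (_ : 4 * _ = (2 * delta) ^+ 2); last by ring.
rewrite ler_wpDl ?sumr_ge0//; try by move=> i /g_ge0.
by rewrite ler_pXn2r ?nnegrE ?mulr_ge0// x_step.
Qed.

(** The descent stops at [delta] and loses [delta ^+ 2]. The ascent starts with a step that may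
    already lead up to [2 * delta] and loses [4 * delta ^+ 2]. For radii [x i], the left side is the
    area of the two discs divided by pi. *)
Lemma telescoping_dip m n : (m <= n)%N -> x m < delta ->
  x 0%N ^+ 2 + x n ^+ 2 <= \sum_(0 <= i < n | delta <= x i) g i + 5 * delta ^+ 2.
Proof.
move=> mn xm; have := ascend mn xm.
have : x 0%N ^+ 2 <= \sum_(0 <= i < m | delta <= x i) g i + delta ^+ 2.
  case: (descend m) => // h; apply: le_trans h _.
  by rewrite lerD2l ler_pXn2r ?nnegrE// ltW.
by rewrite (big_cat_nat (leq0n m) mn)/=; lra.
Qed.

End telescoping.

Section grid.
Context {R : realType}.
Local Notation mu := (@lebesgue_measure R).
Variables (L : R) (F : R -> R) (N : nat) (delta eta : R).
Hypotheses (L_gt0 : 0 < L) (F_gt0 : forall t, 0 < F t).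
Hypothesis FL : forall s t, `|F s - F t| <= L * `|s - t|.
Hypotheses (N_gt0 : (0 < N)%N) (eta_gt0 : 0 < eta) (eta_delta : eta <= delta / 2).
Hypothesis LN : L / N%:R <= eta.

(* A lower bound for F on the i-th arc, since F is L-Lipschitz. *)
Definition grid_height i := F (i%:R / N%:R) - L / N%:R.
(** Up to the factor 2 pi, the area of flat cylinders with the lower bounds as radii, over the arcs
    that start at distance at least [delta] from the axis. *)
Definition grid_area :=
  \sum_(0 <= i < N | delta <= F (i%:R / N%:R)) grid_height i * (L / N%:R).

Let n0 : 0 < N%:R :> R. Proof. by rewrite ltr0n. Qed.
Let l0 : 0 < L / N%:R. Proof. by rewrite divr_gt0. Qed.
Let delta_gt0 : 0 < delta. Proof. by move: eta_gt0 eta_delta; lra. Qed.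
Let kappa := 1 + 4 * eta / delta.

Lemma grid_height_le i t : i%:R / N%:R <= t -> t <= i.+1%:R / N%:R ->
  grid_height i <= F t <= grid_height i + 2 * (L / N%:R).
Proof.
move=> it ti; have := FL t (i%:R / N%:R).
have : `|t - i%:R / N%:R| <= N%:R^-1.
  by rewrite ger0_norm ?subr_ge0// lerBlDl (le_trans ti)// -natr1 mulrDl mul1r.
rewrite -(ler_pM2l L_gt0) => h /le_trans/(_ h).
by rewrite /grid_height ler_norml => /andP[h1 h2]; apply/andP; split; lra.
Qed.

Lemma grid_height_gt i : delta <= F (i%:R / N%:R) -> delta / 2 <= grid_height i.
Proof. by rewrite /grid_height; move: LN eta_delta; lra. Qed.

(** Such an arc has height at least [delta / 2], so an oscillation of [2 * eta] is at most
    [4 * eta / delta] times the height. *)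
Lemma grid_height_kappa i : delta <= F (i%:R / N%:R) ->
  grid_height i + 2 * (L / N%:R) <= kappa * grid_height i.
Proof.
move=> /grid_height_gt; set h := grid_height i => h_gt.
have : 2 * eta <= 4 * eta / delta * h.
  rewrite (_ : 2 * eta = 4 * eta / delta * (delta / 2)); last first.
    by field; rewrite gt_eqF.
  by rewrite ler_wpM2l// divr_ge0 ?mulr_ge0// ltW.
rewrite (_ : kappa * h = h + 4 * eta / delta * h); last by rewrite /kappa; ring.
by move: LN; lra.
Qed.

Let Fc : continuous F. Proof. exact: lip_continuous FL. Qed.

Let cell_le i : (i%:R / N%:R : R) <= i.+1%:R / N%:R.
Proof. by rewrite ler_pM2r ?invr_gt0// ler_nat. Qed.

Let cell_const (c : R) i :
  Rintegral mu `[i%:R / N%:R, i.+1%:R / N%:R] (fun=> c) = c / N%:R.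
Proof. by rewrite Rintegral_itv_cst// -natr1 mulrDl mul1r addrC addKr. Qed.

Let cstc (c : R) : continuous (fun _ : R => c). Proof. by move=> x; exact: cvg_cst. Qed.

Lemma grid_area_le : grid_area <= L * Rintegral mu `[0, 1] F.
Proof.
have -> : (1 : R) = N%:R / N%:R by rewrite divff ?gt_eqF.
rewrite Rintegral_cells// mulr_sumr /grid_area big_mkcond/=; apply: ler_sum => i _.
have cellF (c : R) : (forall t, i%:R / N%:R <= t -> t <= i.+1%:R / N%:R -> c <= F t) ->
    c * (L / N%:R) <= L * Rintegral mu `[i%:R / N%:R, i.+1%:R / N%:R] F.
  move=> cF; rewrite mulrCA ler_pM2l// -(cell_const c i).
  exact: le_Rintegral_itv.
case: ifP => _; last first.
  by rewrite -(mul0r (L / N%:R)); apply: cellF => t _ _; exact: ltW.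
by apply: cellF => t it ti; have /andP[] := grid_height_le it ti.
Qed.

(** The difference of two squared radii is their difference, at most the arc length, times their
    sum, at most [2 * kappa] times the height: the annulus between two parallel circles is no larger
    than the band joining them. *)
Lemma grid_area_dip m : (m <= N)%N -> F (m%:R / N%:R) < delta ->
  F 0 ^+ 2 + F 1 ^+ 2 <= 2 * kappa * grid_area + 5 * delta ^+ 2.
Proof.
move=> mN Fm.
have := @telescoping_dip _ (fun i => F (i%:R / N%:R))
  (fun i => 2 * kappa * (grid_height i * (L / N%:R))) delta _ _ _ _ m N mN Fm.
rewrite -mulr_sumr mul0r divff ?gt_eqF//; apply.
- by move=> i; exact: ltW.
- exact: ltW.
- move=> i Fi; have := grid_height_kappa Fi.
  have /andP[h1 h2] := grid_height_le (lexx _) (cell_le i).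
  have /andP[h3 h4] := grid_height_le (cell_le i) (lexx _).
  have hd := grid_height_gt Fi.
  rewrite subr_sqr normrM => hk.
  have s1 : `|F (i%:R / N%:R) - F (i.+1%:R / N%:R)| <= L / N%:R.
    rewrite (le_trans (FL _ _))// distrC ger0_norm ?subr_ge0//.
    by rewrite -natr1 mulrDl mul1r addrC addKr.
  have s2 : `|F (i%:R / N%:R) + F (i.+1%:R / N%:R)| <= 2 * (kappa * grid_height i).
    rewrite ger0_norm; last by rewrite addr_ge0// ltW.
    by move: hk h2 h4; set kh := kappa * _; lra.
  have := ler_pM (normr_ge0 _) (normr_ge0 _) s1 s2; move/le_trans; apply.
  by rewrite le_eqVlt; apply/orP; left; apply/eqP; ring.
- move=> i /= Fi; have /andP[_] := grid_height_le (cell_le i) (lexx _).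
  rewrite /grid_height; move: LN eta_delta delta_gt0 Fi.
  by set a := F _; set b := F _; set c := L / _; lra.
Qed.

(** If no grid point is closer than [delta] to the axis, then all arcs count and only the factor
    [kappa] is lost; otherwise the meridian dips towards the axis and the discs give the bound. *)
Lemma grid_area_ge :
  L * Rintegral mu `[0, 1] F <= kappa * grid_area \/
  F 0 ^+ 2 + F 1 ^+ 2 <= 2 * kappa * grid_area + 5 * delta ^+ 2.
Proof.
have [[m [mN Fm]]|nodip] := pselect (exists m, (m <= N)%N /\ F (m%:R / N%:R) < delta).
  by right; exact: grid_area_dip Fm.
left; have Fd i : (i <= N)%N -> delta <= F (i%:R / N%:R).
  by move=> iN; rewrite leNgt; apply/negP => Fi; apply: nodip; exists i.
have -> : (1 : R) = N%:R / N%:R by rewrite divff ?gt_eqF.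
rewrite Rintegral_cells// !mulr_sumr /grid_area [leRHS]big_mkcond/= !big_nat.
apply: ler_sum => i /andP[_ iN]; rewrite Fd ?(ltnW iN)//.
rewrite mulrA [leRHS]mulrA mulrAC [leRHS]mulrC ler_pM2l// .
apply: (@le_trans _ _ ((grid_height i + 2 * (L / N%:R)) / N%:R)).
  rewrite -(cell_const _ i); apply: le_Rintegral_itv => // t it ti.
  by have /andP[] := grid_height_le it ti.
by rewrite ler_pM2r ?invr_gt0// grid_height_kappa// Fd// ltnW.
Qed.

Lemma grid_area_near_axis t : 0 <= t -> t <= 1 -> F t < delta / 2 ->
  F 0 ^+ 2 + F 1 ^+ 2 <= 2 * kappa * grid_area + 5 * delta ^+ 2.
Proof.
move=> t0 t1 Ft; pose i := Num.truncn (t * N%:R).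
have /andP[it ti] : i%:R <= t * N%:R < i.+1%:R by apply: truncn_itv;
  rewrite mulr_ge0// ltW.
have iN : (i <= N)%N by rewrite -(ler_nat R) (le_trans it)//
  -[leRHS]mul1r ler_wpM2r// ltW.
apply: (grid_area_dip iN).
have /andP[+ _] : grid_height i <= F t <= grid_height i + 2 * (L / N%:R).
  by apply: grid_height_le; rewrite ?ler_pdivrMr ?ler_pdivlMr// ltW.
by rewrite /grid_height; move: LN eta_delta; lra.
Qed.

End grid.

(** * Upper bounds for the eigenvalues *)

Section trigonometric_integrals.
Context {R : realType}.
Local Notation mu := (@lebesgue_measure R).

Lemma sin_natpi n : sin (pi * n%:R) = 0 :> R.
Proof.
elim: n => [|n IH]; first by rewrite mulr0 sin0.
by rewrite -natr1 mulrDr mulr1 sinDpi IH oppr0.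
Qed.

Lemma norm_cos_sin_le1 (x : R) : `|cos x| <= 1 /\ `|sin x| <= 1.
Proof.
have := cos2Dsin2 x; have := sqr_ge0 (cos x); have := sqr_ge0 (sin x) => h1 h2 h3.
have H y : y ^+ 2 <= 1 -> `|y| <= 1 :> R.
  by rewrite -[y ^+ 2]real_normK ?num_real// -[leRHS](expr1n _ 2) ler_pXn2r ?nnegrE.
by split; apply: H; lra.
Qed.

Lemma is_derive_sinM (c t : R) : is_derive t 1 (fun t : R =>
  sin (c * t)) (c * cos (c * t)).
Proof.
have dc : is_derive t 1 (fun t : R => c * t) c.
  by have := is_deriveZ c (is_derive_id t 1); rewrite /GRing.scale/= mulr1.
by rewrite mulrC; apply: (@is_derive1_comp R sin (fun t => c * t) t).
Qed.

Lemma continuous_cosM (c : R) : continuous (fun t : R => cos (c * t)).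
Proof.
move=> t; apply: continuous_comp; last exact: continuous_cos.
by apply: cvgM; [exact: cvg_cst|exact: cvg_id].
Qed.

Lemma continuous_sinM (c : R) : continuous (fun t : R => sin (c * t)).
Proof.
move=> t; apply: continuous_comp; last exact: continuous_sin.
by apply: cvgM; [exact: cvg_cst|exact: cvg_id].
Qed.

Lemma continuous_sum (I : Type) (r : seq I) (f : I -> R -> R) :
  (forall i, continuous (f i)) -> continuous (fun t => \sum_(i <- r) f i t).
Proof.
move=> fc; elim: r => [|i r IH].
  rewrite (_ : (fun _ => _) = (fun=> 0)); first by move=> x; exact: cvg_cst.
  by apply/funext => t; rewrite big_nil.
rewrite (_ : (fun _ => _) = (fun t => f i t + \sum_(i <- r) f i t)).
  by move=> x; apply: cvgD; [exact: fc|exact: IH].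
by apply/funext => t; rewrite big_cons.
Qed.

Lemma Rintegral_itv_sum (I : Type) (r : seq I) (f : I -> R -> R) (a b : R) :
  (forall i, continuous (f i)) ->
  Rintegral mu `[a, b] (fun t => \sum_(i <- r) f i t) =
  \sum_(i <- r) Rintegral mu `[a, b] (f i).
Proof.
move=> fc; have sc s := @continuous_sum I s f fc.
elim: r => [|i r IH].
  rewrite big_nil (_ : (fun _ => _) = (fun t : R => 0 * t)).
    by rewrite Rintegral_itvZ ?mul0r// => x; exact: cvg_id.
  by apply/funext => t; rewrite big_nil mul0r.
rewrite big_cons -IH -Rintegral_itvD//.
by apply: eq_Rintegral => t _; rewrite big_cons.
Qed.

Lemma Rintegral_itv_orthogonal M (phi : nat -> R -> R) (c : nat -> R) (a b h : R) :
  (forall m, continuous (phi m)) ->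
  (forall m m', Rintegral mu `[a, b] (fun t => phi m t * phi m' t) =
     if m == m' then h else 0) ->
  Rintegral mu `[a, b] (fun t => (\sum_(0 <= m < M) c m * phi m t) ^+ 2) =
  \sum_(0 <= m < M) c m ^+ 2 * h.
Proof.
move=> pc orth.
have pc2 m m' : continuous (fun t => phi m t * phi m' t).
  by move=> x; apply: cvgM; exact: pc.
have cpc2 m m' : continuous (fun t => c m * c m' * (phi m t * phi m' t)).
  by move=> x; apply: cvgM; [exact: cvg_cst|exact: pc2].
rewrite (_ : (fun t => _) = (fun t => \sum_(0 <= m < M) \sum_(0 <= m' < M)
    c m * c m' * (phi m t * phi m' t))); last first.
  apply/funext => t; rewrite expr2 big_distrl/=; apply: eq_bigr => m _.
  by rewrite big_distrr/=; apply: eq_bigr => m' _; ring.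
rewrite Rintegral_itv_sum; last first.
  by move=> m; apply: continuous_sum.
rewrite !big_nat; apply: eq_bigr => m /andP[_ mM].
rewrite Rintegral_itv_sum// (bigD1_seq m)/= ?mem_index_iota ?iota_uniq//.
rewrite Rintegral_itvZ// orth eqxx big1 ?addr0 ?expr2// => m' m'm.
by rewrite Rintegral_itvZ// orth eq_sym (negbTE m'm) mulr0.
Qed.

Variable N : nat.
Hypothesis N_gt0 : (0 < N)%N.

Let n0 : 0 < N%:R :> R. Proof. by rewrite ltr0n. Qed.

(* There are N arcs; the sine with frequency freq m has m + 1 half-waves on each. *)
Definition freq m : R := pi * m.+1%:R * N%:R.

Lemma freq_gt0 m : 0 < freq m.
Proof. by rewrite !mulr_gt0// pi_gt0. Qed.

Lemma sin_freq m i : sin (freq m * (i%:R / N%:R)) = 0.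
Proof.
rewrite (_ : _ * _ = pi * (m.+1 * i)%:R) ?sin_natpi//.
by rewrite /freq natrM; field; rewrite gt_eqF.
Qed.

Let cell (i : nat) (f : R -> R) := Rintegral mu `[i%:R / N%:R, i.+1%:R / N%:R] f.

Let cell_le i : (i%:R / N%:R : R) <= i.+1%:R / N%:R.
Proof. by rewrite ler_pM2r ?invr_gt0// ler_nat. Qed.

Let cell_cst i (c : R) : cell i (fun=> c) = c / N%:R.
Proof. by rewrite /cell Rintegral_itv_cst// -natr1 mulrDl mul1r addrC addKr. Qed.

Let cell_cos i m : cell i (fun t => cos (freq m * t)) = 0.
Proof.
have dF (x : R) : is_derive x 1 (fun t : R =>
  (freq m)^-1 * sin (freq m * t)) (cos (freq m * x)).
  have := is_deriveZ (freq m)^-1 (is_derive_sinM (freq m) x).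
  by rewrite /GRing.scale/= mulrA mulVf ?gt_eqF ?freq_gt0// mul1r.
rewrite /cell (Rintegral_itv_ftc (cell_le i) (@continuous_cosM (freq m)) (fun x _ =>
  dF x)).
by rewrite !sin_freq !mulr0 subrr.
Qed.

(** Sums and differences of distinct frequencies are frequencies again, up to sign, with index
    shifted by one because [freq m] has the factor m + 1. The coefficient [e] is -1/2 for products
    of sines and 1/2 for products of cosines. *)
Let cell_cosB i m m' (e : R) : m != m' ->
  cell i (fun t => 2^-1 * cos ((freq m - freq m') * t) + e * cos ((freq m +
    freq m') * t)) = 0.
Proof.
move=> mm'; rewrite /cell Rintegral_itvD; last 2 first.
- by move=> x; apply: cvgM; [exact: cvg_cst|exact: continuous_cosM].
- by move=> x; apply: cvgM; [exact: cvg_cst|exact: continuous_cosM].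
rewrite !Rintegral_itvZ; try exact: continuous_cosM.
have -> : freq m + freq m' = freq (m + m').+1.
  by rewrite /freq -mulrDl -mulrDr -natrD addSn addnS.
rewrite [X in _ + _ * X]cell_cos mulr0 addr0.
have diff p p' : (p' < p)%N -> freq p - freq p' = freq (p - p').-1.
  move=> pp; rewrite /freq -mulrBl -mulrBr -natrB; last exact: ltnW.
  by rewrite subSS prednK// subn_gt0.
have [mm|mm] := ltnP m' m; first by rewrite diff// [X in _ * X]cell_cos mulr0.
have {}mm : (m < m')%N by rewrite ltn_neqAle mm'.
rewrite (_ : (fun t => _) = (fun t : R => cos (freq (m' - m).-1 * t))).
  by rewrite [X in _ * X]cell_cos mulr0.
by apply/funext => t; rewrite -cosN -mulNr opprB diff.
Qed.

Lemma cell_sin_orthogonal i m m' :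
  cell i (fun t => sin (freq m * t) * sin (freq m' * t)) =
  if m == m' then (2 * N%:R)^-1 else 0.
Proof.
rewrite (_ : (fun t => _) = (fun t => 2^-1 * cos ((freq m - freq m') * t) +
   (- 2^-1) * cos ((freq m + freq m') * t))); last first.
  by apply/funext => t; rewrite mulrBl mulrDl cosB cosD; field.
case: eqVneq => [<-|mm']; last exact: cell_cosB.
rewrite subrr /cell Rintegral_itvD; last 2 first.
- by move=> x; apply: cvgM; [exact: cvg_cst|exact: continuous_cosM].
- by move=> x; apply: cvgM; [exact: cvg_cst|exact: continuous_cosM].
rewrite !Rintegral_itvZ; try exact: continuous_cosM.
have -> : freq m + freq m = freq (m + m).+1.
  by rewrite /freq -mulrDl -mulrDr -natrD addSn addnS.
rewrite [X in _ + _ * X]cell_cos mulr0 addr0.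
rewrite (_ : (fun t => _) = (fun t : R => 1)); last by apply/funext => t;
  rewrite mul0r cos0.
by rewrite [X in _ * X]cell_cst; field; rewrite gt_eqF.
Qed.

Lemma cell_cos_orthogonal i m m' :
  cell i (fun t => cos (freq m * t) * cos (freq m' * t)) =
  if m == m' then (2 * N%:R)^-1 else 0.
Proof.
rewrite (_ : (fun t => _) = (fun t => 2^-1 * cos ((freq m - freq m') * t) +
   2^-1 * cos ((freq m + freq m') * t))); last first.
  by apply/funext => t; rewrite mulrBl mulrDl cosB cosD; field.
case: eqVneq => [<-|mm']; last exact: cell_cosB.
rewrite subrr /cell Rintegral_itvD; last 2 first.
- by move=> x; apply: cvgM; [exact: cvg_cst|exact: continuous_cosM].
- by move=> x; apply: cvgM; [exact: cvg_cst|exact: continuous_cosM].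
rewrite !Rintegral_itvZ; try exact: continuous_cosM.
have -> : freq m + freq m = freq (m + m).+1.
  by rewrite /freq -mulrDl -mulrDr -natrD addSn addnS.
rewrite [X in _ + _ * X]cell_cos mulr0 addr0.
rewrite (_ : (fun t => _) = (fun t : R => 1)); last by apply/funext => t;
  rewrite mul0r cos0.
by rewrite [X in _ * X]cell_cst; field; rewrite gt_eqF.
Qed.

End trigonometric_integrals.

(** * Sines supported on single arcs *)

Section cells.
Context {R : realType}.
Local Notation mu := (@lebesgue_measure R).
Variable N : nat.
Hypothesis N_gt0 : (0 < N)%N.

Let n0 : 0 < N%:R :> R. Proof. by rewrite ltr0n. Qed.

Let cell_le i : (i%:R / N%:R : R) <= i.+1%:R / N%:R.
Proof. by rewrite ler_pM2r ?invr_gt0// ler_nat. Qed.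

Lemma cell_of (t : R) : 0 <= t -> t < 1 ->
  exists2 i : nat, (i < N)%N & i%:R / N%:R <= t < i.+1%:R / N%:R.
Proof.
move=> t0 t1; exists (Num.truncn (t * N%:R)).
  by rewrite truncn_lt_nat ?mulr_ge0// -[ltRHS]mul1r ltr_pM2r.
rewrite ler_pdivrMr// ltr_pdivlMr//; apply: truncn_itv.
by rewrite mulr_ge0.
Qed.

(** The integral of a possibly nonmeasurable [f] cannot be split into cells; [f] is first dominated
    by the sum [h] of the restricted [g i], and only the integral of [h] is split. *)
Lemma Rintegral_cells_le (f : R -> R) (g : nat -> R -> R) :
  (forall t, 0 <= t <= 1 -> 0 <= f t) -> (forall i t, 0 <= g i t) ->
  (forall i, continuous (g i)) ->
  {ae mu, forall t : R, forall i, (i < N)%N -> i%:R / N%:R < t < i.+1%:R / N%:R ->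
     f t <= g i t} ->
  Rintegral mu `[0, 1] f <=
  \sum_(0 <= i < N) Rintegral mu `[i%:R / N%:R, i.+1%:R / N%:R] (g i).
Proof.
move=> f0 g0 gc fg.
pose I i : set R := `[i%:R / N%:R, i.+1%:R / N%:R]%classic.
have intg i : (\int[mu]_(x in I i) (g i x)%:E = (Rintegral mu (I i) (g i))%:E)%E.
  rewrite /Rintegral fineK//; apply: integrable_fin_num; first exact: measurable_itv.
  exact: continuous_itv_integrable.
have IS i : (i < N)%N -> I i `<=` `[0, 1]%classic.
  move=> iN t; rewrite /I /= !in_itv/= => /andP[it ti].
  rewrite (le_trans _ it) ?divr_ge0//= (le_trans ti)// ler_pdivrMr// mul1r.
  by rewrite ler_nat.
pose h t := (\sum_(0 <= i < N) ((EFin \o g i) \_ (I i)) t)%E.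
have gI0 i t : (0 <= ((EFin \o g i) \_ (I i)) t)%E.
  by apply: erestrict_ge0 => x _; rewrite lee_fin.
have hE : (\int[mu]_(t in `[0%R, 1%R]) h t =
    (\sum_(0 <= i < N) Rintegral mu (I i) (g i))%:E)%E.
  have mI i : measurable_fun (`[(0 : R),
    1]%classic : set (measurableTypeR R)) ((EFin \o g i) \_ (I i)).
    apply: (@measurable_funS _ _ _ _ setT) => //.
    apply/(measurable_restrictT _ _).1; first exact: measurable_itv.
    apply/measurable_EFinP; apply: measurable_funTS.
    exact: continuous_measurable_fun (gc i).
  have gI0' i (x : R) : `[(0 : R), 1]%classic x ->
    (0 <= ((EFin \o g i) \_ (I i)) x)%E by [].
  apply: eq_trans (ge0_integral_sum mu (measurable_itv _) mI gI0' _) _.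
  rewrite -sumEFin !big_nat; apply: eq_bigr => i /andP[_ iN].
  rewrite -intg -integral_mkcondr (_ : _ `&` _ = I i)//.
  by apply/setIidPr; exact: IS.
have fh : (\int[mu]_(t in `[0%R, 1%R]) (f t)%:E <= \int[mu]_(t in `[0%R, 1%R]) h t)%E.
  apply: ge0_ae_le_nonmeasurable_integral.
  - by move=> t /=; rewrite in_itv/= lee_fin => /f0.
  - by move=> t _; apply: sume_ge0.
  have grid : {ae mu, forall t : R, forall i : 'I_N.+1, t != i%:R / N%:R}.
    by apply: filter_forall => i; exact: ae_neq.
  apply: filterS2 fg grid; first exact: (ae_filter_ringOfSetsType mu).
  move=> t H tne; rewrite /= in_itv/= => /andP[t0 t1].
  have {}t1 : t < 1.
    rewrite lt_neqAle t1 andbT; have := tne ord_max.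
    by rewrite /= divff// gt_eqF.
  have [i iN /andP[it ti]] := cell_of t0 t1.
  have {}it : i%:R / N%:R < t.
    rewrite lt_neqAle it andbT eq_sym.
    by have := tne (widen_ord (leqnSn N) (Ordinal iN)).
  rewrite /h (bigD1_seq i)/= ?mem_index_iota ?iota_uniq//.
  rewrite -[leLHS]adde0 leeD//; last by apply: sume_ge0.
  rewrite patchE mem_set ?lee_fin; first by apply: H => //; rewrite it ti.
  by rewrite /I /= in_itv/= !ltW.
have fh' := fh; rewrite -lee_fin -hE; apply: le_trans fh.
rewrite /Rintegral fineK// ge0_fin_numE; last first.
  by apply: integral_ge0 => t /=; rewrite in_itv/= lee_fin => /f0.
by rewrite (le_lt_trans fh')// hE ltry.
Qed.

(** Clamping the argument to the cell cuts the sine off at zeros, so the Lipschitz constant is kept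
    without a case distinction. *)
Definition bump i m (t : R) := sin (freq N m * clamp (i%:R / N%:R) (i.+1%:R / N%:R) t).

Lemma bump_in i m t : i%:R / N%:R <= t <= i.+1%:R / N%:R ->
  bump i m t = sin (freq N m * t).
Proof. by move=> it; rewrite /bump clamp_id. Qed.

Lemma bump_left i m t : t <= i%:R / N%:R -> bump i m t = 0.
Proof.
by move=> ti; rewrite /bump /clamp max_l ?sin_freq// ge_min ti orbT.
Qed.

Lemma bump_right i m t : i.+1%:R / N%:R <= t -> bump i m t = 0.
Proof.
by move=> it; rewrite /bump /clamp min_l// max_r// sin_freq.
Qed.

Lemma bump_lip i m x y : `|bump i m x - bump i m y| <= freq N m * `|x - y|.
Proof.
have f0 := ltW (@freq_gt0 R N N_gt0 m).
rewrite /bump; set a := clamp _ _ x; set b := clamp _ _ y.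
apply: (@le_trans _ _ (freq N m * `|a - b|)); last by rewrite ler_wpM2l// clamp_lip.
wlog ab : a b / a <= b => [H|].
  have [|/ltW] := leP a b; first exact: H.
  by move=> /H; rewrite distrC (distrC b a).
have [c _] := MVT_segment ab (fun t _ => is_derive_sinM (freq N m) t)
  (continuous_subspaceT (@continuous_sinM R (freq N m))).
rewrite distrC (distrC a b) => ->; rewrite normrM.
rewrite normrM ger0_norm// ler_wpM2r// -[leRHS]mulr1 ler_wpM2l//.
exact: (norm_cos_sin_le1 _).1.
Qed.

Lemma bump_continuous i m : continuous (bump i m).
Proof. exact: lip_continuous (bump_lip i m). Qed.

Lemma bump_Lip0 i m : (i < N)%N -> Lip0 (bump i m).
Proof.
move=> iN; split.
  by apply/lipschitz_onP; exists (freq N m) => s t _ _; exact: bump_lip.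
move=> t; rewrite in_itv/= negb_and -!leNgt => /orP[t0|t1].
  by rewrite bump_left// (le_trans t0)// divr_ge0.
by rewrite bump_right// (le_trans _ t1)// ler_pdivrMr// mul1r ler_nat.
Qed.

Variables (M : nat) (c : nat -> nat -> R).

Definition bumps t := \sum_(0 <= i < N) \sum_(0 <= m < M) c i m * bump i m t.
Definition cell_bumps i t := \sum_(0 <= m < M) c i m * sin (freq N m * t).
Definition cell_dbumps i t := \sum_(0 <= m < M) (c i m * freq N m) * cos (freq N m * t).

Lemma bumps_cell i t : (i < N)%N -> i%:R / N%:R <= t <= i.+1%:R / N%:R ->
  bumps t = cell_bumps i t.
Proof.
move=> iN it; rewrite /bumps (bigD1_seq i)/= ?mem_index_iota ?iota_uniq//.
rewrite [X in _ + X]big1 ?addr0; first by apply: eq_bigr => m _; rewrite bump_in.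
move=> i' i'i; apply: big1 => m _; move: it => /andP[it ti].
move: i'i; rewrite neq_ltn => /orP[i'i|ii'].
  rewrite bump_right ?mulr0// (le_trans _ it)// ler_pM2r ?invr_gt0//.
  by rewrite ler_nat.
rewrite bump_left ?mulr0// (le_trans ti)// ler_pM2r ?invr_gt0//.
by rewrite ler_nat.
Qed.

Lemma bumps_continuous : continuous bumps.
Proof.
apply: continuous_sum => i; apply: continuous_sum => m x.
by apply: cvgM; [exact: cvg_cst|exact: bump_continuous].
Qed.

Lemma cell_bumps_continuous i : continuous (cell_bumps i).
Proof.
apply: continuous_sum => m x.
by apply: cvgM; [exact: cvg_cst|exact: continuous_sinM].
Qed.

Lemma cell_dbumps_continuous i : continuous (cell_dbumps i).
Proof.
apply: continuous_sum => m x.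
by apply: cvgM; [exact: cvg_cst|exact: continuous_cosM].
Qed.

Lemma is_derive_cell_bumps i (t : R) : is_derive t 1 (cell_bumps i) (cell_dbumps i t).
Proof.
rewrite /cell_bumps /cell_dbumps; elim: (index_iota 0 M) => [|m r IH].
  rewrite big_nil (_ : (fun _ => _) = cst 0); first exact: is_derive_cst.
  by apply/funext => x; rewrite big_nil.
rewrite big_cons (_ : (fun _ => _) = (fun x => c i m * sin (freq N m * x)) +
    (fun x => \sum_(j <- r) c i j * sin (freq N j * x))); last first.
  by apply/funext => x; rewrite big_cons.
apply: is_deriveD => //.
have := is_deriveZ (c i m) (is_derive_sinM (freq N m) t).
by rewrite /GRing.scale/= mulrA.
Qed.

Lemma bumps_derive1 i t : (i < N)%N -> i%:R / N%:R < t < i.+1%:R / N%:R ->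
  derive1 bumps t = cell_dbumps i t.
Proof.
move=> iN /andP[it ti]; rewrite derive1E.
have [_ <-] := is_derive_cell_bumps i t.
apply: near_eq_derive; near=> x; apply: bumps_cell => //.
by apply/andP; split; apply: ltW; near: x; [exact: lt_nbhsr|exact: lt_nbhsl].
Unshelve. all: by end_near. Qed.

Lemma Rintegral_cell_bumps i :
  Rintegral mu `[i%:R / N%:R, i.+1%:R / N%:R] (fun t => cell_bumps i t ^+ 2) =
  \sum_(0 <= m < M) c i m ^+ 2 * (2 * N%:R)^-1.
Proof.
apply: (@Rintegral_itv_orthogonal R M (fun m t => sin (freq N m * t)) (c i)).
  by move=> m; exact: continuous_sinM.
by move=> m m'; exact: cell_sin_orthogonal.
Qed.

Lemma Rintegral_cell_dbumps i :
  Rintegral mu `[i%:R / N%:R, i.+1%:R / N%:R] (fun t => cell_dbumps i t ^+ 2) =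
  \sum_(0 <= m < M) (c i m * freq N m) ^+ 2 * (2 * N%:R)^-1.
Proof.
apply: (@Rintegral_itv_orthogonal R M (fun m t => cos (freq N m * t)) (fun m =>
  c i m * freq N m)).
  by move=> m; exact: continuous_cosM.
by move=> m m'; exact: cell_cos_orthogonal.
Qed.

End cells.

(** * Rayleigh quotients of combinations of sines *)

Section rayleigh_quotients.
Context {R : realType}.
Local Notation mu := (@lebesgue_measure R).
Variables (alpha : R -> R * R) (L : R) (F : R -> R).
Hypotheses (L_gt0 : 0 < L) (Fc : continuous F) (F_gt0 : forall t, 0 < F t).
Hypothesis alphaF : forall t : R, t \in `[0, 1] -> (alpha t).1 = F t.
Hypothesis alpha_speed :
  {ae mu, forall t : R, t \in `[0, 1] -> speed alpha t = L}.
Variables (N M k : nat) (good : pred nat) (f : nat -> R) (kappa Lambda : R).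
Hypotheses (N_gt0 : (0 < N)%N) (kappa_ge0 : 0 <= kappa).
Hypothesis f_gt0 : forall i, 0 < f i.
Hypothesis f_good : forall i t, (i < N)%N -> good i ->
  i%:R / N%:R <= t <= i.+1%:R / N%:R -> f i <= F t <= kappa * f i.

(** Since [freq N m / L] is pi (m + 1) divided by the arc length [L / N], for [kappa = 1] the left
    side is a Dirichlet eigenvalue of the flat cylinder of radius [f i] over the arc. The factor
    [kappa] accounts for radii up to [kappa * f i] in the gradient term. *)
Definition admissible i m := good i &&
  (kappa * freq N m ^+ 2 / L ^+ 2 + k%:R ^+ 2 / f i ^+ 2 <= Lambda).

Let n0 : 0 < N%:R :> R. Proof. by rewrite ltr0n. Qed.

Let cell_le i : (i%:R / N%:R : R) <= i.+1%:R / N%:R.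
Proof. by rewrite ler_pM2r ?invr_gt0// ler_nat. Qed.

Section one_combination.
Variable c : nat -> nat -> R.
Hypothesis c_admissible : forall i m, (i < N)%N -> (m < M)%N ->
  c i m != 0 -> admissible i m.

Let bad_cell i t : (i < N)%N -> ~~ good i ->
  cell_bumps N M c i t = 0 /\ cell_dbumps N M c i t = 0.
Proof.
move=> iN bad; have c0 m : (m < M)%N -> c i m = 0.
  move=> mM; apply/eqP; apply: contraNT bad => /(c_admissible iN mM).
  by case/andP.
split; rewrite /cell_bumps /cell_dbumps big_nat big1// => m /andP[_ mM].
  by rewrite c0// mul0r.
by rewrite c0// !mul0r.
Qed.

(** The denominator of the Rayleigh quotient with [F] replaced by [f i] on each cell; orthogonality
    makes it a diagonal quadratic form. *)
Definition bumps_mass :=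
  \sum_(0 <= i < N) \sum_(0 <= m < M) c i m ^+ 2 * (f i * L * (2 * N%:R)^-1).

Let continuousM2 (g h : R -> R) :
  continuous g -> continuous h -> continuous (fun t => g t * h t).
Proof. by move=> gc hc x; apply: cvgM; [exact: gc|exact: hc]. Qed.

Let continuousZ (a : R) (g : R -> R) : continuous g -> continuous (fun t => a * g t).
Proof. by move=> gc x; apply: cvgM; [exact: cvg_cst|exact: gc]. Qed.

Let continuousX2 (g : R -> R) : continuous g -> continuous (fun t => g t ^+ 2).
Proof. by move=> gc x; apply: (cvgM (gc x) (gc x)). Qed.

Lemma rayleigh_denominator :
  bumps_mass <= Rintegral mu `[0, 1] (fun t =>
    bumps N M c t ^+ 2 * (alpha t).1 * speed alpha t).
Proof.
have -> : Rintegral mu `[0, 1] (fun t => bumps N M c t ^+ 2 * (alpha t).1 * speed alpha t)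
   = Rintegral mu `[0, 1] (fun t => L * (bumps N M c t ^+ 2 * F t)).
  apply: ge0_ae_eq_nonmeasurable_Rintegral.
  - move=> t t01; rewrite alphaF// mulr_ge0 ?sqrtr_ge0// mulr_ge0 ?sqr_ge0//.
    exact: ltW.
  - by move=> t _; rewrite mulr_ge0 ?(ltW L_gt0)// mulr_ge0 ?sqr_ge0// ltW.
  apply: filterS alpha_speed; first exact: (ae_filter_ringOfSetsType mu).
  by move=> t H t01; rewrite H// alphaF// mulrC.
have gc : continuous (fun t => L * (bumps N M c t ^+ 2 * F t)).
  apply: continuousZ; apply: continuousM2 => //; apply: continuousX2.
  exact: bumps_continuous.
rewrite -[in X in `[0, X]%classic](@divff _ (N%:R : R)) ?gt_eqF//.
rewrite (Rintegral_cells _ N_gt0 gc) /bumps_mass !big_nat;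
  apply: ler_sum => i /andP[_ iN].
rewrite (_ : \sum_(0 <= m < M) _ = (f i * L) * \sum_(0 <=
  m < M) c i m ^+ 2 * (2 * N%:R)^-1); last first.
  by rewrite mulr_sumr; apply: eq_bigr => m _; ring.
have wc := @cell_bumps_continuous R N M c i.
rewrite -(Rintegral_cell_bumps N_gt0 M c i) -Rintegral_itvZ; last exact: continuousX2.
apply: le_Rintegral_itv => //; first exact/continuousZ/continuousX2.
move=> t it ti; rewrite (bumps_cell N_gt0 M c iN) ?it//.
have [gi|/(bad_cell t iN)[-> _]] := boolP (good i); last first.
  by rewrite expr0n/= mulr0 mul0r mulr0.
have /andP[fF _] := f_good iN gi (introT andP (conj it ti)).
set X := _ ^+ 2; rewrite (_ : f i * L * X = L * (X * f i)); last by ring.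
by rewrite ler_pM2l// ler_wpM2l// sqr_ge0.
Qed.

(** [F] is bounded above in the gradient term and below in the angular term. After that both terms
    are diagonal in the coefficients, and admissibility compares them one by one. *)
Lemma rayleigh_numerator : 0 <= Lambda ->
  Rintegral mu `[0, 1] (fun t =>
    derive1 (bumps N M c) t ^+ 2 * (alpha t).1 / speed alpha t +
    k%:R ^+ 2 * bumps N M c t ^+ 2 * speed alpha t / (alpha t).1) <=
  Lambda * bumps_mass.
Proof.
move=> Lambda_ge0.
pose A i := kappa * f i / L; pose B i := k%:R ^+ 2 * L / f i.
have A0 i : 0 <= A i.
  by apply: divr_ge0; [apply: mulr_ge0 => //; exact: ltW|exact: ltW].
have B0 i : 0 <= B i.
  by apply: divr_ge0; [apply: mulr_ge0; [exact: sqr_ge0|exact: ltW]|exact: ltW].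
pose g i t := A i * cell_dbumps N M c i t ^+ 2 + B i * cell_bumps N M c i t ^+ 2.
have c1 i : continuous (fun t => A i * cell_dbumps N M c i t ^+ 2).
  exact/continuousZ/continuousX2/cell_dbumps_continuous.
have c2 i : continuous (fun t => B i * cell_bumps N M c i t ^+ 2).
  exact/continuousZ/continuousX2/cell_bumps_continuous.
have gc i : continuous (g i) by move=> x; apply: cvgD; [exact: c1|exact: c2].
apply: (@le_trans _ _ (\sum_(0 <= i < N) Rintegral mu `[i%:R / N%:R,
  i.+1%:R / N%:R] (g i))).
  apply: Rintegral_cells_le => //.
  - move=> t t01; rewrite alphaF ?in_itv//; have F0 := ltW (F_gt0 t).
    have S0 : 0 <= speed alpha t by exact: sqrtr_ge0.
    apply: addr_ge0; apply: divr_ge0 => //; apply: mulr_ge0 => //; first exact: sqr_ge0.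
    by apply: mulr_ge0; exact: sqr_ge0.
  - by move=> i t; rewrite addr_ge0// mulr_ge0 ?sqr_ge0.
  apply: filterS alpha_speed; first exact: (ae_filter_ringOfSetsType mu).
  move=> t H i iN iti.
  have iti' : i%:R / N%:R <= t <= i.+1%:R / N%:R by case/andP: iti => /ltW -> /ltW ->.
  have t01 : t \in `[0, 1].
    rewrite in_itv/=; case/andP: iti' => it ti; apply/andP; split.
      by rewrite (le_trans _ it)// divr_ge0.
    by rewrite (le_trans ti)// ler_pdivrMr// mul1r ler_nat.
  rewrite (bumps_derive1 N_gt0 M c iN iti) (bumps_cell N_gt0 M c iN iti') H// alphaF// /g.
  have [gi|/(bad_cell t iN)[-> ->]] := boolP (good i); last first.
    by rewrite expr0n/= !(mul0r, mulr0).
  have /andP[fF Ff] := f_good iN gi iti'.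
  apply: lerD.
    rewrite /A [leRHS]mulrC -mulrA ler_wpM2l ?sqr_ge0//.
    by rewrite ler_pM2r ?invr_gt0.
  rewrite /B (_ : k%:R ^+ 2 * _ * L / F t =
    (k%:R ^+ 2 * L * cell_bumps N M c i t ^+ 2) * (F t)^-1); last by ring.
  rewrite (_ : k%:R ^+ 2 * L / f i * _ =
    (k%:R ^+ 2 * L * cell_bumps N M c i t ^+ 2) * (f i)^-1); last by ring.
  rewrite ler_wpM2l ?lef_pV2 ?posrE//.
  by rewrite mulr_ge0 ?sqr_ge0// mulr_ge0 ?sqr_ge0// ltW.
rewrite /bumps_mass mulr_sumr !big_nat; apply: ler_sum => i /andP[_ iN].
rewrite /g Rintegral_itvD// !Rintegral_itvZ; last 2 first.
- exact/continuousX2/cell_bumps_continuous.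
- exact/continuousX2/cell_dbumps_continuous.
rewrite (Rintegral_cell_bumps N_gt0) (Rintegral_cell_dbumps N_gt0).
rewrite !mulr_sumr -big_split/= !big_nat; apply: ler_sum => m /andP[_ mM].
have [->|cim] := eqVneq (c i m) 0; first by rewrite !(mul0r, expr0n, mulr0, addr0).
have /andP[_ adm] := c_admissible iN mM cim.
rewrite (_ : A i * _ + _ = c i m ^+ 2 * (f i * L * (2 * N%:R)^-1) *
   (kappa * freq N m ^+ 2 / L ^+ 2 + k%:R ^+ 2 / f i ^+ 2)); last first.
  by rewrite /A /B; field; rewrite !gt_eqF//.
rewrite [leRHS]mulrC ler_wpM2l// mulr_ge0 ?sqr_ge0// mulr_ge0 ?invr_ge0 ?mulr_ge0//.
  exact: ltW.
exact: ltW.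
Qed.

Lemma rayleigh_bumps_le : 0 <= Lambda -> 0 < bumps_mass ->
  rayleigh alpha k (bumps N M c) <= Lambda.
Proof.
move=> Lambda_ge0 mass; rewrite /rayleigh.
have den := rayleigh_denominator.
rewrite ler_pdivrMr; last exact: lt_le_trans den.
apply: le_trans (rayleigh_numerator Lambda_ge0) _.
by rewrite ler_wpM2l.
Qed.

End one_combination.

Lemma bumps_eq0 (c : nat -> nat -> R) : (forall t, bumps N M c t = 0) ->
  forall i m, (i < N)%N -> (m < M)%N -> c i m = 0.
Proof.
move=> w0 i m iN mM.
have : Rintegral mu `[i%:R / N%:R, i.+1%:R / N%:R] (fun t =>
  cell_bumps N M c i t ^+ 2) = 0.
  rewrite -[RHS](mul0r (i.+1%:R / N%:R - i%:R / N%:R)) -Rintegral_itv_cst//.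
  apply: eq_Rintegral => t /set_mem/=; rewrite in_itv/= => it.
  by rewrite -(bumps_cell N_gt0 M c iN it) w0 expr0n.
rewrite (Rintegral_cell_bumps N_gt0) => /eqP.
have pos (j : nat) : 0 <= c i j ^+ 2 * (2 * N%:R)^-1 by rewrite mulr_ge0 ?sqr_ge0//
  invr_ge0 mulr_ge0.
rewrite psumr_eq0// => /allP/(_ m); rewrite mem_index_iota mM => /(_ isT).
rewrite /= mulf_eq0 sqrf_eq0 => /orP[/eqP//|].
by rewrite gt_eqF// invr_gt0 mulr_gt0.
Qed.

Lemma lambda_kn_le (n : nat) (iota_ : 'I_n -> nat * nat) : 0 <= Lambda ->
  injective iota_ ->
  (forall r, [/\ ((iota_ r).1 < N)%N, ((iota_ r).2 < M)%N &
     admissible (iota_ r).1 (iota_ r).2]) ->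
  (lambda_kn alpha k n <= Lambda%:E)%E.
Proof.
move=> Lambda_ge0 iota_inj iotaP.
pose b r := bump N (iota_ r).1 (iota_ r).2 : R -> R.
(* Lists the coefficients by cell and frequency; as [iota_] is injective, the entry at [iota_ r] is
   [a r], and all entries off its image are 0. *)
pose coef (a : 'I_n -> R) i m := \sum_(r < n | iota_ r == (i, m)) a r.
have bE a t : \sum_(r < n) a r * b r t = bumps N M (coef a) t.
  rewrite /bumps /coef.
  under [RHS]eq_bigr => i _ do under eq_bigr => m _ do rewrite big_distrl big_mkcond/=.
  under [RHS]eq_bigr => i _ do rewrite exchange_big/=.
  rewrite exchange_big/=; apply: eq_bigr => r _.
  have [i1 m1 _] := iotaP r.
  rewrite (bigD1_seq (iota_ r).1)/= ?mem_index_iota ?iota_uniq//.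
  rewrite (bigD1_seq (iota_ r).2)/= ?mem_index_iota ?iota_uniq//.
  rewrite -surjective_pairing eqxx !big1 ?addr0// => [i ir|m mr].
    rewrite big1// => m _; case: eqP => // E; by move: ir; rewrite E eqxx.
  by case: eqP => // E; move: mr; rewrite E eqxx.
have coef0 a : (forall i m, (i < N)%N -> (m < M)%N -> coef a i m = 0) ->
    forall r, a r = 0.
  move=> c0 r; have [i1 m1 _] := iotaP r.
  have := c0 _ _ i1 m1; rewrite /coef -surjective_pairing.
  by rewrite (big_pred1 r)// => s; rewrite (inj_eq iota_inj).
pose W := [set w | exists a : 'I_n -> R, w = fun t => \sum_(r < n) a r * b r t].
apply: (@le_trans _ _ (ereal_sup [set (rayleigh alpha k w)%:E | w in W `\ (fun=> 0)])).
  apply: ereal_inf_lbound; exists W => //; exists b; split => //.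
    by move=> r; apply: bump_Lip0 => //; have [] := iotaP r.
  move=> a a0; apply: coef0; apply: bumps_eq0 => t; by rewrite -bE.
apply: ge_ereal_sup => _ [w [[a wE] w0] <-]; rewrite lee_fin.
have {}wE : w = bumps N M (coef a) by rewrite wE; apply/funext => t; exact: bE.
rewrite wE; apply: rayleigh_bumps_le => //.
  move=> i m iN mM; apply: contraNT => nadm; rewrite /coef big1// => r /eqP rE.
  by have [_ _] := iotaP r; rewrite rE (negbTE nadm).
rewrite lt_neqAle eq_sym; apply/andP; split; last first.
  apply: sumr_ge0 => i _; apply: sumr_ge0 => m _.
  rewrite mulr_ge0 ?sqr_ge0// mulr_ge0 ?invr_ge0 ?mulr_ge0//; exact: ltW.
apply/negP; rewrite /bumps_mass.
have pos i m : 0 <= coef a i m ^+ 2 * (f i * L * (2 * N%:R)^-1).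
  rewrite mulr_ge0 ?sqr_ge0// mulr_ge0 ?invr_ge0 ?mulr_ge0//; exact: ltW.
rewrite psumr_eq0; last by move=> i _; apply: sumr_ge0 => m _.
move=> /allP H; apply: w0 => /=; rewrite wE; apply/funext => t.
have c0 i m : (i < N)%N -> (m < M)%N -> coef a i m = 0.
  move=> iN mM; have := H i; rewrite mem_index_iota iN => /(_ isT)/=.
  rewrite psumr_eq0// => /allP/(_ m); rewrite mem_index_iota mM => /(_ isT)/=.
  rewrite mulf_eq0 sqrf_eq0 => /orP[/eqP//|].
  by rewrite gt_eqF// mulr_gt0 ?mulr_gt0// invr_gt0 mulr_gt0.
rewrite /bumps big_nat big1// => i /andP[_ iN]; rewrite big_nat big1// => m /andP[_ mM].
by rewrite c0// mul0r.
Qed.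

End rayleigh_quotients.

(* Without an enumeration lambda takes its default value 0, so its existence
   is not needed for upper bounds. *)
Lemma lambda_le_count (R : realType) (alpha : R ->
  R * R) (Lambda : R) (Q : seq (int * nat)) (j : nat) :
  0 <= Lambda -> uniq Q ->
  (forall x, x \in Q -> (lambda_kn alpha `|x.1|%N x.2.+1 <= Lambda%:E)%E) ->
  (0 < j <= size Q)%N -> (lambda alpha j <= Lambda%:E)%E.
Proof.
move=> Lambda_ge0 uQ QL /andP[j0 jQ]; rewrite /lambda.
case: xgetP => [l -> [l_homo [e [[e' eK e'K] lE]]]|_]; last by rewrite lee_fin.
(* At least [j] distinct places cannot all lie below [j.-1], the place of the j-th eigenvalue when
   counting from 0. *)
have [x xQ xj] : exists2 x, x \in Q & (j.-1 <= e' x)%N.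
  apply: contrapT => H; have : (size (map e' Q) <= size (iota 0 j.-1))%N.
    apply: uniq_leq_size; first by rewrite map_inj_uniq//; exact: can_inj e'K.
    move=> y /mapP[x xQ ->]; rewrite mem_iota add0n leq0n/= ltnNge.
    by apply/negP => xj; apply: H; exists x.
  by rewrite size_map size_iota => /(leq_trans jQ); rewrite -ltnS prednK// ltnn.
by apply: le_trans (l_homo _ _ xj) _; rewrite lE e'K; exact: QL.
Qed.

Lemma size_dep_pairs (T : eqType) (s : seq T) (n : T -> nat) :
  uniq s ->
  uniq [seq (x, m) | x <- s, m <- iota 0 (n x)] /\
  size [seq (x, m) | x <- s, m <- iota 0 (n x)] = \sum_(x <- s) n x.
Proof.
move=> us; split.
  apply: allpairs_uniq_dep => //; first by move=> x _; exact: iota_uniq.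
  by move=> [x m] [x' m'] _ _ /= [-> ->].
rewrite size_allpairs_dep sumnE big_map; apply: eq_bigr => x _.
by rewrite size_iota.
Qed.

(** * Counting the eigenvalues below a bound *)

Section counting.
Context {R : realType}.
Local Notation mu := (@lebesgue_measure R).
Variables (alpha : R -> R * R) (L : R) (F : R -> R).
Hypotheses (L_gt0 : 0 < L) (F_gt0 : forall t, 0 < F t).
Hypothesis FL : forall s t, `|F s - F t| <= L * `|s - t|.
Hypothesis alphaF : forall t : R, t \in `[0, 1] -> (alpha t).1 = F t.
Hypothesis alpha_speed :
  {ae mu, forall t : R, t \in `[0, 1] -> speed alpha t = L}.
Variables (N : nat) (delta eta Lambda : R).
Hypotheses (N_gt0 : (0 < N)%N) (eta_gt0 : 0 < eta) (eta_delta : eta <= delta / 2).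
Hypotheses (LN : L / N%:R <= eta) (LN' : eta / 2 <= L / N%:R) (Lambda_ge1 : 1 <= Lambda).

Let n0 : 0 < N%:R :> R. Proof. by rewrite ltr0n. Qed.
Let l0 : 0 < L / N%:R. Proof. by rewrite divr_gt0. Qed.
Let delta_gt0 : 0 < delta. Proof. by move: eta_gt0 eta_delta; lra. Qed.
Let kappa := 1 + 4 * eta / delta.
Let kappa_ge1 : 1 <= kappa.
Proof. by rewrite lerDl divr_ge0// ?mulr_ge0// ltW. Qed.
Let Lambda_gt0 : 0 < Lambda. Proof. exact: lt_le_trans Lambda_ge1. Qed.
Let rL := Num.sqrt Lambda.
Let rL_ge1 : 1 <= rL. Proof. by rewrite /rL -[leLHS]sqrtr1 ler_wsqrtr. Qed.
Let rL2 : rL ^+ 2 = Lambda. Proof. by rewrite sqr_sqrtr// ltW. Qed.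

Let good i := delta <= F (i%:R / N%:R).
(** The value 1 on the discarded cells only keeps [f] positive everywhere. *)
Let f i := if good i then grid_height L F N i else 1.
Let f_ge i : good i -> delta / 2 <= f i.
Proof. by move=> gi; rewrite /f gi; exact: (grid_height_gt eta_delta LN). Qed.
Let f_gt0 i : 0 < f i.
Proof.
have [gi|ngi] := boolP (good i); last by rewrite /f (negbTE ngi).
by apply: lt_le_trans (f_ge gi); rewrite divr_gt0.
Qed.

Let f_good i t : (i < N)%N -> good i -> i%:R / N%:R <= t <= i.+1%:R / N%:R ->
  f i <= F t <= kappa * f i.
Proof.
move=> _ gi /andP[it ti]; rewrite /f gi.
have /andP[-> h] := grid_height_le L_gt0 FL it ti; rewrite (le_trans h)//.
exact: (grid_height_kappa eta_gt0 eta_delta LN).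
Qed.

(** [a i] and [b] are semi-axes: the inequality in [admissible] says that (k / a i, (m + 1) / b)
    lies in the unit disc. *)
Let a i := f i * rL.
Let b := L / N%:R * rL / (pi * Num.sqrt kappa).
Let rows k i := if good i then lattice_row (a i) b k else 0%N.

Let sk_gt0 : 0 < Num.sqrt kappa.
Proof. by rewrite sqrtr_gt0; exact: lt_le_trans kappa_ge1. Qed.
Let rL_gt0 : 0 < rL. Proof. exact: lt_le_trans rL_ge1. Qed.
Let a_gt0 i : 0 < a i. Proof. by rewrite mulr_gt0. Qed.
Let b_gt0 : 0 < b.
Proof. by apply: divr_gt0; apply: mulr_gt0 => //; exact: pi_gt0. Qed.

Let rows_admissible k i m : (m < rows k i)%N ->
  (m < (Num.truncn b).+1)%N /\ admissible L N k good f kappa Lambda i m.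
Proof.
rewrite /rows /admissible; case: ifP => // _; rewrite /lattice_row truncn_gt_nat.
set s := Num.sqrt _ => ms.
have s_gt0 : 0 < s.
  rewrite lt_neqAle sqrtr_ge0 andbT eq_sym; apply/eqP => s0.
  by move: ms; rewrite s0 mulr0 leNgt ltr0n.
have s2 : s ^+ 2 = 1 - (k%:R / a i) ^+ 2.
  by rewrite sqr_sqrtr// ltW// -sqrtr_gt0.
have s1 : s <= 1.
  have s0' := ltW s_gt0; rewrite -(@ler_pXn2r _ 2) ?nnegrE// s2 expr1n.
  by rewrite lerBlDr lerDl sqr_ge0.
split.
  rewrite ltnS ltnW// truncn_gt_nat (le_trans ms)//.
  by rewrite -[leRHS]mulr1 ler_wpM2l// ltW.
have : m.+1%:R ^+ 2 <= (b * s) ^+ 2.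
  by rewrite ler_pXn2r ?nnegrE// mulr_ge0// ltW.
rewrite exprMn s2 => h.
have bE : kappa * freq N m ^+ 2 / L ^+ 2 = Lambda / b ^+ 2 * m.+1%:R ^+ 2.
  rewrite /freq /b -rL2 -[in LHS](@sqr_sqrtr _ kappa); last first.
    exact: le_trans kappa_ge1.
  by move: (pi_gt0 R); move: (@pi R) => p p0; field; rewrite !gt_eqF.
have aE : k%:R ^+ 2 / f i ^+ 2 = Lambda * (k%:R / a i) ^+ 2.
  by rewrite /a -rL2; field; rewrite !gt_eqF.
rewrite bE aE -[leRHS]mulr1 -mulrA -mulrDr ler_pM2l//.
rewrite -lerBrDr mulrC ler_pdivrMr ?exprn_gt0//.
by rewrite [leRHS]mulrC.
Qed.

Let total k := (\sum_(0 <= i < N) rows k i)%N.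

(** The admissible pairs (i, m) for this k number [total k], and the first n + 1 of them span a test
    space. *)
Let lambda_kn_total k n : (n < total k)%N ->
  (lambda_kn alpha k n.+1 <= Lambda%:E)%E.
Proof.
move=> nk; pose P := [seq (i, m) | i <- index_iota 0 N, m <- iota 0 (rows k i)].
have [uP sP] := @size_dep_pairs _ (index_iota 0 N) (rows k) (iota_uniq _ _).
have lt_r (r : 'I_n.+1) : (r < size P)%N by rewrite sP (leq_trans (ltn_ord r)).
apply: (lambda_kn_le L_gt0 (lip_continuous FL) F_gt0 alphaF alpha_speed N_gt0
  (le_trans ler01 kappa_ge1) f_gt0 f_good
  (M := (Num.truncn b).+1) (iota_ := fun r : 'I_n.+1 => nth (0%N, 0%N) P r)).
- exact: ltW.
- move=> r r' /eqP; rewrite nth_uniq// => /eqP; exact: val_inj.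
- move=> r; have := mem_nth (0%N, 0%N) (lt_r r).
  case/allpairsPdep => i [m [iN mrow ->]]/=.
  move: iN mrow; rewrite mem_index_iota mem_iota add0n => /= iN /rows_admissible[].
  by split.
Qed.

(** The sum is a convenient number above every [Num.truncn (a i)], so no nonempty row is missed. *)
Let K := (\sum_(0 <= i < N) Num.truncn (a i)).+1.

(** The errors [2 * a i], 2 and [b] of [lattice_count] are each bounded by a multiple of
    [f i * (L / N%:R) * rL], using that the height is at least [delta / 2], the arc length at least
    [eta / 2] and [rL] at least 1. So their sum over the cells is controlled by [grid_area],
    whatever [N] and [L] are. *)
Let count_ge : grid_area L F N delta * (Lambda / (2 * kappa) -
    (4 / eta + 8 / (delta * eta) + 2 / delta) * rL) <=
  2 * (\sum_(0 <= k < K) total k)%:R - (total 0)%:R.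
Proof.
rewrite /total natr_sum mulr_sumr natr_sum.
under [X in _ <= X - _]eq_bigr => k _ do rewrite natr_sum mulr_sumr.
rewrite exchange_big/= -sumrB /grid_area mulr_suml big_mkcond/= !big_nat.
apply: ler_sum => i /andP[_ iN]; rewrite -/(good i) /rows.
case: ifP => gi; last by rewrite big1 ?subr0// => k _; rewrite mulr0.
rewrite -mulr_sumr.
have aK : (Num.truncn (a i) < K)%N.
  by rewrite ltnS (bigD1_seq i)/= ?mem_index_iota ?iota_uniq// leq_addr.
apply: le_trans _ (lattice_count (a_gt0 i) b_gt0 aK).
have fE : grid_height L F N i = f i by rewrite /f gi.
rewrite fE; set l := L / N%:R.
have f_d := f_ge gi; have l_e : eta / 2 <= l by exact: LN'.
have fl0 : 0 < f i * l by rewrite mulr_gt0.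
have sk1 : Num.sqrt kappa <= kappa.
  rewrite -[leRHS]sqr_sqrtr ?expr2; last exact: le_trans kappa_ge1.
  by rewrite ler_peMl ?(ltW sk_gt0)// -[leLHS]sqrtr1 ler_wsqrtr.
have ab : f i * l * (Lambda / (2 * kappa)) <= pi / 2 * (a i * b).
  rewrite (_ : pi / 2 * (a i * b) = f i * l * (Lambda / (2 * Num.sqrt kappa)));
    last first.
    rewrite /a /b -/l -rL2; move: (pi_gt0 R); move: (@pi R) => p p0.
    by field; rewrite !gt_eqF.
  rewrite ler_pM2l// ler_pM2l// lef_pV2 ?posrE ?mulr_gt0//.
    by rewrite ler_pM2l.
  exact: lt_le_trans kappa_ge1.
have e1 : 2 * a i <= 4 / eta * (f i * l * rL).
  rewrite (_ : 2 * a i = 4 / eta * (f i * (eta / 2) * rL)); last first.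
    by rewrite /a; field; rewrite gt_eqF.
  rewrite ler_pM2l ?divr_gt0// ler_pM2r// ler_pM2l//.
have e2 : 2 <= 8 / (delta * eta) * (f i * l * rL).
  rewrite [leLHS](_ : _ = 8 / (delta * eta) * (delta / 2 * (eta / 2) * 1)); last first.
    by field; rewrite !gt_eqF.
  rewrite ler_pM2l ?divr_gt0 ?mulr_gt0//.
  by apply: ler_pM => //; [rewrite mulr_ge0// divr_ge0// ltW|
    apply: ler_pM => //; rewrite divr_ge0// ltW].
have e3 : b <= 2 / delta * (f i * l * rL).
  apply: (@le_trans _ _ (l * rL)).
    rewrite /b -/l ler_pdivrMr; last by apply: mulr_gt0 => //; exact: pi_gt0.
    rewrite -[leLHS]mulr1 ler_pM2l; last exact: mulr_gt0.
    apply: (@le_trans _ _ (1 * 1)); first by rewrite mulr1.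
    apply: ler_pM => //; first by have := pi_ge2 R; lra.
    by rewrite -[leLHS]sqrtr1 ler_wsqrtr.
  rewrite (_ : l * rL = 2 / delta * (delta / 2 * l * rL)); last first.
    by field; rewrite gt_eqF.
  by rewrite ler_pM2l ?divr_gt0// ler_pM2r// ler_pM2r.
have pos : 0 < rL by [].
rewrite mulrBr; move: ab e1 e2 e3.
rewrite (_ : f i * l * ((4 / eta + 8 / (delta * eta) + 2 / delta) * rL) =
  4 / eta * (f i * l * rL) + 8 / (delta * eta) * (f i * l * rL) +
    2 / delta * (f i * l * rL)); last by ring.
set x1 := 4 / eta * _; set x2 := _ * (f i * l * rL); set x3 := _ * (f i * l * rL).
by lra.
Qed.

Lemma lambda_le_grid (j : nat) : (0 < j)%N ->
  j%:R <= grid_area L F N delta * (Lambda / (2 * kappa) -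
    (4 / eta + 8 / (delta * eta) + 2 / delta) * rL) ->
  (lambda alpha j <= Lambda%:E)%E.
Proof.
(* [Negz k] is -(k + 1), so these are the integers from -(K - 1) to K - 1, each once; this matches
   the double counting of k <> 0. *)
move=> j0 jle; pose Zs := [seq Posz k | k <- iota 0 K] ++ [seq Negz k | k <- iota 0 K.-1].
have uZ : uniq Zs.
  rewrite cat_uniq !map_inj_uniq ?iota_uniq ?andbT//=; last 2 first.
  - by move=> ? ? [].
  - by move=> ? ? [].
  by apply/hasPn => _ /mapP[k _ ->]; apply/negP => /mapP[].
have [uQ sQ] := size_dep_pairs (fun z : int => total `|z|%N) uZ.
apply: (lambda_le_count (ltW Lambda_gt0) uQ).
  move=> x /allpairsPdep[z [n [_ nz ->]]]/=; apply: lambda_kn_total.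
  by move: nz; rewrite mem_iota.
rewrite j0 sQ /Zs big_cat !big_map/= -(ler_nat R) (le_trans jle)//.
apply: le_trans count_ge _.
have iotaE n : iota 0 n = index_iota 0 n by rewrite /index_iota subn0.
rewrite !iotaE natrD.
have -> : (\sum_(0 <= k < K) total k = total 0 + \sum_(0 <= k < K.-1) total k.+1)%N.
  by rewrite /K big_nat_recl.
have -> : (\sum_(0 <= k < K.-1) total `|Negz k| = \sum_(0 <= k < K.-1) total k.+1)%N.
  by [].
by rewrite natrD; lra.
Qed.

End counting.

(** * Uniform bounds and the conclusion *)

Lemma limn_einf_gt (R : realType) (u : nat -> \bar R) (a b : R) :
  (a%:E <= limn_einf u)%E -> b < a -> \forall j \near \oo, (b%:E < u j)%E.
Proof.
move=> au ba.
have ul : (b%:E < ereal_sup (range (einfs u)))%E.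
  have <- : limn_einf u = ereal_sup (range (einfs u)).
    by rewrite limn_einf_lim; apply/cvg_lim => //; exact: cvg_einfs_sup.
  by rewrite (lt_le_trans _ au)// lte_fin.
have [n bn] : exists n, (b%:E < einfs u n)%E.
  apply: contrapT => H; move: ul; rewrite ltNge => /negP; apply.
  apply: ge_ereal_sup => _ [n _ <-]; rewrite leNgt; apply/negP => bn.
  by apply: H; exists n.
exists n => // j /= nj; apply: lt_le_trans bn _.
by apply: ereal_inf_lbound; exists j.
Qed.

(** The arc length stays between [eta / 2] and [eta] however long the meridian is, which makes the
    error terms uniform. *)
Lemma mesh_choice (R : realType) (L eta : R) : 0 < eta -> 0 < L ->
  exists N : nat, [/\ (0 < N)%N, L / N%:R <= eta & eta <= L -> eta / 2 <= L / N%:R].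
Proof.
move=> e0 L0; exists (Num.truncn (L / eta)).+1.
have Le : 0 <= L / eta by rewrite divr_ge0// ltW.
have /andP[h1 h2] := truncn_itv Le.
have n0 : 0 < (Num.truncn (L / eta)).+1%:R :> R by rewrite ltr0n.
split=> // [|eL].
  by rewrite ler_pdivrMr// mulrC -ler_pdivrMr// ltW.
rewrite ler_pdivlMr// -[(Num.truncn _).+1%:R]natr1 mulrDr mulr1.
have : eta / 2 * (Num.truncn (L / eta))%:R <= eta / 2 * (L / eta).
  by rewrite ler_pM2l// divr_gt0.
rewrite (_ : eta / 2 * (L / eta) = L / 2); last by field; rewrite gt_eqF.
by lra.
Qed.

Lemma area_gt0 (R : realType) (p q : R * R) (alpha : R -> R * R) :
  p != q -> meridian p q alpha -> 0 < area alpha.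
Proof.
move=> pq /(meridian_arc pq)[L [F [G [L0 FG _ F0 [_ _ ->]]]]].
have [FC _] := equilip_lip (ltW L0) FG.
have Fc := lip_continuous FC.
rewrite !mulr_gt0 ?pi_gt0//.
have [m _ mP] := EVT_min (@ler01 R) (continuous_subspaceT Fc).
apply: (@lt_le_trans _ _ (F m * (1 - 0))); first by rewrite subr0 mulr1.
rewrite -Rintegral_itv_cst//; apply: le_Rintegral_itv => //.
  by move=> x; exact: cvg_cst.
by move=> x x0 x1; apply: mP; rewrite in_itv/= x0.
Qed.

Section area_bounds.
Context {R : realType}.
Variables (p q : R * R) (pq : p != q).

Let pi0 : 0 < pi :> R. Proof. exact: pi_gt0. Qed.

Lemma meridian_off_axis (Amin : R) : 0 < Amin ->
  Amin < pi * p.1 ^+ 2 + pi * q.1 ^+ 2 ->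
  exists delta e : R, [/\ 0 < delta, 0 < e & forall alpha, meridian p q alpha ->
    area alpha <= Amin + e -> forall t, t \in `[0, 1] -> delta <= (alpha t).1].
Proof.
set D := pi * _ + _ => A0 AD.
(* [delta] makes the loss [5 * pi * delta ^+ 2] equal to half of [D - Amin]. The other half is
   [4 * e], while the area excess and the two errors caused by [sigma] amount to at most [3 * e]. *)
pose e := (D - Amin) / 8.
have e0 : 0 < e by rewrite /e divr_gt0// subr_gt0.
pose delta := Num.sqrt ((D - Amin) / (10 * pi)).
have delta_gt0 : 0 < delta by rewrite sqrtr_gt0 divr_gt0 ?subr_gt0// mulr_gt0.
have delta2 : 5 * pi * delta ^+ 2 = (D - Amin) / 2.
  rewrite sqr_sqrtr; last by rewrite divr_ge0 ?subr_ge0 ?mulr_ge0// ltW.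
  by move: (pi_gt0 R) (D); move: (@pi R) => P P0 D'; field; rewrite gt_eqF.
pose sigma := Num.min 1 (e / Amin).
have s0 : 0 < sigma by rewrite lt_min ltr01 divr_gt0.
pose eta := Num.min (delta / 2) (sigma * delta / 4).
have eta0 : 0 < eta by rewrite lt_min !divr_gt0// mulr_gt0.
exists (delta / 2), e; split => //; first by rewrite divr_gt0.
move=> alpha malpha aA t t01; rewrite leNgt; apply/negP => at_.
have [L [F [G [L0 FG _ F0 [aE _ areaE]]]]] := meridian_arc pq malpha.
have [FC _] := equilip_lip (ltW L0) FG.
have [N [N0 LN _]] := mesh_choice eta0 L0.
have eta_delta : eta <= delta / 2 by rewrite ge_min lexx.
move: (t01); rewrite in_itv/= => /andP[t0 t1].
have Ft : F t < delta / 2 by move: at_; rewrite aE.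
have := grid_area_near_axis L0 F0 FC N0 eta0 eta_delta LN t0 t1 Ft.
have := grid_area_le delta L0 F0 FC N0.
set S := grid_area _ _ _ _; set I := Rintegral _ _ _ in areaE * => SI.
have [_ _ ap aq _] := malpha.
have in0 : (0 : R) \in `[0, 1] by rewrite in_itv/= lexx ler01.
have in1 : (1 : R) \in `[0, 1] by rewrite in_itv/= lexx ler01.
have -> : F 0 = p.1 by rewrite -ap aE.
have -> : F 1 = q.1 by rewrite -aq aE.
set k := 1 + _ => dip.
have k1 : k <= 1 + sigma.
  rewrite lerD2l ler_pdivrMr// mulrC -ler_pdivlMr//.
  by rewrite ge_min lexx orbT.
have k0 : 0 < k by rewrite /k ltr_wpDr// divr_ge0// ?mulr_ge0// ltW.
have piS : 2 * pi * S <= Amin + e by apply: le_trans aA;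
  rewrite areaE ler_pM2l// mulr_gt0.
have sA : sigma * Amin <= e by rewrite -ler_pdivlMr// ge_min lexx orbT.
have se : sigma * e <= e by rewrite -[leRHS]mul1r ler_pM2r// ge_min lexx.
have : k * (2 * pi * S) <= (1 + sigma) * (Amin + e).
  apply: (@le_trans _ _ (k * (Amin + e))); first by rewrite ler_pM2l.
  by rewrite ler_pM2r// addr_gt0.
have : pi * (p.1 ^+ 2 + q.1 ^+ 2) <=
  pi * (2 * k * S + 5 * delta ^+ 2) by rewrite ler_pM2l.
rewrite (_ : pi * (_ + _) = D); last by rewrite /D mulrDr.
rewrite (_ : pi * (_ + _) = k * (2 * pi * S) + 5 * pi * delta ^+ 2); last by ring.
rewrite delta2 mulrDl mul1r mulrDr => h1 h2.
have : D <= Amin + e + (sigma * Amin + sigma * e) + (D - Amin) / 2 by lra.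
have : e * 8 = D - Amin by rewrite /e; field.
by lra.
Qed.

(** Neither [mu] nor the threshold for [j] depends on the meridian, so the bound applies to the j-th
    meridian at index j. *)
Lemma lambda_upper_bound (Amin e0 : R) : 0 < Amin -> 0 < e0 ->
  Amin < pi * p.1 ^+ 2 + pi * q.1 ^+ 2 ->
  exists2 mu : R, mu < 4 * pi / Amin & \forall j \near \oo, forall alpha,
    meridian p q alpha ->
    Amin + e0 < area alpha -> (lambda alpha j <= (mu * j%:R)%:E)%E.
Proof.
set D := pi * _ + _ => A0 e00 AD.
(* With this choice both alternatives of [grid_area_ge] give at least [S1]; in the second, half of
   [D - Amin] remains after the loss at the axis. *)
pose e1 := Num.min e0 ((D - Amin) / 2).
have e1_gt0 : 0 < e1 by rewrite lt_min e00 divr_gt0// subr_gt0.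
pose delta := Num.sqrt ((D - Amin) / (10 * pi)).
have delta_gt0 : 0 < delta by rewrite sqrtr_gt0 divr_gt0 ?subr_gt0// mulr_gt0.
have delta2 : 5 * pi * delta ^+ 2 = (D - Amin) / 2.
  rewrite sqr_sqrtr; last by rewrite divr_ge0 ?subr_ge0 ?mulr_ge0// ltW.
  by move: (pi_gt0 R) (D); move: (@pi R) => P P0 D'; field; rewrite gt_eqF.
(* [nu0] involves (1 + sigma) ^ 3, two factors from [k ^+ 2] and one from [mu]; this is at most 1 +
   7 sigma, less than 1 + e1 / Amin. *)
pose sigma := Num.min 1 (e1 / (8 * Amin)).
have s0 : 0 < sigma by rewrite lt_min ltr01 divr_gt0// mulr_gt0.
pose dist := Num.sqrt ((p.1 - q.1) ^+ 2 + (p.2 - q.2) ^+ 2).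
have dist_gt0 : 0 < dist.
  rewrite sqrtr_gt0 lt_neqAle eq_sym addr_ge0 ?sqr_ge0// andbT.
  apply: contraNN pq; rewrite paddr_eq0 ?sqr_ge0// !sqrf_eq0 !subr_eq0 =>
    /andP[/eqP h1 /eqP h2].
  by rewrite [p]surjective_pairing h1 h2 -surjective_pairing.
(* [dist] is a lower bound for the length of every meridian, as [mesh_choice] requires; the last
   bound gives [k <= 1 + sigma]. *)
pose eta := Num.min dist (Num.min (delta / 2) (sigma * delta / 4)).
have eta0 : 0 < eta by rewrite !lt_min dist_gt0 !divr_gt0// mulr_gt0.
have eta_delta : eta <= delta / 2 by rewrite !ge_min lexx orbT.
pose k := 1 + 4 * eta / delta.
have k0 : 0 < k by rewrite /k ltr_wpDr// divr_ge0// ?mulr_ge0// ltW.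
have k1 : k <= 1 + sigma.
  rewrite lerD2l ler_pdivrMr// mulrC -ler_pdivlMr//.
  by rewrite !ge_min lexx !orbT.
pose mu := 4 * pi / Amin / (1 + sigma).
have sig1 : 0 < 1 + sigma by rewrite ltr_wpDl.
have mu0 : 0 < mu by rewrite !divr_gt0// mulr_gt0.
exists mu.
  rewrite /mu ltr_pdivrMr// ltr_pMr ?ltrDl// divr_gt0// mulr_gt0//.
pose S1 := (Amin + e1) / (2 * pi * k).
have S10 : 0 < S1 by rewrite divr_gt0 ?addr_gt0// !mulr_gt0.
pose C := 4 / eta + 8 / (delta * eta) + 2 / delta.
have C0 : 0 < C by rewrite !addr_gt0 ?divr_gt0 ?mulr_gt0.
(* The surplus of the main term, per unit of [j]; it absorbs the error, which is of the order of the
   square root of [j]. *)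
pose nu := S1 * (mu / (2 * k)) - 1.
have nu0 : 0 < nu.
  rewrite /nu; have -> : S1 * (mu / (2 * k)) = (Amin + e1) / Amin / (k ^+ 2 * (1 +
    sigma)).
    rewrite /S1 /mu; move: (pi_gt0 R); move: (@pi R) => P P0.
    by field; rewrite !gt_eqF.
  rewrite subr_gt0 ltr_pdivlMr ?mulr_gt0 ?exprn_gt0// mul1r.
  apply: (@le_lt_trans _ _ ((1 + sigma) ^+ 2 * (1 + sigma))).
    by rewrite ler_pM2r// ler_pXn2r ?nnegrE// ltW.
  rewrite mulrDl divff ?gt_eqF//.
  have s1 : sigma <= 1 by rewrite ge_min lexx.
  have s2 : sigma * 8 <= e1 / Amin.
    have : sigma <= e1 / (8 * Amin) by rewrite ge_min lexx orbT.
    rewrite (_ : e1 / (8 * Amin) = e1 / Amin / 8); last by field; rewrite gt_eqF.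
    by rewrite ler_pdivlMr.
  have : sigma ^+ 2 <= sigma by rewrite expr2 ler_piMl// ltW.
  have : sigma ^+ 3 <= sigma.
    by rewrite exprS ler_piMr ?(ltW s0)// exprn_ile1// ltW.
  rewrite (_ : (1 + sigma) ^+ 2 * (1 + sigma) = 1 + 3 * sigma + 3 * sigma ^+ 2 +
    sigma ^+ 3); last by ring.
  by lra.
near=> j; move=> alpha malpha aA.
have j0 : (0 < j)%N by near: j; exact: nbhs_infty_gt.
have jr0 : 0 < j%:R :> R by rewrite ltr0n.
have j1 : mu^-1 <= j%:R by near: j; exact: nbhs_infty_ger.
have j2 : (S1 * C / nu) ^+ 2 * mu <= j%:R by near: j; exact: nbhs_infty_ger.
have [L [F [G [L0 FG _ F0 [aE aS areaE]]]]] := meridian_arc pq malpha.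
have [FC _] := equilip_lip (ltW L0) FG.
have [_ _ ap aq _] := malpha.
have in0 : (0 : R) \in `[0, 1] by rewrite in_itv/= lexx ler01.
have in1 : (1 : R) \in `[0, 1] by rewrite in_itv/= lexx ler01.
have F0p : F 0 = p.1 by rewrite -ap aE.
have F1q : F 1 = q.1 by rewrite -aq aE.
have Ld : dist <= L.
  rewrite -(@ler_pXn2r _ 2) ?nnegrE ?(ltW L0) ?sqrtr_ge0// sqr_sqrtr; last first.
    by rewrite addr_ge0 ?sqr_ge0.
  have := FG 0 1; rewrite sub0r mulrN mulr1 sqrrN.
  have -> : G 0 = p.2 by rewrite -ap aE.
  have -> : G 1 = q.2 by rewrite -aq aE.
  by rewrite F0p F1q.
have [N [N0 LN /(_ _)LN']] := mesh_choice eta0 L0.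
have {}LN' : eta / 2 <= L / N%:R by apply: LN'; apply: le_trans Ld; rewrite ge_min lexx.
have aF (t : R) : t \in `[0, 1] -> (alpha t).1 = F t by move=> /aE ->.
have Lambda1 : 1 <= mu * j%:R by rewrite mulrC -ler_pdivrMr// div1r.
have rE : Num.sqrt (mu * j%:R) ^+ 2 = mu * j%:R by rewrite sqr_sqrtr// mulr_ge0 ?ltW.
apply: (lambda_le_grid L0 F0 FC aF aS N0 eta0 eta_delta LN LN' Lambda1 j0).
rewrite -/k -/C; set r := Num.sqrt _ in rE *.
have r0 : 0 <= r by exact: sqrtr_ge0.
set S := grid_area _ _ _ _.
have S_ge : S1 <= S.
  rewrite /S1 ler_pdivrMr ?mulr_gt0//.
  have h1 : Amin + e1 <= Amin + e0 by rewrite lerD2l ge_min lexx.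
  have h2 : e1 <= (D - Amin) / 2 by rewrite ge_min lexx orbT.
  have [h|] := grid_area_ge L0 F0 FC N0 eta0 eta_delta LN; rewrite -/k -/S.
    apply: le_trans h1 _; apply: le_trans (ltW aA) _; rewrite areaE.
    rewrite (_ : S * _ = 2 * pi * (k * S)); last by ring.
    by rewrite ler_pM2l ?mulr_gt0.
  rewrite F0p F1q => h.
  have : pi * (p.1 ^+ 2 + q.1 ^+ 2) <=
    pi * (2 * k * S + 5 * delta ^+ 2) by rewrite ler_pM2l.
  rewrite (_ : pi * (_ + _) = D); last by rewrite /D mulrDr.
  rewrite (_ : pi * (_ + _) = S * (2 * pi * k) + 5 * pi * delta ^+ 2); last by ring.
  by rewrite delta2; lra.
have key : j%:R <= S1 * (mu * j%:R / (2 * k) - C * r).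
  have : S1 * C * r <= nu * j%:R.
    have h : S1 * C / nu * mu <= r.
      rewrite -(@ler_pXn2r _ 2) ?nnegrE// ?rE; last first.
        by rewrite mulr_ge0 ?(ltW mu0)// divr_ge0 ?(ltW nu0)// mulr_ge0 ?(ltW C0)// ltW.
      rewrite (_ : _ ^+ 2 = mu * ((S1 * C / nu) ^+ 2 * mu)); last by ring.
      by rewrite ler_pM2l.
    rewrite (_ : nu * j%:R = nu / mu * r * r); last first.
      by rewrite -mulrA -expr2 rE; field; rewrite gt_eqF.
    rewrite ler_wpM2r//.
    rewrite (_ : S1 * C = nu / mu * (S1 * C / nu * mu)); last by field; rewrite !gt_eqF.
    by rewrite ler_wpM2l// divr_ge0 ?ltW.
  have -> : nu * j%:R = S1 * (mu / (2 * k)) * j%:R - j%:R by rewrite /nu; ring.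
  by rewrite mulrBr -!mulrA; lra.
(* [S1] may be replaced by the larger [S] because [key] also shows that the bracket is
   nonnegative. *)
apply: (le_trans key); rewrite ler_wpM2r//.
by rewrite -(pmulr_rge0 _ S10) (le_trans _ key).
Unshelve. all: by end_near. Qed.

End area_bounds.

Lemma cvge0P (R : realType) (u : nat -> \bar R) : (forall j, 0 <= u j)%E ->
  (forall e : R, 0 < e -> \forall j \near \oo, (u j <= e%:E)%E) ->
  u j @[j --> \oo] --> 0%E.
Proof.
move=> u0 ue; apply/fine_cvgP; split.
  apply: filterS (ue 1 ltr01) => j u1; rewrite ge0_fin_numE//.
  by rewrite (le_lt_trans u1)// ltry.
apply/cvgrPdist_le => e e0; apply: filterS (ue e e0) => j uje.
rewrite sub0r normrN ger0_norm ?fine_ge0//= -lee_fin fineK//.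
by rewrite ge0_fin_numE// (le_lt_trans uje)// ltry.
Qed.

Theorem lemma4p5 (R : realType)
  (o u : 'rV[R]_3) (r1 h1 r2 h2 : R)
  (K : set (set 'rV[R]_3 * \bar R))
  (cat : R -> R * R) (Sigma : nat -> R -> R * R)
  (u_unit : enorm u = 1)
  (r1_gt0 : 0 < r1) (r2_gt0 : 0 < r2)
  (C1_neq_C2 : circle o u r1 h1 <> circle o u r2 h2)
  (K_plateau : plateau_class o u r1 h1 r2 h2 K)
  (cat_meridian : meridian (r1, h1) (r2, h2) cat)
  (cat_catenary : catenary_arc cat)
  (cat_min : unique_area_minimizer K (surface o u cat, (area cat)%:E))
  (Sigma_meridian :
     forall j, (0 < j)%N -> meridian (r1, h1) (r2, h2) (Sigma j))
  (Sigma_lambda :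
     ((4 * pi / area cat)%:E <=
        limn_einf (fun j => lambda (Sigma j) j * (j%:R^-1)%:E))%E) :
  (area (Sigma j) @[j --> \oo] --> area cat) /\
  (hausdorff_dist (surface o u (Sigma j)) (surface o u cat)
     @[j --> \oo] --> 0%E).
Proof.
have pq : (r1, h1) != (r2, h2).
  by apply/eqP => -[rE hE]; apply: C1_neq_C2; rewrite rE hE.
have A0 := area_gt0 pq cat_meridian.
have [Kmer Kdisc] := K_plateau; have [_ Kmin] := cat_min.
have min_le beta : meridian (r1, h1) (r2, h2) beta -> area cat <= area beta.
  move=> /Kmer Kb.
  have [E|ne] := pselect ((surface o u beta, (area beta)%:E) = (surface o u cat,
    (area cat)%:E)).
    by have /= <- := congr1 (fun x => fine x.2) E; exact: lexx.
  by have := Kmin _ Kb ne; rewrite /= lte_fin; exact: ltW.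
(* Minimizers agree as sets, whatever their parametrizations, and the Hausdorff distance sees only
   the sets. *)
have min_uniq beta : meridian (r1, h1) (r2, h2) beta -> area beta = area cat ->
    surface o u beta = surface o u cat.
  move=> /Kmer Kb bE; apply: contrapT => ne.
  have neX : (surface o u beta, (area beta)%:E) <> (surface o u cat, (area cat)%:E).
    by move=> E; apply: ne; exact: (congr1 fst E).
  by have := Kmin _ Kb neX; rewrite /= bE ltxx.
(* The discs meet the axis and so differ from the catenoid, hence the inequality is strict. *)
have A_disc : area cat < pi * (r1, h1).1 ^+ 2 + pi * (r2, h2).1 ^+ 2.
  have [_ cat0 _ _ _] := cat_meridian.
  have : (disc o u r1 h1 `|` disc o u r2 h2, (pi * r1 ^+ 2 + pi * r2 ^+ 2)%:E)
      <> (surface o u cat, (area cat)%:E).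
    move=> E; have /= /esym E1 := congr1 fst E.
    exact: (surface_neq_disc (ltW r1_gt0) cat0 E1).
  by move=> neX; have := Kmin _ Kdisc neX; rewrite /= lte_fin.
have area_le e : 0 < e -> \forall j \near \oo, area (Sigma j) <= area cat + e.
  move=> e0; have [mu mu_lt Hmu] := lambda_upper_bound pq A0 e0 A_disc.
  have Hl := limn_einf_gt Sigma_lambda mu_lt.
  near=> j; have j0 : (0 < j)%N by near: j; exact: nbhs_infty_gt.
  rewrite leNgt; apply/negP => lt_area.
  have lam : (lambda (Sigma j) j <= (mu * j%:R)%:E)%E.
    have H : forall alpha, meridian (r1, h1) (r2, h2) alpha ->
      area cat + e < area alpha -> (lambda alpha j <= (mu * j%:R)%:E)%E by near: j.
    exact: H (Sigma_meridian j j0) lt_area.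
  have : (mu%:E < lambda (Sigma j) j * (j%:R^-1)%:E)%E by near: j.
  rewrite ltNge => /negP; apply.
  have jr : 0 < j%:R :> R by rewrite ltr0n.
  rewrite (_ : mu%:E = ((mu * j%:R)%:E * (j%:R^-1)%:E)%E); last first.
    by rewrite -EFinM mulfK// gt_eqF.
  by rewrite lee_wpmul2r// lee_fin invr_ge0 ltW.
have meridians : \forall j \near \oo, meridian (r1, h1) (r2, h2) (Sigma j).
  by near=> j; apply: Sigma_meridian; near: j; exact: nbhs_infty_gt.
have area_cvg : area (Sigma j) @[j --> \oo] --> area cat.
  apply/cvgrPdist_le => e e0; apply: filterS2 (area_le e e0) meridians => j je mj.
  by rewrite distrC ger0_norm ?subr_ge0 ?min_le// lerBlDl.
split=> //; apply: cvge0P; first by move=> j; exact: hausdorff_surface_ge0.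
move=> e e0; apply: contrapT => Hbad.
(* If the distance exceeds [e] infinitely often, the cofinite filter restricted to these indices is
   proper. An ultrafilter refining it contains [B], yet along it the surfaces converge to the
   catenoid. *)
pose B : set nat := [set j | ~ (hausdorff_dist (surface o u (Sigma j)) (surface o u
  cat) <= e%:E)%E].
have PB : ProperFilter (within B \oo).
  apply: Build_ProperFilter_ex => P [n _ Pn]; apply: contrapT => H; apply: Hbad.
  exists n => // j nj; apply: contrapT => Bj; apply: H; exists j; exact: Pn.
have [U [UU BU]] := ultraFilterLemma PB.
have ooU P : (\forall j \near \oo, P j) -> U P.
  by move=> ooP; apply: BU; apply: filterS ooP => j Pj _.
have [delta [d [delta0 d0 off]]] := meridian_off_axis pq A0 A_disc.
have S_ge : \forall j \near U, forall t : R, t \in `[0, 1] -> delta <= (Sigma j t).1.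
  apply: ooU; apply: filterS2 (area_le d d0) meridians => j jd mj.
  exact: off.
have S_area : area (Sigma j) @[j --> U] --> area cat.
  by apply: cvg_trans area_cvg => P /ooU.
have [beta [mb ab Hunif]] := limit_meridian UU pq delta0 min_le (ooU _ meridians)
  S_ge S_area.
(* [hausdorff_surface_le] doubles the bound on the coordinates. *)
have e2 : 0 < e / 2 by rewrite divr_gt0.
have UB : U B by apply: BU; apply: nearW.
have [j [Bj Hj]] := filter_ex (filterI UB (Hunif _ e2)).
apply: Bj; rewrite -(min_uniq _ mb ab).
have := hausdorff_surface_le o u_unit (ltW e2) Hj.
by rewrite mulrC divfK.
Unshelve. all: by end_near. Qed.
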